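(* Let $d\ge2$, $\alpha\in(1,2)$, let $D\subset\mathbb{R}^d$ be a bounded $C^{1,1}$ open set with interior ball radius $R=R(D)$, and let $Y$ be the censored $\alpha$-stable process in $D$. There is a constant $c>1$ depending only on $Y$ (that is, on $d$, $\alpha$, $D$) such that the following holds. Suppose that $\{B(x_j,r_j)\}_{j\ge1}$ is a collection of balls with $B(x_j,2r_j)\subset D$, $\delta_D(x_j)<R/2$ and $\eta^*(r_j;x_j)<R/2$ for all $j$, and that the balls $\{B(x_j,\eta^*(r_j;x_j))\}_{j\ge1}$ are pairwise disjoint. If $E$ is a Borel set contained in $\bigcup_{j\ge1}B(x_j,r_j)$, then $$\mathrm{Cap}^D(E)\le\sum_{j\ge1}\mathrm{Cap}^D(B(x_j,r_j)\cap E)\le c\,\mathrm{Cap}^D(E).$$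
   Context: $\delta_D(x)=\mathrm{dist}(x,\partial D)$; $|\cdot|$ of a set is Lebesgue measure. Censored stable process: $Y=(Y_t,\mathbb{P}_x)_{x\in D}$ is the symmetric Hunt process on $D$ associated with the Dirichlet form $(\mathcal{E}^D,\mathcal{F}^D)$ on $L^2(D)$, where $$\mathcal{E}^D(u,v)=\tfrac12\mathcal{A}(d,-\alpha)\int_D\int_D\frac{(u(x)-u(y))(v(x)-v(y))}{|x-y|^{d+\alpha}}\,dy\,dx,$$ $\mathcal{A}(d,-\alpha)>0$ is the standard normalizing constant of the $\alpha$-stable process, and $\mathcal{F}^D$ is the closure of $C_c^\infty(D)$ under $\mathcal{E}^D+\langle\cdot,\cdot\rangle_{L^2(D)}$. Capacity: $\mathrm{Cap}^D$ is the (0-order) capacity of $Y$: $\mathrm{Cap}^D(U)=\inf\{\mathcal{E}^D(u,u):u\in\mathcal{F}^D,\ u\ge1\text{ a.e. on }U\}$ for open $U\subset D$, and $\mathrm{Cap}^D(E)=\inf\{\mathrm{Cap}^D(U):U\supset E\text{ open in }D\}$ for general $E\subset D$. Interior ball condition: $R=R(D)>0$ is a fixed number such that for every $x\in D$ with $\delta_D(x)<R$ there is $z\in\partial D$ with $|x-z|=\delta_D(x)$ and $B(y,R)\subset D$ where $y=z+R(x-z)/|x-z|$. For a ball $B(x,r)$ with $B(x,2r)\subset D$, $\eta(r;x)>0$ is the radius such that $|B(x,\eta(r;x))|=\mathrm{Cap}^D(B(x,r))$, and $\eta^*(r;x)=\max\{\eta(r;x),16r\}$. *)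

(* Defs.v *)
From HB Require Import structures.
From mathcomp Require Import all_boot all_order all_algebra.
From mathcomp Require Import all_classical all_reals all_analysis.
From mathcomp Require Import measurable_realfun.
Set Implicit Arguments.
Unset Strict Implicit.
Unset Printing Implicit Defensive.
Import Order.TTheory GRing.Theory Num.Theory.
Import numFieldNormedType.Exports.
Local Open Scope classical_set_scope.
Local Open Scope ring_scope.

(* Matrices, hence row vectors, carry the Borel sigma-algebra of their
   topology. *)
Section borel_matrix.
Variables (R : realType) (m n : nat).

HB.instance Definition _ := @isMeasurable.Build
  (sigma_display (@open 'M[R]_(m, n))) 'M[R]_(m, n)
  <<s @open 'M[R]_(m, n) >> (@sigma_algebra0 _ setT _) (@sigma_algebraC _ _)
  (@sigma_algebra_bigcup _ setT _).

End borel_matrix.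

(* Lebesgue measure on R^n: the n-fold product of the one-dimensional Lebesgue
   measure, built on n-tuples and transported to row vectors. *)
Section tuple_step.
Variables (R : realType) (n : nat).

Definition cons_pair (x : R * n.-tuple R) : n.+1.-tuple R :=
  [tuple of x.1 :: x.2].

Definition uncons_tuple (t : n.+1.-tuple R) : R * n.-tuple R :=
  (thead t, [tuple of behead t]).

Lemma measurable_cons_pair : measurable_fun setT cons_pair.
Proof. exact: measurable_cons. Qed.

Lemma measurable_uncons_tuple : measurable_fun setT uncons_tuple.
Proof.
apply/measurable_fun_pairP; split => /=; last exact: measurable_behead.
exact: measurable_tnth.
Qed.

Lemma cons_pairK : cancel cons_pair uncons_tuple.
Proof. by case=> x t; congr pair; apply/val_inj. Qed.

Variable mu : {sigma_finite_measure set n.-tuple R -> \bar R}.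

Definition lebesgue_cons : set (n.+1.-tuple R) -> \bar R :=
  pushforward ((@lebesgue_measure R) \x mu)%E cons_pair.

HB.instance Definition _ := Measure.copy lebesgue_cons
  (measure_function_pushforward__canonical__measure_function_Measure
    ((@lebesgue_measure R) \x mu)%E measurable_cons_pair).

Let lebesgue_cons_sigma_finite : sigma_finite setT lebesgue_cons.
Proof.
have /sigma_finiteP[F [FT ndF Foo]] := sigma_finiteT (@lebesgue_measure R).
have /sigma_finiteP[G [GT ndG Goo]] := sigma_finiteT mu.
exists (fun i => uncons_tuple @^-1` (F i `*` G i)).
  apply/esym; rewrite -preimage_bigcup -subTset => t _.
  have [i _ Fi] : (\bigcup_i F i) (uncons_tuple t).1 by rewrite -FT.
  have [j _ Gj] : (\bigcup_i G i) (uncons_tuple t).2 by rewrite -GT.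
  exists (maxn i j) => //; split.
    by move: (_.1) Fi; apply/subsetPset/ndF; exact: leq_maxl.
  by move: (_.2) Gj; apply/subsetPset/ndG; exact: leq_maxr.
move=> i; have [mF Fi] := Foo i; have [mG Gi] := Goo i; split.
  rewrite -[X in measurable X]setTI; apply: measurable_uncons_tuple => //.
  exact: measurableX.
have pre (X : set (R * n.-tuple R)) : cons_pair @^-1` (uncons_tuple @^-1` X) = X.
  by apply/funext => x; rewrite /preimage /mkset cons_pairK.
rewrite /lebesgue_cons /pushforward pre.
by rewrite /= product_measure1E// lte_mul_pinfty// ge0_fin_numE.
Qed.

HB.instance Definition _ := Measure_isSigmaFinite.Build _ _ _
  lebesgue_cons lebesgue_cons_sigma_finite.

End tuple_step.

Fixpoint lebesgue_tuple (R : realType) (n : nat) :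
    {sigma_finite_measure set n.-tuple R -> \bar R} :=
  match n with
  | 0 => dirac [tuple]
  | n'.+1 => lebesgue_cons (lebesgue_tuple R n')
  end.

Lemma measurable_tuple_box (R : realType) (n : nat) (A : 'I_n -> set R) :
  (forall i, measurable (A i)) ->
  measurable [set t : n.-tuple R | forall i, A i (tnth t i)].
Proof.
move=> mA.
rewrite (_ : mkset _ = \bigcap_(i in [set: 'I_n]) ((@tnth _ R)^~ i @^-1` A i)).
  apply: fin_bigcap_measurable => // i _.
  by rewrite -[X in measurable X]setTI; exact: measurable_tnth.
by apply/seteqP; split => t /= tA i; [move=> _; exact: tA|exact: (tA i I)].
Qed.

Section lebesgue_rV.
Variables (R : realType) (n : nat).

Definition rV_of_tuple (t : n.-tuple R) : 'rV[R]_n := \row_i tnth t i.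

Lemma measurable_rV_of_tuple : measurable_fun setT rV_of_tuple.
Proof.
apply: (measurability _ (erefl <<s @open 'rV[R]_n >>)) => _ [U oU <-].
rewrite setTI.
pose B (p : 'rV[rat]_n * nat) : set 'rV[R]_n :=
  [set x : 'rV[R]_n | forall i, `|x ord0 i - ratr (p.1 ord0 i)| < p.2.+1%:R^-1].
have -> : U = \bigcup_p (if `[< B p `<=` U >] then B p else set0).
  apply/seteqP; split => [x Ux|x [p _]]; last first.
    by case: ifPn => // /asboolP; exact.
  have /nbhs_ballP[e /= e0 xeU] := open_nbhs_nbhs (conj oU Ux).
  pose k := Num.truncn (2 / e).
  have ke : 2 / k.+1%:R < e.
    by rewrite ltr_pdivrMr// -ltr_pdivrMl// mulrC truncnS_gt.
  have k0 : 0 < k.+1%:R^-1 :> R by rewrite invr_gt0.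
  have dens i : exists q : rat, `|x ord0 i - ratr q| < k.+1%:R^-1.
    have [||y [/= By [q _ qy]]] := @dense_rat R (ball (x ord0 i) k.+1%:R^-1).
    - by exists (x ord0 i); exact: ballxx.
    - exact: ball_open.
    - by exists q; rewrite qy.
  have [q qP] := choice dens.
  exists (\row_i q i, k) => //.
  rewrite ifT; last first.
    apply/asboolP => y yB; apply: xeU; split => // i j.
    have := yB j; rewrite (ord1 i) /= mxE => yq.
    rewrite /ball /= (le_lt_trans (ler_distD (ratr (q j)) _ _))//.
    apply: lt_trans ke.
    rewrite mulr_natl mulr2n ltrD//.
    by rewrite distrC.
  by move=> i /=; rewrite mxE; exact: qP.
rewrite preimage_bigcup; apply: countable_bigcupT_measurable => // p.
case: ifPn => _; last by rewrite preimage_set0.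
pose A i : set R := ball (ratr (p.1 ord0 i) : R) p.2.+1%:R^-1.
rewrite (_ : _ @^-1` _ = [set t : n.-tuple R | forall i, A i (tnth t i)]).
  have mA i : measurable (A i) by apply: open_measurable; apply: ball_open; rewrite /= invr_gt0.
  exact: (measurable_tuple_box mA).
apply/seteqP; split => t /= tB i; have := tB i.
  by rewrite /A /ball /= mxE distrC.
by rewrite /A /ball /= mxE distrC.
Qed.

Definition lebesgue_rV : set 'rV[R]_n -> \bar R :=
  pushforward (lebesgue_tuple R n) rV_of_tuple.

HB.instance Definition _ := Measure.copy lebesgue_rV
  (measure_function_pushforward__canonical__measure_function_Measure
    (lebesgue_tuple R n) measurable_rV_of_tuple).

End lebesgue_rV.

Lemma lebesgue_tuple_box (R : realType) (n : nat) (A : 'I_n -> set R) :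
  (forall i, measurable (A i)) ->
  lebesgue_tuple R n [set t | forall i, A i (tnth t i)] =
  (\prod_(i < n) lebesgue_measure (A i))%E.
Proof.
elim: n A => [|n IHn] A mA.
  by rewrite big_ord0 /= diracE mem_set// => -[].
rewrite big_ord_recl /= /lebesgue_cons /pushforward.
rewrite (_ : _ @^-1` _ = A ord0 `*`
    [set t | forall i, A (lift ord0 i) (tnth t i)]); last first.
  apply/seteqP; split => -[x t] /=.
    move=> At; split; first exact: (At ord0).
    by move=> i; have := At (lift ord0 i); rewrite tnthS.
  by move=> [Ax At] i; case: (unliftP ord0 i) => [j|] -> //; rewrite tnthS.
rewrite product_measure1E//=.
  by congr (_ * _)%E; apply: IHn => i; exact: mA.
  exact: mA.
exact: (measurable_tuple_box (fun i => mA (lift ord0 i))).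
Qed.

Lemma lebesgue_rV_box (R : realType) (n : nat) (A : 'I_n -> set R) :
  (forall i, measurable (A i)) ->
  lebesgue_rV [set x : 'rV[R]_n | forall i, A i (x ord0 i)] =
  (\prod_(i < n) lebesgue_measure (A i))%E.
Proof.
move=> mA; rewrite -lebesgue_tuple_box// /lebesgue_rV /pushforward.
congr (lebesgue_tuple R n _); apply/seteqP.
by split => t /= tA i; have := tA i; rewrite mxE.
Qed.

Section euclidean.
Variables (R : realType) (d : nat).
Implicit Types (x y z : 'rV[R]_d) (D : set 'rV[R]_d).

(* The norm `|x| that the library puts on row vectors is the sup norm. *)
Definition enorm x : R := Num.sqrt (\sum_(i < d) x ord0 i ^+ 2).

Definition eball x (r : R) : set 'rV[R]_d := [set y | enorm (y - x) < r].

Definition boundary D : set 'rV[R]_d := closure D `\` D°.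

Definition dist_boundary D x : R :=
  inf [set enorm (x - z) | z in boundary D].

End euclidean.

Section domains.
Variables (R : realType) (d : nat).
Implicit Types D : set 'rV[R]_d.

Definition gradient n (phi : 'rV[R]_n -> R) (x : 'rV[R]_n) : 'rV[R]_n :=
  \row_j 'D_(delta_mx ord0 j) phi x.

Definition C11_function n (Lam : R) (phi : 'rV[R]_n -> R) : Prop :=
  [/\ forall x, differentiable phi x,
      forall x, enorm (gradient phi x) <= Lam &
      forall x y, enorm (gradient phi x - gradient phi y) <= Lam * enorm (x - y)].

(* Around z, the orthonormal coordinates of y are (y - z) *m Q; the i-th one is
   the height above the graph of phi, which is a function of the others. *)
Definition C11_open D : Prop :=
  open D /\
  exists r0 Lam : R, [/\ 0 < r0, 0 < Lam &
    forall z, boundary D z ->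
    exists (Q : 'M[R]_d) (i : 'I_d) (phi : 'rV[R]_(d.-1) -> R),
    [/\ Q *m Q^T = 1%:M, C11_function Lam phi, phi 0 = 0, gradient phi 0 = 0 &
        D `&` eball z r0 =
        [set y | phi (col' i ((y - z) *m Q)) < ((y - z) *m Q) ord0 i]
          `&` eball z r0]].

Definition interior_ball_radius D (rho : R) : Prop :=
  0 < rho /\
  forall x, D x -> dist_boundary D x < rho ->
    exists z, [/\ boundary D z, enorm (x - z) = dist_boundary D x &
      eball (z + (rho / enorm (x - z)) *: (x - z)) rho `<=` D].

End domains.

Section censored.
Variables (R : realType) (d : nat).
Implicit Types (D : set 'rV[R]_d) (u v : 'rV[R]_d -> R) (alpha : R).

Local Notation leb := (@lebesgue_rV R d).

Definition Gamma (s : R) : R :=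
  \int[lebesgue_measure]_(t in `]0, +oo[) (t `^ (s - 1) * expR (- t)).

(* A(d, -alpha), the constant for which (1/2) A(d, -alpha) / |x - y|^(d + alpha)
   is the jump kernel of the form with Fourier symbol |xi|^alpha. *)
Definition stable_const alpha : R :=
  alpha * 2 `^ (alpha - 1) * Gamma ((d%:R + alpha) / 2)
  / (pi `^ (d%:R / 2) * Gamma (1 - alpha / 2)).

(* The integrand vanishes on the diagonal, since x / 0 = 0. *)
Definition censored_form alpha D u v : \bar R :=
  ((2^-1 * stable_const alpha)%:E *
   \int[leb]_(x in D) \int[leb]_(y in D)
     ((u x - u y) * (v x - v y) / enorm (x - y) `^ (d%:R + alpha))%:E)%E.

Definition L2_product D u v : \bar R :=
  (\int[leb]_(x in D) (u x * v x)%:E)%E.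

Definition censored_form1 alpha D u : \bar R :=
  (censored_form alpha D u u + L2_product D u u)%E.

Definition partial (i : 'I_d) u : 'rV[R]_d -> R :=
  fun x => 'D_(delta_mx ord0 i) u x.

Definition smooth u : Prop :=
  forall s : seq 'I_d, let w := foldr partial u s in
    continuous w /\ forall i x, derivable w x (delta_mx ord0 i).

Definition test_function D u : Prop :=
  [/\ smooth u, compact (closure [set x | u x != 0]) &
      closure [set x | u x != 0] `<=` D].

(* F^D, as a set of functions rather than of classes modulo a.e. equality. *)
Definition censored_domain alpha D : set ('rV[R]_d -> R) :=
  [set u | [/\ measurable_fun D u, (L2_product D u u < +oo)%E &
    exists phi : nat -> 'rV[R]_d -> R,
      (forall k, test_function D (phi k)) /\
      (fun k => censored_form1 alpha D (phi k \- u)) @ \oo --> 0%E]].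

Definition capacity_open alpha D (U : set 'rV[R]_d) : \bar R :=
  ereal_inf [set censored_form alpha D u u | u in
    [set u | censored_domain alpha D u /\ {ae leb, forall x, U x -> 1 <= u x}]].

Definition capacity alpha D (E : set 'rV[R]_d) : \bar R :=
  ereal_inf [set capacity_open alpha D U | U in
    [set U | [/\ open U, U `<=` D & E `<=` U]]].

(* For B(x, 2 r) `<=` D there is exactly one such s; 0 is a junk value. *)
Definition cap_radius alpha D (r : R) (x : 'rV[R]_d) : R :=
  xget 0 [set s | 0 < s /\ leb (eball x s) = capacity alpha D (eball x r)].

Definition cap_radius_star alpha D (r : R) (x : 'rV[R]_d) : R :=
  Num.max (cap_radius alpha D r x) (16 * r).

End censored.

(* Main.v *)
(** Fix alpha > 1 and let E(u) be the Gagliardo energy on D.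

    Friedrichs inequality: |u|^2 <= C E(u) in L^2(D).  Near a boundary point D contains uniform cones
    around an inner direction n.  Pushing points along n compares the L^2 mass of the boundary layer of
    depth lam h with twice that of the layer of depth h, with an error O(h^alpha E(u)).  As alpha > 1, one
    can choose lam < 2 with lam^alpha > 2, and iterating down to the support of u shows that the mass of
    the layer of depth h is O(h^alpha E(u)).  A nonlocal Poincare inequality then compares all of D with
    one such layer.

    Subadditivity: if u_j >= 1 on a neighbourhood of E_j, then sqrt (e^2 + sum_j u_j^2) - e has energy at
    most sum_j E(u_j), and it is almost at least 1 on the union.

    Quasi-additivity: let u be nearly optimal for E and w = u^2 / (1 + u^2), so that 1/2 <= w <= 1 on E.
    Let O be the trace on D of the ball B of radius eta* at x_j, and m a value of w on O for which the
    Poincare inequality |w - m|^2 <= c eta*^alpha E_O(w) holds in L^2(O).  If m <= 1/4, then a multiple of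
    w (w - m) times a bump supported in B is admissible for the j-th piece, and its energy is at most
    c E_O(w).  If m > 1/4, then |O| <= c (E_O(w) + |w|^2), while the capacity of B(x_j, r_j) is at most |B|,
    which the interior ball condition bounds by c |O|.  The sets O are disjoint, so that summing over j
    bounds the sum by c (E(w) + |w|^2), and the last term is controlled by the Friedrichs inequality. *)

Require Import Defs.
From HB Require Import structures.
From mathcomp Require Import all_boot all_order all_algebra.
From mathcomp Require Import all_classical all_reals all_analysis.
From mathcomp Require Import measurable_realfun ring lra.
Set Implicit Arguments.
Unset Strict Implicit.
Unset Printing Implicit Defensive.
Import Order.TTheory GRing.Theory Num.Theory.
Import numFieldNormedType.Exports.
Local Open Scope classical_set_scope.
Local Open Scope ring_scope.

(** The domain of the form is a closure of test functions, so a competitor for a capacity has to be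
    a limit of test functions and not merely have finite energy. Maxima and truncations are
    therefore replaced by smooth maps that vanish at 0, so that supports are preserved, and are
    Lipschitz, so that energies stay controlled.

    The ball B may leave D, and a bump supported in B is then no test function on D. The factor w in
    w (w - m) makes up for this, since it vanishes wherever u does, while the factor w - m turns the
    error of localization into the L^2 quantity that the Poincare inequality controls. That
    inequality comes from |O| >= c eta*^d: two points of O are at distance at most 2 eta*, where the
    kernel is bounded below. Taking m to be a value of w gives 0 <= m <= 1 for free.

    The Friedrichs inequality also enters the subadditivity: for infinitely many u_j it makes the
    L^2 norms summable along with the energies, without which the l2-norm of the sequence could be
    infinite. *)

(** * Elementary inequalities and the Euclidean norm *)

Lemma sum_sqr_ge0 (R : realDomainType) n (a : 'I_n -> R) : 0 <= \sum_(i < n) a i ^+ 2.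
Proof. by apply: sumr_ge0 => i _; exact: sqr_ge0. Qed.

(** Lagrange's identity: the double sum of the squares of [a i * b j - a j * b i] is twice the
    gap. *)
Lemma cauchy_schwarz_sum (R : realFieldType) n (a b : 'I_n -> R) :
  (\sum_(i < n) a i * b i) ^+ 2 <= (\sum_(i < n) a i ^+ 2) * \sum_(i < n) b i ^+ 2.
Proof.
have : 0 <= \sum_(i < n) \sum_(j < n) (a i * b j - a j * b i) ^+ 2.
  by do 2! (apply: sumr_ge0 => ? _); exact: sqr_ge0.
under eq_bigr do under eq_bigr do rewrite sqrrB !exprMn.
under eq_bigr do rewrite big_split sumrB /= -!mulr_sumr -mulr_suml.
rewrite big_split sumrB /= -!mulr_suml -mulr_sumr.
have -> : \sum_(i < n) \sum_(j < n) a i * b j * (a j * b i) *+ 2 =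
    2 * (\sum_(i < n) a i * b i) ^+ 2.
  rewrite expr2 mulr_suml mulr_sumr; apply: eq_bigr => i _.
  by rewrite mulr_sumr mulr_sumr; apply: eq_bigr => j _; ring.
lra.
Qed.

Lemma sqrt_sum_sqrD (R : rcfType) n (a b : 'I_n -> R) :
  Num.sqrt (\sum_(i < n) (a i + b i) ^+ 2) <=
  Num.sqrt (\sum_(i < n) a i ^+ 2) + Num.sqrt (\sum_(i < n) b i ^+ 2).
Proof.
have A0 := sum_sqr_ge0 a; have B0 := sum_sqr_ge0 b.
rewrite -(@ler_pXn2r _ 2) ?nnegrE ?addr_ge0 ?sqrtr_ge0//.
rewrite sqr_sqrtr ?sum_sqr_ge0// sqrrD !sqr_sqrtr//.
under eq_bigr do rewrite sqrrD.
rewrite !big_split /= lerD2r lerD2l.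
rewrite -mulr2n lerMn2r /= -sqrtrM//.
apply: le_trans (ler_norm _) _.
by rewrite -sqrtr_sqr ler_wsqrtr// cauchy_schwarz_sum.
Qed.

(** The map a |-> sqrt (e^2 + |a|^2) is 1-Lipschitz. This makes the energy of an l2-norm of
    functions at most the sum of their energies. *)
Lemma sqr_sqrtB_le (R : rcfType) n (e : R) (a b : 'I_n -> R) :
  (Num.sqrt (e ^+ 2 + \sum_(i < n) a i ^+ 2) - Num.sqrt (e ^+ 2 + \sum_(i < n) b i ^+ 2)) ^+ 2
  <= \sum_(i < n) (a i - b i) ^+ 2.
Proof.
have A0 := sum_sqr_ge0 a; have B0 := sum_sqr_ge0 b; have e0 := sqr_ge0 e.
set A := \sum_(i < n) _ in A0 *; set B := \sum_(i < n) _ in B0 *.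
rewrite sqrrB !sqr_sqrtr ?addr_ge0//.
under eq_bigr do rewrite sqrrB.
rewrite big_split sumrB /= -/A -/B -sqrtrM ?addr_ge0//.
rewrite [X in _ <= _ - X + _](_ : _ = 2 * \sum_(i < n) a i * b i); last first.
  by rewrite mulr_sumr; apply: eq_bigr => i _; rewrite mulr_natl.
(* What remains is the Cauchy-Schwarz inequality for the vectors (e, a) and (e, b). *)
suff : e ^+ 2 + \sum_(i < n) a i * b i <= Num.sqrt ((e ^+ 2 + A) * (e ^+ 2 + B)) by lra.
apply: le_trans (ler_norm _) _.
rewrite -sqrtr_sqr ler_wsqrtr//.
have CS : (\sum_(i < n) a i * b i) ^+ 2 <= A * B by exact: cauchy_schwarz_sum.
have AB : 2 * (\sum_(i < n) a i * b i) <= A + B.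
  have : 0 <= \sum_(i < n) (a i - b i) ^+ 2 by exact: sum_sqr_ge0.
  under eq_bigr do rewrite sqrrB.
  rewrite big_split sumrB /= -/A -/B.
  rewrite [X in _ <= _ - X + _](_ : _ = 2 * \sum_(i < n) a i * b i); first by lra.
  by rewrite mulr_sumr; apply: eq_bigr => i _; rewrite mulr_natl.
nra.
Qed.

Lemma enorm_le_sum (R : realType) d (x : 'rV[R]_d) : enorm x <= \sum_(i < d) `|x ord0 i|.
Proof.
rewrite -[leRHS]ger0_norm ?sumr_ge0// -sqrtr_sqr ler_wsqrtr//.
rewrite [leRHS]expr2 mulr_suml; apply: ler_sum => i _.
rewrite -real_normK ?num_real// expr2 ler_wpM2l//.
by rewrite (bigD1 i)//= lerDl sumr_ge0.
Qed.

Lemma continuous_sumr (R : realType) (T : topologicalType) I (s : seq I) (f : I -> T -> R) :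
  (forall i, continuous (f i)) -> continuous (fun x => \sum_(i <- s) f i x).
Proof.
move=> cf x; elim: s => [|i s ih].
  by under eq_fun do rewrite big_nil; exact: cvg_cst.
under eq_fun do rewrite big_cons.
by apply: cvgD => //; exact: cf.
Qed.

Section enorm_theory.
Variables (R : realType) (d : nat).
Implicit Types x y z : 'rV[R]_d.

Lemma enorm_ge0 x : 0 <= enorm x. Proof. exact: sqrtr_ge0. Qed.

Lemma sqr_enorm x : enorm x ^+ 2 = \sum_(i < d) x ord0 i ^+ 2.
Proof. by rewrite sqr_sqrtr// sum_sqr_ge0. Qed.

Lemma enorm0 : enorm (0 : 'rV[R]_d) = 0.
Proof. by rewrite /enorm big1 ?sqrtr0// => i _; rewrite mxE expr0n. Qed.

Lemma enormN x : enorm (- x) = enorm x.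
Proof. by congr Num.sqrt; apply: eq_bigr => i _; rewrite mxE sqrrN. Qed.

Lemma enormB x y : enorm (x - y) = enorm (y - x).
Proof. by rewrite -enormN opprB. Qed.

Lemma enormD x y : enorm (x + y) <= enorm x + enorm y.
Proof.
apply: le_trans (sqrt_sum_sqrD (x ord0) (y ord0)).
by rewrite /enorm; under eq_bigr do rewrite mxE.
Qed.

Lemma enorm_distD z x y : enorm (x - y) <= enorm (x - z) + enorm (z - y).
Proof. by apply: le_trans (enormD _ _); rewrite addrA subrK. Qed.

Lemma enormZ (a : R) x : enorm (a *: x) = `|a| * enorm x.
Proof.
rewrite /enorm -sqrtr_sqr -sqrtrM ?sqr_ge0// mulr_sumr; congr Num.sqrt.
by apply: eq_bigr => i _; rewrite mxE exprMn.
Qed.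

Lemma coord_le_enorm x i : `|x ord0 i| <= enorm x.
Proof.
rewrite -sqrtr_sqr ler_wsqrtr// (bigD1 i)//= lerDl.
by apply: sumr_ge0 => j _; exact: sqr_ge0.
Qed.

Lemma enorm_eq0 x : (enorm x == 0) = (x == 0).
Proof.
apply/eqP/eqP => [x0|->]; last exact: enorm0.
apply/rowP => i; rewrite mxE; apply/eqP; rewrite -normr_le0 -x0.
exact: coord_le_enorm.
Qed.

Lemma enorm_gt0 x : (0 < enorm x) = (x != 0).
Proof. by rewrite lt0r enorm_ge0 andbT enorm_eq0. Qed.

Lemma enorm_lt_coord x (s : R) : 0 < s -> (forall i, `|x ord0 i| < s / d%:R) -> enorm x < s.
Proof.
move=> s0 xs; case: d x xs => [x _|n x xs].
  by rewrite /enorm big_ord0 sqrtr0.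
apply: le_lt_trans (enorm_le_sum x) _.
apply: (@lt_le_trans _ _ (\sum_(i < n.+1) (s / n.+1%:R))); last first.
  by rewrite sumr_const card_ord -[leLHS]mulr_natr divfK// pnatr_eq0.
apply: ltr_sum => [|i _]; last exact: xs.
by apply/hasP; exists ord0; rewrite ?mem_index_enum.
Qed.

Lemma norm_le_enorm x : `|x| <= enorm x.
Proof.
rewrite /Num.norm/= mx_normrE; apply: bigmax_le => [|[i j] _]; first exact: enorm_ge0.
by rewrite (ord1 i) coord_le_enorm.
Qed.

Lemma coord_le_norm x i : `|x ord0 i| <= `|x|.
Proof. by rewrite [leRHS]/Num.norm/= mx_normrE (le_bigmax _ _ (ord0, i)). Qed.

Lemma enorm_le_norm x : enorm x <= d%:R * `|x|.
Proof.
apply: le_trans (enorm_le_sum x) _.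
apply: (@le_trans _ _ (\sum_(i < d) `|x|)); last first.
  by rewrite sumr_const card_ord mulr_natl.
by apply: ler_sum => i _; exact: coord_le_norm.
Qed.

Lemma continuous_enorm : continuous (@enorm R d).
Proof.
move=> x; apply: (@continuous_comp _ _ _ (fun y : 'rV[R]_d => \sum_(i < d) y ord0 i ^+ 2) Num.sqrt);
  last exact: sqrt_continuous.
by apply: continuous_sumr => i y; apply: continuousM; exact: coord_continuous.
Qed.

Lemma continuous_coord (i : 'I_d) : continuous (fun y : 'rV[R]_d => y ord0 i).
Proof. exact: coord_continuous. Qed.

Lemma open_eball x r : open (eball x r).
Proof.
rewrite (_ : eball x r = (fun y => enorm (y - x)) @^-1` [set t | t < r])//.
apply: open_comp; last exact: open_lt.
move=> y _; apply: continuous_comp; last exact: continuous_enorm.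
by apply: continuousB; [exact: cvg_id|exact: cst_continuous].
Qed.

Lemma continuous_measurable_rV (f : 'rV[R]_d -> R) :
  continuous f -> measurable_fun setT f.
Proof.
move=> /continuousP cf; apply: (measurability _ (RGenOpens.measurableE R)).
move=> _ [_ [a [b ->] <-]]; rewrite setTI; apply: sub_sigma_algebra.
exact/cf/interval_open.
Qed.

Lemma measurable_open_rV (U : set 'rV[R]_d) : open U -> measurable U.
Proof. by move=> oU; apply: sub_sigma_algebra. Qed.

Lemma measurable_coord (i : 'I_d) : measurable_fun setT (fun y : 'rV[R]_d => y ord0 i).
Proof. apply: continuous_measurable_rV; exact: continuous_coord. Qed.

Lemma measurable_eball x r : measurable (eball x r).
Proof. apply: measurable_open_rV; exact: open_eball. Qed.

(** Measurability is with respect to the product sigma-algebra on pairs, so the proof goes through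
    coordinates instead of continuity on the product. *)
Lemma measurable_enormB :
  measurable_fun setT (fun p : 'rV[R]_d * 'rV[R]_d => enorm (p.1 - p.2)).
Proof.
have m1 i : measurable_fun setT (fun p : 'rV[R]_d * 'rV[R]_d => p.1 ord0 i).
  exact: (measurableT_comp (measurable_coord i) measurable_fst).
have m2 i : measurable_fun setT (fun p : 'rV[R]_d * 'rV[R]_d => p.2 ord0 i).
  exact: (measurableT_comp (measurable_coord i) measurable_snd).
have H : measurable_fun setT
    (fun p : 'rV[R]_d * 'rV[R]_d => \sum_(i < d) (p.1 ord0 i - p.2 ord0 i) ^+ 2).
  apply: measurable_sum => i; apply: measurable_funX; exact: measurable_funB.
have := measurableT_comp (continuous_measurable_fun (@sqrt_continuous R)) H.
apply: eq_measurable_fun => p _ /=; congr Num.sqrt.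
by apply: eq_bigr => i _; rewrite !mxE.
Qed.

End enorm_theory.

(** * Lebesgue measure on row vectors *)

Section lebesgue_rV_theory.
Variables (R : realType) (d : nat).
Implicit Types x y : 'rV[R]_d.
Local Notation leb := (@lebesgue_rV R d).

(** Cubes are the sets whose volume is computed; balls are only compared with an inscribed and a
    circumscribed cube. *)
Definition cube x (s : R) : set 'rV[R]_d :=
  [set y | forall i, `|y ord0 i - x ord0 i| < s].

Lemma cubeE x s : cube x s = [set y | forall i, ball (x ord0 i) s (y ord0 i)].
Proof. by apply/seteqP; split => y /= h i; have := h i; rewrite /ball /= distrC. Qed.

Lemma measurable_cube x s : measurable (cube x s).
Proof.
rewrite (_ : cube x s =
    \bigcap_(i in [set: 'I_d]) (fun y : 'rV[R]_d => y ord0 i) @^-1` ball (x ord0 i) s).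
  apply: fin_bigcap_measurable => // i _.
  by rewrite -[X in measurable X]setTI; apply: measurable_coord => //; exact: measurable_ball.
by rewrite cubeE; apply/seteqP; split => y /= h i; [move=> _; exact: h|exact: (h i I)].
Qed.

Lemma lebesgue_cube x s : 0 <= s -> leb (cube x s) = ((2 * s) ^+ d)%:E.
Proof.
move=> s0; rewrite cubeE.
rewrite (lebesgue_rV_box (A := fun i => ball (x ord0 i) s)); last by move=> i; exact: measurable_ball.
transitivity (\prod_(i < d) (2 * s)%:E)%E.
  by apply: eq_bigr => i _; rewrite lebesgue_measure_ball// mulr2n mulrDl mul1r.
by rewrite prodEFin prodr_const card_ord.
Qed.

Lemma lebesgue_rV_sigma_finite : sigma_finite setT leb.
Proof.
exists (fun n : nat => cube 0 n%:R).
  apply/esym; rewrite -subTset => x _.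
  exists (Num.truncn `|x|).+1 => // i.
  rewrite mxE subr0; apply: le_lt_trans (truncnS_gt _); exact: coord_le_norm.
move=> n; split; first exact: measurable_cube.
by rewrite lebesgue_cube ?ltry.
Qed.

HB.instance Definition _ := Measure_isSigmaFinite.Build _ _ _
  leb lebesgue_rV_sigma_finite.

Lemma eball_sub_cube x s : eball x s `<=` cube x s.
Proof.
move=> y ys i; apply: le_lt_trans ys.
by have := coord_le_enorm (y - x) i; rewrite !mxE.
Qed.

Lemma cube_sub_eball x s : 0 < s -> cube x (s / d%:R) `<=` eball x s.
Proof.
by move=> s0 y ys; apply: enorm_lt_coord => // i; have := ys i; rewrite !mxE.
Qed.

Lemma eball0 x s : s <= 0 -> eball x s = set0.
Proof.
move=> s0; apply/seteqP; split => y //=; rewrite /eball /= => ys.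
by have := lt_le_trans ys s0; rewrite ltNge enorm_ge0.
Qed.

Lemma lebesgue_eball_le x s : 0 <= s -> (leb (eball x s) <= ((2 * s) ^+ d)%:E)%E.
Proof.
move=> s0; rewrite -(lebesgue_cube x)//; apply: le_measure; rewrite ?inE.
- exact: measurable_eball.
- exact: measurable_cube.
- exact: eball_sub_cube.
Qed.

Lemma lebesgue_eball_ge x s : 0 < s -> (((2 * (s / d%:R)) ^+ d)%:E <= leb (eball x s))%E.
Proof.
move=> s0; rewrite -(lebesgue_cube x (divr_ge0 (ltW s0) (ler0n _ _))).
apply: le_measure; rewrite ?inE.
- exact: measurable_cube.
- exact: measurable_eball.
- exact: cube_sub_eball.
Qed.

Lemma lebesgue_eball_lty x s : (leb (eball x s) < +oo)%E.
Proof.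
have [s0|/ltW s0] := leP s 0; first by rewrite eball0// measure0.
exact: le_lt_trans (lebesgue_eball_le x s0) (ltry _).
Qed.

Lemma bounded_sub_eball (D : set 'rV[R]_d) :
  bounded_set D -> exists2 M : R, 0 < M & D `<=` eball 0 M.
Proof.
move=> [M0 [_ /(_ (`|M0| + 1))]].
rewrite (le_lt_trans (ler_norm M0)) ?ltrDl// => /(_ isT) HM.
exists (d%:R * (`|M0| + 1) + 1).
  by rewrite ltr_wpDl// mulr_ge0// addr_ge0.
move=> x Dx; rewrite /eball /= subr0.
apply: (le_lt_trans (enorm_le_norm x)).
rewrite (@le_lt_trans _ _ (d%:R * (`|M0| + 1)))// ?ltrDl// ler_wpM2l//.
exact: HM.
Qed.

End lebesgue_rV_theory.

(** * Balls of prescribed volume *)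

Section eball_radius.
Variables (R : realType) (n : nat).
Implicit Types x y : 'rV[R]_n.+1.
Local Notation leb := (@lebesgue_rV R n.+1).

Lemma measurable_enorm_sub x : measurable_fun setT (fun y => enorm (y - x)).
Proof.
have m1 : measurable_fun setT (fun y : 'rV[R]_n.+1 => (y, x)).
  exact: pair2_measurable.
exact: (measurableT_comp (@measurable_enormB R n.+1) m1).
Qed.

(** Tonelli in the first coordinate: a line parallel to the first axis meets the sphere in at most
    two points. *)
Lemma lebesgue_sphere x (s : R) : leb [set y | enorm (y - x) = s] = 0%E.
Proof.
set S := [set y | _].
have mS : measurable S.
  rewrite -[S]setTI (_ : S = (fun y => enorm (y - x)) @^-1` [set s])//.
  exact: measurable_enorm_sub.
pose A := @cons_pair R n @^-1` (@rV_of_tuple R n.+1 @^-1` S).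
have mA : measurable A.
  rewrite /A -[X in measurable X]setTI; apply: measurable_cons_pair => //.
  by rewrite -[X in measurable X]setTI; exact: measurable_rV_of_tuple.
rewrite (_ : leb S = ((@lebesgue_measure R) \x lebesgue_tuple R n)%E A)//.
rewrite -[A]setIT -integral_indic//.
rewrite fubini_tonelli2; last 2 first.
- by apply/measurable_EFinP; exact: measurable_indic.
- by move=> p; rewrite lee_fin.
apply: integral0_eq => t _; rewrite /fubini_G.
pose c := s ^+ 2 - \sum_(i < n) (tnth t i - x ord0 (lift ord0 i)) ^+ 2.
pose F : set R := [set x ord0 ord0 + Num.sqrt c] `|` [set x ord0 ord0 - Num.sqrt c].
have cF : countable F.
  by apply: finite_set_countable; rewrite finite_setU; split; exact: finite_set1.
have mF : measurable F by apply: measurableU.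
apply/eqP; rewrite eq_le; apply/andP; split; last first.
  by apply: integral_ge0 => a _; rewrite lee_fin.
rewrite -(countable_lebesgue_measure0 cF) -[X in (_ <= lebesgue_measure X)%E]setIT -integral_indic//.
have mAt : measurable_fun setT (fun a : R => (\1_A (a, t) : R)).
  by apply: (measurableT_comp (measurable_indic _)) => //; exact: pair2_measurable.
apply: ge0_le_integral => //.
- exact/measurable_EFinP.
- by apply/measurable_EFinP; exact: measurable_indic.
move=> a _; rewrite lee_fin !indicE ler_nat; case: (boolP ((a, t) \in A)) => //.
rewrite inE /A /S /preimage /= => Aat.
rewrite (_ : a \in F)// inE /F /=.
have ac : (a - x ord0 ord0) ^+ 2 = c.
  have E i : (rV_of_tuple (cons_pair (a, t)) - x) ord0 i =
      tnth [tuple of a :: t] i - x ord0 i by rewrite !mxE.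
  rewrite /c -Aat sqr_enorm; under eq_bigr do rewrite E.
  rewrite big_ord_recl tnth0; under eq_bigr do rewrite tnthS.
  by rewrite addrK.
rewrite -ac sqrtr_sqr; have [h|h] := ger0P (a - x ord0 ord0).
  by left => /=; ring.
by right => /=; ring.
Qed.

Lemma lebesgue_closed_eball x (s : R) :
  leb [set y | enorm (y - x) <= s] = leb (eball x s).
Proof.
rewrite (_ : [set y | _] = eball x s `|` [set y | enorm (y - x) = s]); last first.
  apply/seteqP; split => y /=; rewrite /eball /= le_eqVlt.
    by move=> /orP[/eqP|]; [right|left].
  by move=> [->|->]; rewrite ?orbT ?eqxx.
have mS : measurable [set y | enorm (y - x) = s].
  rewrite -[X in measurable X]setTI (_ : [set y | _] = (fun y => enorm (y - x)) @^-1` [set s])//.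
  exact: measurable_enorm_sub.
rewrite measureU//.
- by rewrite [X in (_ + X)%E](lebesgue_sphere x s) adde0.
- exact: measurable_eball.
- by apply/seteqP; split => y //= -[ys e]; move: ys; rewrite /eball /= e ltxx.
Qed.

(** The volume is continuous in the radius, since spheres are null sets, so the supremum of the
    radii of volume at most [V] is a solution. This ensures that [cap_radius] is not its junk value
    when the capacity is positive and finite. *)
Lemma eball_radius x (V : R) : 0 < V -> exists2 s, 0 < s & leb (eball x s) = V%:E.
Proof.
move=> V0.
pose S := [set s : R | 0 <= s /\ (leb (eball x s) <= V%:E)%E].
have S0 : S 0 by split => //; rewrite eball0// measure0 lee_fin ltW.
have Sub : has_ubound S.
  (* Beyond this radius the inscribed cube has side at least 1, so its volume is at least its side,
     which exceeds [V]. *)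
  exists (n.+1%:R * (V + 1)) => s [s0 sV]; rewrite leNgt; apply/negP => Vs.
  have {}s0 : 0 < s by apply: lt_trans Vs; rewrite mulr_gt0// addr_gt0.
  have := le_trans (lebesgue_eball_ge x s0) sV; rewrite lee_fin => {}sV.
  have h : V + 1 < s / n.+1%:R by rewrite ltr_pdivlMr// mulrC.
  have : V < (2 * (s / n.+1%:R)) ^+ n.+1.
    apply: (@lt_le_trans _ _ (2 * (s / n.+1%:R))).
      by move: V0 h; set t := s / _; lra.
    by rewrite ler_eXnr//; move: V0 h; set t := s / _; lra.
  by rewrite ltNge sV.
have hS : has_sup S by split => //; exists 0.
pose s := sup S.
have s0 : 0 <= s by exact: ub_le_sup.
have ltS t : t < s -> (leb (eball x t) <= V%:E)%E.
  move=> ts; have [|e [e0 eV] se] := @sup_adherent R S (s - t) _ hS; first by rewrite subr_gt0.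
  apply: le_trans eV; apply: le_measure; rewrite ?inE; try exact: measurable_eball.
  move=> y; rewrite /eball /= => /lt_trans; apply.
  by apply: le_lt_trans se; rewrite -/s; lra.
have gtS t : s < t -> (V%:E <= leb (eball x t))%E.
  move=> st; rewrite leNgt; apply/negP => tV.
  have : t <= s by apply: ub_le_sup => //; split; [exact: ltW (le_lt_trans s0 st)|exact: ltW].
  by rewrite leNgt st.
have le1 : (leb (eball x s) <= V%:E)%E.
  pose F k := eball x (s - k.+1%:R^-1).
  have FU : eball x s = \bigcup_k F k.
    apply/seteqP; split => y /=; rewrite /F /eball /=; last first.
      by move=> [k _] /lt_le_trans; apply; rewrite gerBl.
    move=> ys; have [k] := @ltr_add_invr R _ _ ys.
    by move=> h; exists k => //=; rewrite ltrBrDr.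
  have mF k : measurable (F k) by exact: measurable_eball.
  have c : (leb \o F) k @[k --> \oo] --> leb (\bigcup_k F k).
    apply: nondecreasing_cvg_mu => //; first by rewrite -FU; exact: measurable_eball.
    move=> k m km; apply/subsetPset => y; rewrite /F /eball /= => /lt_le_trans; apply.
    by rewrite lerB// lef_pV2 ?posrE// ler_nat.
  rewrite FU -(cvg_lim _ c)//; apply: lime_le; first by apply/cvg_ex; eexists; exact: c.
  by apply: nearW => k /=; apply: ltS; rewrite gtrBl.
(* Continuity from above only reaches the closed ball, which is where the null sphere is used. *)
have ge1 : (V%:E <= leb (eball x s))%E.
  rewrite -lebesgue_closed_eball.
  pose F k := eball x (s + k.+1%:R^-1).
  have FU : [set y | enorm (y - x) <= s] = \bigcap_k F k.
    apply/seteqP; split => y /=; rewrite /F /eball /=.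
      by move=> ys k _ /=; apply: le_lt_trans ys _; rewrite ltrDl.
    move=> yF; rewrite leNgt; apply/negP => sy; have [k] := @ltr_add_invr R _ _ sy.
    by apply/negP; rewrite -leNgt ltW// (yF k).
  have mF k : measurable (F k) by exact: measurable_eball.
  have c : (leb \o F) k @[k --> \oo] --> leb (\bigcap_k F k).
    apply: nonincreasing_cvg_mu => //; first exact: lebesgue_eball_lty.
      exact: bigcap_measurable.
    move=> k m km; apply/subsetPset => y; rewrite /F /eball /= => /lt_le_trans; apply.
    by rewrite lerD2l lef_pV2 ?posrE// ler_nat.
  rewrite FU -(cvg_lim _ c)//; apply: lime_ge; first by apply/cvg_ex; eexists; exact: c.
  by apply: nearW => k /=; apply: gtS; rewrite ltrDl.
have sV : leb (eball x s) = V%:E by apply/eqP; rewrite eq_le le1 ge1.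
exists s => //; rewrite lt_neqAle s0 andbT; apply/negP => /eqP s00.
by move: sV; rewrite -s00 eball0// measure0 => -[]; lra.
Qed.

End eball_radius.

(** * Gagliardo energy *)

Section tonelli_rect.
Context d1 d2 (T1 : measurableType d1) (T2 : measurableType d2) (R : realType).
Variables (m1 : {sigma_finite_measure set T1 -> \bar R})
  (m2 : {sigma_finite_measure set T2 -> \bar R}).
Variables (A : set T1) (B : set T2) (f : T1 * T2 -> \bar R).
Hypotheses (mA : measurable A) (mB : measurable B).
Hypotheses (mf : measurable_fun (A `*` B) f) (f0 : forall p, (A `*` B) p -> (0 <= f p)%E).

Let g := f \_ (A `*` B).

Let mg : measurable_fun setT g.
Proof. by apply/(measurable_restrictT _ _).1 => //; exact: measurableX. Qed.

Let g0 p : (0 <= g p)%E.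
Proof. by rewrite /g patchE; case: ifPn => // /set_mem /f0. Qed.

Lemma tonelli_rect1 : (\int[m1 \x m2]_(p in A `*` B) f p =
  \int[m1]_(x in A) \int[m2]_(y in B) f (x, y))%E.
Proof.
rewrite integral_mkcond (fubini_tonelli1 g mg g0) [RHS]integral_mkcond.
apply: eq_integral => x _; rewrite /fubini_F /g patchE; case: ifPn => xA.
  rewrite [RHS]integral_mkcond; apply: eq_integral => y _.
  by rewrite !patchE in_setX xA.
by apply: integral0_eq => y _; rewrite patchE in_setX (negbTE xA).
Qed.

Lemma tonelli_rect2 : (\int[m1 \x m2]_(p in A `*` B) f p =
  \int[m2]_(y in B) \int[m1]_(x in A) f (x, y))%E.
Proof.
rewrite integral_mkcond (fubini_tonelli2 g mg g0) [RHS]integral_mkcond.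
apply: eq_integral => y _; rewrite /fubini_G /g patchE; case: ifPn => yB.
  rewrite [RHS]integral_mkcond; apply: eq_integral => x _.
  by rewrite !patchE in_setX yB andbT.
by apply: integral0_eq => x _; rewrite patchE in_setX (negbTE yB) andbF.
Qed.

End tonelli_rect.

Section gagliardo.
Variables (R : realType) (d : nat) (alpha : R).
Implicit Types (A D : set 'rV[R]_d) (u v w : 'rV[R]_d -> R).
Local Notation leb := (@lebesgue_rV R d).
Local Notation leb2 := (leb \x leb)%E.

Definition kern (p : 'rV[R]_d * 'rV[R]_d) : R :=
  (enorm (p.1 - p.2) `^ (d%:R + alpha))^-1.

Definition gint u p : R := (u p.1 - u p.2) ^+ 2 * kern p.

(** The form without its constant, over the product measure and not as an iterated integral:
    domination, sums over disjoint pieces and both orders of integration then apply directly. *)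
Definition gag A u : \bar R := (\int[leb2]_(p in A `*` A) (gint u p)%:E)%E.

Definition l2 A u : \bar R := (\int[leb]_(x in A) (u x ^+ 2)%:E)%E.

Lemma kern_ge0 p : 0 <= kern p.
Proof. by rewrite invr_ge0 powR_ge0. Qed.

Lemma gint_ge0 u p : 0 <= gint u p.
Proof. by rewrite mulr_ge0 ?sqr_ge0 ?kern_ge0. Qed.

Lemma gag_ge0 A u : (0 <= gag A u)%E.
Proof. by apply: integral_ge0 => p _; rewrite lee_fin gint_ge0. Qed.

Lemma l2_ge0 A u : (0 <= l2 A u)%E.
Proof. by apply: integral_ge0 => p _; rewrite lee_fin sqr_ge0. Qed.

Lemma measurable_kern : measurable_fun setT kern.
Proof.
have := measurableT_comp (measurable_powR (- (d%:R + alpha))) (@measurable_enormB R d).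
by apply: eq_measurable_fun => p _ /=; rewrite powRN.
Qed.

Lemma measurable_gint A u : measurable A -> measurable_fun A u ->
  measurable_fun (A `*` A) (fun p => (gint u p)%:E).
Proof.
move=> mA mu.
have m1 : measurable_fun (A `*` A) (fun p => u p.1).
  apply: (@measurable_comp _ _ _ _ _ _ A) => //; first by move=> _ [p [pA _] <-].
  exact: (measurable_funS _ _ (@measurable_fst _ _ _ _)).
have m2 : measurable_fun (A `*` A) (fun p => u p.2).
  apply: (@measurable_comp _ _ _ _ _ _ A) => //; first by move=> _ [p [_ pA] <-].
  exact: (measurable_funS _ _ (@measurable_snd _ _ _ _)).
apply/measurable_EFinP; apply: measurable_funM.
  by apply: measurable_funX; exact: measurable_funB.
exact: (measurable_funS _ _ measurable_kern).
Qed.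

Lemma measurable_gintT u (A : set ('rV[R]_d * 'rV[R]_d)) :
  measurable_fun setT u -> measurable_fun A (fun p => (gint u p)%:E).
Proof.
move=> mu; have := measurable_gint measurableT mu.
by rewrite setXTT => h; exact: (measurable_funS _ _ h).
Qed.

Lemma measurable_sqr u A :
  measurable_fun A u -> measurable_fun A (fun x => (u x ^+ 2)%:E).
Proof. by move=> mu; apply/measurable_EFinP; exact: measurable_funX. Qed.

Lemma censored_formE D u : measurable D -> measurable_fun D u ->
  censored_form alpha D u u = ((2^-1 * stable_const d alpha)%:E * gag D u)%E.
Proof.
move=> mD mu; rewrite /censored_form /gag tonelli_rect1//.
  exact: measurable_gint.
by move=> p _; rewrite lee_fin gint_ge0.
Qed.

Lemma gag_subset A B u : measurable A -> measurable B -> measurable_fun setT u ->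
  A `<=` B -> (gag A u <= gag B u)%E.
Proof.
move=> mA mB mu AB; apply: ge0_subset_integral; [exact: measurableX|exact: measurableX| | |].
- exact: measurable_gintT.
- by move=> p _; rewrite lee_fin gint_ge0.
- by move=> p [/AB ? /AB ?].
Qed.

Lemma l2_subset A B u : measurable A -> measurable B -> measurable_fun setT u ->
  A `<=` B -> (l2 A u <= l2 B u)%E.
Proof.
move=> mA mB mu AB; apply: ge0_subset_integral => //.
- by apply: measurable_sqr; exact: measurable_funTS.
- by move=> x _; rewrite lee_fin sqr_ge0.
Qed.

Lemma gag_le (C : R) A u v : measurable A -> measurable_fun setT u -> measurable_fun setT v ->
  0 <= C ->
  (forall x y, A x -> A y -> (u x - u y) ^+ 2 <= C * (v x - v y) ^+ 2) ->
  (gag A u <= C%:E * gag A v)%E.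
Proof.
move=> mA mu mv C0 uv.
rewrite -ge0_integralZl//; last 3 first.
- exact: measurableX.
- exact: measurable_gintT.
- by move=> p _; rewrite lee_fin gint_ge0.
apply: ge0_le_integral; first exact: measurableX.
- by move=> p _; rewrite lee_fin gint_ge0.
- exact: measurable_gintT.
- by apply: measurable_funeM; exact: measurable_gintT.
move=> [x y] [xA yA]; rewrite -EFinM lee_fin /gint mulrA ler_wpM2r ?kern_ge0//.
exact: uv.
Qed.

Lemma l2_le (C : R) A u v : measurable A -> measurable_fun setT u -> measurable_fun setT v ->
  0 <= C -> (forall x, A x -> u x ^+ 2 <= C * v x ^+ 2) -> (l2 A u <= C%:E * l2 A v)%E.
Proof.
move=> mA mu mv C0 uv.
rewrite -ge0_integralZl//; last 2 first.
- by apply: measurable_sqr; exact: measurable_funTS.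
- by move=> p _; rewrite lee_fin sqr_ge0.
apply: ge0_le_integral => //.
- by move=> p _; rewrite lee_fin sqr_ge0.
- by apply: measurable_sqr; exact: measurable_funTS.
- by apply: measurable_funeM; apply: measurable_sqr; exact: measurable_funTS.
Qed.

Lemma gag_leD (C : R) A u v w : measurable A -> measurable_fun setT u ->
  measurable_fun setT v -> measurable_fun setT w -> 0 <= C ->
  (forall x y, A x -> A y -> (u x - u y) ^+ 2 <= C * ((v x - v y) ^+ 2 + (w x - w y) ^+ 2)) ->
  (gag A u <= C%:E * (gag A v + gag A w))%E.
Proof.
move=> mA mu mv mw C0 uvw.
have mAA := measurableX mA mA.
have g0 f p : (A `*` A) p -> (0 <= (gint f p)%:E)%E by rewrite lee_fin gint_ge0.
rewrite -ge0_integralD//; [|exact: g0|exact: measurable_gintT|exact: g0|exact: measurable_gintT].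
rewrite -ge0_integralZl//; last 2 first.
- by apply: emeasurable_funD; exact: measurable_gintT.
- by move=> p pA; rewrite adde_ge0 ?g0.
apply: ge0_le_integral => //.
- exact: g0.
- exact: measurable_gintT.
- by apply: measurable_funeM; apply: emeasurable_funD; exact: measurable_gintT.
move=> [x y] [xA yA]; rewrite -EFinD -EFinM lee_fin /gint -mulrDl mulrA ler_wpM2r ?kern_ge0//.
exact: uvw.
Qed.

Lemma l2_leD (C : R) A u v w : measurable A -> measurable_fun setT u ->
  measurable_fun setT v -> measurable_fun setT w -> 0 <= C ->
  (forall x, A x -> u x ^+ 2 <= C * (v x ^+ 2 + w x ^+ 2)) ->
  (l2 A u <= C%:E * (l2 A v + l2 A w))%E.
Proof.
move=> mA mu mv mw C0 uvw.
have g0 f x : A x -> (0 <= (f x ^+ 2 : R)%:E)%E by rewrite lee_fin sqr_ge0.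
have mf (f : 'rV[R]_d -> R) : measurable_fun setT f -> measurable_fun A (fun x => (f x ^+ 2)%:E).
  by move=> ?; apply: measurable_sqr; exact: measurable_funTS.
rewrite -ge0_integralD//; [|exact: g0|exact: mf|exact: g0|exact: mf].
rewrite -ge0_integralZl//; last 2 first.
- by apply: emeasurable_funD; exact: mf.
- by move=> p pA; rewrite adde_ge0 ?g0.
apply: ge0_le_integral => //.
- exact: g0.
- exact: mf.
- by apply: measurable_funeM; apply: emeasurable_funD; exact: mf.
Qed.

End gagliardo.

Lemma mule4 (R : realType) (x : \bar R) : (4%:E * x = (x + x) + (x + x))%E.
Proof. by rewrite mule_natl !muleS mule0n adde0 addeA. Qed.

Lemma cvg_sqr (R : realType) (f : nat -> R) (l : R) :
  f @ \oo --> l -> (f k ^+ 2) @[k --> \oo] --> l ^+ 2.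
Proof. by move=> h; rewrite expr2; under eq_fun do rewrite expr2; exact: cvgM. Qed.

(** * Membership in the domain by dominated convergence *)

Section censored_domain_theory.
Variables (R : realType) (d : nat) (alpha : R) (D : set 'rV[R]_d).
Implicit Types (u v w : 'rV[R]_d -> R).
Local Notation leb := (@lebesgue_rV R d).
Local Notation leb2 := (leb \x leb)%E.
Hypothesis mD : measurable D.

Let mDD : measurable (D `*` D). Proof. exact: measurableX. Qed.

Lemma ae_pair (P : 'rV[R]_d -> Prop) : {ae leb, forall x, P x} ->
  {ae leb2, forall p, P p.1 /\ P p.2}.
Proof.
move=> [N [mN N0 PN]]; exists ((N `*` setT) `|` (setT `*` N)); split.
- by apply: measurableU; apply: measurableX.
- have N1 : leb2 (N `*` setT) = 0%E by transitivity (leb N * leb setT)%E; [exact: product_measure1E|rewrite N0 mul0e].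
  have N2 : leb2 (setT `*` N) = 0%E by transitivity (leb setT * leb N)%E; [exact: product_measure1E|rewrite N0 mule0].
  by rewrite measureU0//; apply: measurableX.
- move=> [x y] /= nP; apply: contrapT => h; apply: nP; split; apply: contrapT => nP;
    apply: h; [left|right]; split => //=; exact: PN.
Qed.

Lemma cvg_gint_sub (w_ : nat -> 'rV[R]_d -> R) w (p : 'rV[R]_d * 'rV[R]_d) :
  w_ ^~ p.1 @ \oo --> w p.1 -> w_ ^~ p.2 @ \oo --> w p.2 ->
  gint alpha (w_ k \- w) p @[k --> \oo] --> (0 : R).
Proof.
move=> h1 h2; rewrite /gint.
rewrite -[X in _ --> X](mul0r (kern alpha p)); apply: cvgM; last exact: cvg_cst.
have h : ((w_ k \- w) p.1 - (w_ k \- w) p.2) @[k --> \oo] --> (w p.1 - w p.1) - (w p.2 - w p.2).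
  by apply: cvgB; apply: cvgB => //; exact: cvg_cst.
rewrite !subrr in h.
by have := cvg_sqr h; rewrite expr0n.
Qed.

Lemma cvg_gint (w_ : nat -> 'rV[R]_d -> R) w (p : 'rV[R]_d * 'rV[R]_d) :
  w_ ^~ p.1 @ \oo --> w p.1 -> w_ ^~ p.2 @ \oo --> w p.2 ->
  gint alpha (w_ k) p @[k --> \oo] --> gint alpha w p.
Proof.
move=> h1 h2; rewrite /gint; apply: cvgM; last exact: cvg_cst.
by apply: cvg_sqr; exact: cvgB.
Qed.

Lemma gint_sub_le u v p : gint alpha (u \- v) p <= 2 * (gint alpha u p + gint alpha v p).
Proof.
rewrite /gint -mulrDl mulrA ler_wpM2r ?kern_ge0//=.
have := sqr_ge0 ((u p.1 - u p.2) + (v p.1 - v p.2)); nra.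
Qed.

(** Dominated convergence with [4 * G]: the limit inherits the bound [G] pointwise, and the squared
    increments of a difference are at most twice the sum of the two squared increments. *)
Lemma gag_cvg0 (w_ : nat -> 'rV[R]_d -> R) w (G : 'rV[R]_d * 'rV[R]_d -> \bar R) :
  (forall k, measurable_fun setT (w_ k)) -> measurable_fun setT w ->
  {ae leb, forall x, D x -> w_ ^~ x @ \oo --> w x} ->
  measurable_fun (D `*` D) G -> (\int[leb2]_(p in D `*` D) G p < +oo)%E ->
  (forall k p, (D `*` D) p -> ((gint alpha (w_ k) p)%:E <= G p)%E) ->
  gag alpha D (w_ k \- w) @[k --> \oo] --> 0%E.
Proof.
move=> mw_ mw ww mG Goo wG.
have G0 p : (D `*` D) p -> (0 <= G p)%E.
  by move=> pD; apply: le_trans (wG 0%N p pD); rewrite lee_fin gint_ge0.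
have aeww := ae_pair ww.
have m4G : measurable_fun (D `*` D) (fun p => 4%:E * G p)%E by exact: measurable_funeM.
have [|||||] := @dominated_convergence _ _ _ leb2 (D `*` D) mDD
   (fun k p => (gint alpha (w_ k \- w) p)%:E) (cst 0%E) (fun p => 4%:E * G p)%E.
- by move=> k; apply: measurable_gintT; exact: measurable_funB.
- exact: measurable_cst.
- move: aeww; apply: filterS => p [w1 w2] [p1 p2].
  apply: cvg_EFin; first by apply: nearW.
  exact: (cvg_gint_sub (w1 p1) (w2 p2)).
- apply/integrableP; split => //.
  under eq_integral => p /set_mem pD do rewrite gee0_abs ?mule_ge0 ?G0//.
  by rewrite ge0_integralZl// lte_mul_pinfty.
- move: aeww; apply: filterS => p [w1 w2] k [p1 p2].
  have wp : ((gint alpha w p)%:E <= G p)%E.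
    have c : (gint alpha (w_ k) p)%:E @[k --> \oo] --> (gint alpha w p)%:E.
      by apply: cvg_EFin; [by apply: nearW|exact: cvg_gint (w1 p1) (w2 p2)].
    rewrite -(cvg_lim _ c)//; apply: lime_le; first by apply/cvg_ex; eexists; exact: c.
    by apply: nearW => m; exact: wG.
  rewrite gee0_abs ?lee_fin ?gint_ge0//.
  apply: (@le_trans _ _ (2 * (gint alpha (w_ k) p + gint alpha w p))%:E).
    by rewrite lee_fin gint_sub_le.
  rewrite mulr_natl mulr2n EFinD EFinD mule4.
  by do 2! apply: leeD => //; exact: wG.
- by move=> _ _; rewrite integral0.
Qed.

Lemma l2_cvg0 (w_ : nat -> 'rV[R]_d -> R) w (H : 'rV[R]_d -> \bar R) :
  (forall k, measurable_fun setT (w_ k)) -> measurable_fun setT w ->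
  {ae leb, forall x, D x -> w_ ^~ x @ \oo --> w x} ->
  measurable_fun D H -> (\int[leb]_(x in D) H x < +oo)%E ->
  (forall k x, D x -> ((w_ k x ^+ 2)%:E <= H x)%E) ->
  l2 D (w_ k \- w) @[k --> \oo] --> 0%E /\ (l2 D w < +oo)%E.
Proof.
move=> mw_ mw ww mH Hoo wH.
have H0 p : D p -> (0 <= H p)%E.
  by move=> pD; apply: le_trans (wH 0%N p pD); rewrite lee_fin sqr_ge0.
have m4H : measurable_fun D (fun p => 4%:E * H p)%E by exact: measurable_funeM.
have aewH : {ae leb, forall x, D x -> ((w x ^+ 2)%:E <= H x)%E}.
  move: ww; apply: filterS => x /[swap] Dx /(_ Dx) wx.
  have c : (w_ k x ^+ 2)%:E @[k --> \oo] --> (w x ^+ 2)%:E.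
    by apply: cvg_EFin; [by apply: nearW|exact: cvg_sqr].
  rewrite -(cvg_lim _ c)//; apply: lime_le; first by apply/cvg_ex; eexists; exact: c.
  by apply: nearW => m; exact: wH.
split; last first.
  apply: le_lt_trans Hoo; apply: ae_ge0_le_integral => //.
  - by move=> x _; rewrite lee_fin sqr_ge0.
  - by apply: measurable_sqr; exact: measurable_funTS.
have [|||||] := @dominated_convergence _ _ _ leb D mD
   (fun k x => ((w_ k \- w) x ^+ 2)%:E) (cst 0%E) (fun p => 4%:E * H p)%E.
- move=> k; apply: measurable_sqr; apply: measurable_funTS; exact: measurable_funB.
- exact: measurable_cst.
- move: ww; apply: filterS => x /[swap] Dx /(_ Dx) wx.
  apply: cvg_EFin; first by apply: nearW.
  have h : (w_ k \- w) x @[k --> \oo] --> w x - w x by apply: cvgB => //; exact: cvg_cst.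
  by rewrite subrr in h; have := cvg_sqr h; rewrite expr0n.
- apply/integrableP; split => //.
  under eq_integral => p /set_mem pD do rewrite gee0_abs ?mule_ge0 ?H0//.
  by rewrite ge0_integralZl// lte_mul_pinfty.
- move: aewH; apply: filterS => x wx k Dx; rewrite gee0_abs ?lee_fin ?sqr_ge0//.
  apply: (@le_trans _ _ (2 * (w_ k x ^+ 2 + w x ^+ 2))%:E).
    by rewrite lee_fin /=; have := sqr_ge0 (w_ k x + w x); nra.
  rewrite mulr_natl mulr2n EFinD EFinD mule4.
  by apply: leeD; apply: leeD; (exact: wH || exact: wx).
- by move=> _ _; rewrite integral0.
Qed.

Lemma test_function_measurable u : test_function D u -> measurable_fun setT u.
Proof. by move=> [/(_ [::])[cu _] _ _]; exact: continuous_measurable_rV. Qed.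

(** The criterion behind the later membership proofs: test functions that converge almost
    everywhere, with increments and values dominated by fixed integrable functions, converge in the
    norm of the form. *)
Lemma censored_domain_dominated (w_ : nat -> 'rV[R]_d -> R) w
    (G : 'rV[R]_d * 'rV[R]_d -> \bar R) (H : 'rV[R]_d -> \bar R) :
  (forall k, test_function D (w_ k)) -> measurable_fun setT w ->
  {ae leb, forall x, D x -> w_ ^~ x @ \oo --> w x} ->
  measurable_fun (D `*` D) G -> (\int[leb2]_(p in D `*` D) G p < +oo)%E ->
  (forall k p, (D `*` D) p -> ((gint alpha (w_ k) p)%:E <= G p)%E) ->
  measurable_fun D H -> (\int[leb]_(x in D) H x < +oo)%E ->
  (forall k x, D x -> ((w_ k x ^+ 2)%:E <= H x)%E) ->
  censored_domain alpha D w.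
Proof.
move=> tw mw ww mG Goo wG mH Hoo wH.
have mw_ k := test_function_measurable (tw k).
have [l2c l2f] := l2_cvg0 mw_ mw ww mH Hoo wH.
have gc := gag_cvg0 mw_ mw ww mG Goo wG.
split => //; first exact: measurable_funTS.
exists w_; split => //.
have h k : censored_form1 alpha D (w_ k \- w) =
    ((2^-1 * stable_const d alpha)%:E * gag alpha D (w_ k \- w)%R + l2 D (w_ k \- w)%R)%E.
  rewrite /censored_form1 censored_formE//.
  by apply: measurable_funTS; exact: measurable_funB.
under eq_fun do rewrite h.
rewrite (_ : 0%E = (2^-1 * stable_const d alpha)%:E * 0 + 0)%E; last by rewrite mule0 adde0.
apply: cvgeD => //; exact: cvgeZl.
Qed.

End censored_domain_theory.

(** * Smooth functions and bumps *)

Section smooth_functions.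
Variable R : realType.

(** The function exp(-1/t) extended by zero, together with the factors t^(-n) that its derivatives
    produce, so that the derivative of one [flat] is a combination of two others. *)
Definition flat (n : nat) (t : R) : R :=
  if 0 < t then t `^ (- n%:R) * expR (- t^-1) else 0.

(** This is exp(s/m) >= s/m raised to the power m. *)
Lemma expRN_bound (m : nat) (s : R) : 0 <= s -> s ^+ m * expR (- s) <= m%:R ^+ m.
Proof.
move=> s0; case: m => [|m].
  by rewrite !expr0 mul1r -expR0 ler_expR oppr_le0.
have m0 : 0 < m.+1%:R :> R by [].
rewrite expRN ler_pdivrMr ?expR_gt0//.
have -> : s = m.+1%:R * (s / m.+1%:R) by rewrite mulrC divfK// gt_eqF.
rewrite expRM_natl exprMn ler_wpM2l ?exprn_ge0//.
apply: lerXn2r; rewrite ?nnegrE ?divr_ge0 ?expR_ge0//.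
by apply: le_trans (expR_ge1Dx _); rewrite lerDr.
Qed.

Lemma flat_bound n (t : R) : `|flat n t| <= (n.+2)%:R ^+ n.+2 * t ^+ 2.
Proof.
rewrite /flat; case: ifPn => t0; last first.
  by rewrite normr0 mulr_ge0 ?sqr_ge0 ?exprn_ge0.
rewrite ger0_norm ?mulr_ge0 ?powR_ge0 ?expR_ge0//.
rewrite powRN (powR_mulrn _ (ltW t0)).
have := @expRN_bound n.+2 t^-1; rewrite invr_ge0 (ltW t0) => /(_ isT) h.
rewrite -ler_pdivrMr ?exprn_gt0//; apply: le_trans h.
rewrite mulrAC ler_wpM2r ?expR_ge0// exprVn -invfM -exprD addn2; exact: lexx.
Qed.

(** Away from 0 this is the product rule; at 0 the quadratic bound [flat_bound] makes the difference
    quotient tend to 0, in agreement with the right-hand side. *)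
Lemma is_derive_flat n (t : R) :
  is_derive t 1 (flat n) (flat n.+2 t - n%:R * flat n.+1 t).
Proof.
have [t0|t0|<-] := ltgtP 0 t.
- apply: (@near_eq_is_derive _ _ _ (fun t => t `^ (- n%:R) * expR (- t^-1))).
    by near=> s; rewrite /flat ifT//; near: s; exact: lt_nbhsr.
  have h1 := is_derive1_powR (- n%:R) t0.
  have hV : is_derive t 1 (fun y : R => - (y^-1)) (t ^- 2).
    rewrite (_ : t ^- 2 = - (- t ^- 2 *: (1 : R))); last by rewrite [_ *: _]mulr1 opprK.
    exact: (is_deriveN (@is_deriveV R id t 1 1 (lt0r_neq0 t0) (is_derive_id _ _))).
  have h2 := @is_derive1_comp R expR (fun y => - y^-1) t _ _ (is_derive_expR (- t^-1)) hV.
  have := is_deriveM h1 h2.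
  rewrite (_ : _ *: _ + _ *: _ = flat n.+2 t - n%:R * flat n.+1 t)//.
  rewrite /flat t0 /= [X in X + _]mulrC [X in _ + X]mulrC.
  have -> : t `^ (- n.+2%:R) = t `^ (- n%:R) * t ^- 2.
    by rewrite !powRN !(powR_mulrn _ (ltW t0)) -invfM -exprD addn2.
  have -> : - n.+1%:R = - n%:R - 1 :> R by rewrite -addn1 natrD opprD.
  ring.
- apply: (@near_eq_is_derive _ _ _ (cst 0)).
    near=> s; rewrite /flat ifF//; apply/negbTE; rewrite -leNgt ltW//.
    near: s; exact: lt_nbhsl.
  have := is_derive_cst (0 : R) t 1.
  rewrite (_ : flat n.+2 t - n%:R * flat n.+1 t = 0)// /flat !ifF ?mulr0 ?subr0//.
    by apply/negbTE; rewrite -leNgt ltW.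
  by apply/negbTE; rewrite -leNgt ltW.
have f0 m : flat m (0 : R) = 0 by rewrite /flat ltxx.
rewrite !f0 mulr0 subrr.
have c : h^-1 *: ((flat n \o shift 0) (h *: 1) - flat n 0) @[h --> (0 : R)^'] --> (0 : R).
  pose C : R := n.+2%:R ^+ n.+2.
  have C0 : 0 < C by rewrite exprn_gt0.
  apply/cvgr0Pnorm_lt => e e0; near=> h.
  have h0 : h != 0 by near: h; exact: nbhs_dnbhs_neq.
  rewrite /= f0 subr0 addr0 [h *: 1]mulr1 normrM normfV.
  rewrite ltr_pdivrMl ?normr_gt0//.
  apply: le_lt_trans (flat_bound n h) _.
  rewrite -real_normK ?num_real// expr2 mulrA -/C [ltRHS]mulrC ltr_pM2r ?normr_gt0//.
  rewrite -ltr_pdivlMl//; near: h; apply: dnbhs0_lt.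
  by rewrite mulr_gt0 ?invr_gt0.
apply: DeriveDef; first by apply/cvg_ex; exists 0.
exact: cvg_lim c.
Unshelve. all: by end_near.
Qed.

End smooth_functions.

Section smooth_closure.
Variables (R : realType) (d : nat).
Implicit Types (u v w : 'rV[R]_d -> R).

(** Reduces directional derivatives to one real variable, where the chain rule is available. *)
Lemma is_derive_line (u : 'rV[R]_d -> R) (x v : 'rV[R]_d) (du : R) :
  is_derive x v u du <-> is_derive (0 : R) 1 (fun h : R => u (h *: v + x)) du.
Proof.
have E : (fun h : R => h^-1 *: ((u \o shift x) (h *: v) - u x)) =
   (fun h : R => h^-1 *: (((fun h : R => u (h *: v + x)) \o shift 0) (h *: 1) -
     (fun h : R => u (h *: v + x)) 0)).
  apply/funext => h /=; rewrite scale0r add0r addr0; congr (_ *: (u (_ *: _ + _) - _)).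
  by rewrite [RHS]mulr1.
split=> -[h1 h2]; apply: DeriveDef.
- by move: h1; rewrite /derivable E.
- by move: h2; rewrite /derive E.
- by move: h1; rewrite /derivable E.
- by move: h2; rewrite /derive E.
Qed.

Lemma is_derive_comp_rV (f : R -> R) u (x v : 'rV[R]_d) (a b : R) :
  is_derive (u x) 1 f a -> is_derive x v u b -> is_derive x v (f \o u) (a * b).
Proof.
move=> fa /is_derive_line ub; apply/is_derive_line.
rewrite -[u x]/(u x) in fa.
apply: (@is_derive1_comp _ f (fun h : R => u (h *: v + x))) => //.
by rewrite scale0r add0r.
Qed.

(* [smooth] unfolds to iterated partial derivatives, so it is proved for the composites below through a
   class stable under [partial]: the derivatives of [flat n] and of powers stay in it. *)
Inductive smooth_closure : ('rV[R]_d -> R) -> Prop :=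
| smooth_closure_smooth u : smooth u -> smooth_closure u
| smooth_closureD u v : smooth_closure u -> smooth_closure v -> smooth_closure (u + v)
| smooth_closureM u v : smooth_closure u -> smooth_closure v -> smooth_closure (u * v)
| smooth_closure_flat n u : smooth_closure u -> smooth_closure (flat n \o u)
| smooth_closure_powR a u : smooth_closure u -> (forall x, 0 < u x) ->
    smooth_closure ((fun t => t `^ a) \o u).

Lemma smooth_partial i u : smooth u -> smooth (partial i u).
Proof. by move=> su s; have := su (rcons s i); rewrite foldr_rcons. Qed.

Lemma smooth_cst (c : R) : smooth (cst c : 'rV[R]_d -> R).
Proof.
have p0 (c' : R) i : partial i (cst c' : 'rV[R]_d -> R) = cst 0.
  by apply/funext => x; rewrite /partial derive_cst.
have H s : exists c', foldr (@partial R d) (cst c) s = cst c'.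
  elim: s => [|i s [c' IH]]; first by exists c.
  by exists 0 => /=; rewrite IH p0.
move=> s /=; have [c' ->] := H s; split; first exact: cst_continuous.
by move=> i x; exact: derivable_cst.
Qed.

Lemma continuous_derivable1 (f : R -> R) (t df : R) : is_derive t 1 f df -> {for t, continuous f}.
Proof. by move=> [/derivable1_diffP/differentiable_continuous]. Qed.

Lemma smooth_closure_partial u : smooth_closure u ->
  [/\ continuous u, forall i x, derivable u x (delta_mx ord0 i) &
      forall i, smooth_closure (partial i u)].
Proof.
elim=> {u} [u su|u v Cu [cu du pu] Cv [cv dv pv]|u v Cu [cu du pu] Cv [cv dv pv]
  |n u Cu [cu du pu]|a u Cu [cu du pu] u0].
- have [cu du] := su [::]; split => // i; apply: smooth_closure_smooth; exact: smooth_partial.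
- split.
  + by move=> x; apply: continuousD; [exact: cu|exact: cv].
  + by move=> i x; apply: derivableD.
  + move=> i; rewrite (_ : partial i (u + v) = partial i u + partial i v).
      exact: smooth_closureD.
    by apply/funext => x; rewrite /partial deriveD.
- split.
  + by move=> x; apply: continuousM; [exact: cu|exact: cv].
  + by move=> i x; apply: derivableM.
  + move=> i; rewrite (_ : partial i (u * v) = u * partial i v + v * partial i u).
      by apply: smooth_closureD; apply: smooth_closureM.
    by apply/funext => x; rewrite /partial deriveM.
- have H i x := is_derive_comp_rV (is_derive_flat n (u x)) (DeriveDef (du i x) erefl).
  split.
  + move=> x; apply: continuous_comp; first exact: cu.
    exact: continuous_derivable1 (is_derive_flat n (u x)).
  + by move=> i x; have [] := H i x.
  + move=> i; rewrite (_ : partial i _ =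
      ((flat n.+2 \o u) + (cst (- n%:R) * (flat n.+1 \o u))) * partial i u).
      apply: smooth_closureM => //; apply: smooth_closureD; first exact: smooth_closure_flat.
      apply: smooth_closureM; last exact: smooth_closure_flat.
      by apply: smooth_closure_smooth; exact: smooth_cst.
    apply/funext => x; rewrite [LHS](@derive_val _ _ _ _ _ _ _ (H i x)).
    by rewrite -mulNr.
- have H i x := is_derive_comp_rV (is_derive1_powR a (u0 x)) (DeriveDef (du i x) erefl).
  split.
  + move=> x; apply: continuous_comp; first exact: cu.
    exact: continuous_derivable1 (is_derive1_powR a (u0 x)).
  + by move=> i x; have [] := H i x.
  + move=> i; rewrite (_ : partial i _ =
      (cst a * ((fun t => t `^ (a - 1)) \o u)) * partial i u).
      apply: smooth_closureM => //; apply: smooth_closureM; last exact: smooth_closure_powR.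
      by apply: smooth_closure_smooth; exact: smooth_cst.
    by apply/funext => x; rewrite [LHS](@derive_val _ _ _ _ _ _ _ (H i x)).
Qed.

Lemma smooth_closureP u : smooth_closure u -> smooth u.
Proof.
move=> Cu s; have {}Cu : smooth_closure (foldr (@partial R d) u s).
  by elim: s => //= i s IH; have [_ _] := smooth_closure_partial IH; exact.
by have [] := smooth_closure_partial Cu.
Qed.

Lemma smoothD u v : smooth u -> smooth v -> smooth (u + v).
Proof.
by move=> su sv; apply: smooth_closureP; apply: smooth_closureD; exact: smooth_closure_smooth.
Qed.

Lemma smoothM u v : smooth u -> smooth v -> smooth (u * v).
Proof.
by move=> su sv; apply: smooth_closureP; apply: smooth_closureM; exact: smooth_closure_smooth.
Qed.

Lemma smooth_powR a u : smooth u -> (forall x, 0 < u x) -> smooth (fun x => u x `^ a).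
Proof.
move=> su u0; apply: smooth_closureP; apply: (@smooth_closure_powR a u) => //.
exact: smooth_closure_smooth.
Qed.

Lemma smooth_flat u : smooth u -> smooth (fun x => flat 0 (u x)).
Proof.
move=> su; apply: smooth_closureP; apply: (@smooth_closure_flat 0 u).
exact: smooth_closure_smooth.
Qed.

Lemma smooth_coord i : smooth (fun x : 'rV[R]_d => x ord0 i).
Proof.
have D j x : is_derive x (delta_mx ord0 j) (fun x : 'rV[R]_d => x ord0 i) (j == i)%:R.
  apply/is_derive_line.
  rewrite (_ : (fun _ => _) = (fun h : R => h * (j == i)%:R + x ord0 i)); last first.
    by apply/funext => h; rewrite !mxE eqxx eq_sym.
  have H := is_deriveD (is_deriveM (is_derive_id (0 : R) (1 : R)) (is_derive_cst ((j == i)%:R : R) (0 : R) (1 : R)))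
    (is_derive_cst (x ord0 i) (0 : R) (1 : R)).
  apply: is_derive_eq H _.
  by rewrite /= scaler0 add0r addr0 [_ *: _]mulr1.
have p0 j : partial j (fun x : 'rV[R]_d => x ord0 i) = cst (j == i)%:R.
  by apply/funext => x; exact: (@derive_val _ _ _ _ _ _ _ (D j x)).
case/lastP => [|s j] /=.
  split; first exact: coord_continuous.
  by move=> j x; have [] := D j x.
rewrite foldr_rcons p0; exact: smooth_cst.
Qed.

Lemma smooth_sum I (s : seq I) (f : I -> 'rV[R]_d -> R) :
  (forall i, smooth (f i)) -> smooth (fun x => \sum_(i <- s) f i x).
Proof.
move=> sf; elim: s => [|i s IH].
  rewrite (_ : (fun _ => _) = cst 0); first exact: smooth_cst.
  by apply/funext => x; rewrite big_nil.
rewrite (_ : (fun _ => _) = f i + (fun x => \sum_(j <- s) f j x)); first exact: smoothD.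
by apply/funext => x; rewrite big_cons.
Qed.

End smooth_closure.

Section flat_estimates.
Variable R : realType.
Implicit Types s t : R.

Lemma flat_ge0 n t : 0 <= flat n t.
Proof. by rewrite /flat; case: ifP => // _; rewrite mulr_ge0 ?powR_ge0 ?expR_ge0. Qed.

Lemma flat0_le1 t : flat 0 t <= 1.
Proof.
rewrite /flat; case: ifP => // t0.
by rewrite oppr0 powRr0 mul1r -expR0 ler_expR oppr_le0 invr_ge0 ltW.
Qed.

Lemma flat0_eq0 t : t <= 0 -> flat 0 t = 0.
Proof. by rewrite /flat ltNge => ->. Qed.

Lemma flat0_ge t : 2^-1 <= t -> expR (- 2) <= flat 0 t.
Proof.
move=> t2; have t0 : 0 < t by apply: lt_le_trans t2; rewrite invr_gt0.
rewrite /flat t0 oppr0 powRr0 mul1r ler_expR lerN2.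
by rewrite -[leRHS]invrK lef_pV2 ?posrE ?invr_gt0.
Qed.

(** The derivative [flat 2] equals s^2 exp(-s) with s = 1/t for positive t, hence is at most 2^2 by
    [expRN_bound]. *)
Lemma flat0_lipschitz s t : `|flat 0 s - flat 0 t| <= 4 * `|s - t|.
Proof.
wlog st : s t / s < t.
  move=> H; have [st|st|<-] := ltgtP s t; last by rewrite !subrr normr0 mulr0.
    exact: H.
  by rewrite (distrC s) (distrC (flat 0 s)); exact: H.
have df (x : R) : is_derive x 1 (flat 0) (flat 2 x).
  by have := is_derive_flat 0 x; rewrite mul0r subr0.
have cf : {within `[s, t], continuous (flat 0 : R -> R)}.
  by apply: continuous_subspaceT => x; exact: continuous_derivable1 (df x).
have [c _ E] := @MVT R (flat 0) (flat 2) s t st (fun x _ => df x) cf.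
rewrite distrC E normrM (distrC s) ler_wpM2r// ger0_norm ?flat_ge0// /flat.
case: ifP => // c0; have := @expRN_bound R 2 c^-1.
rewrite invr_ge0 (ltW c0) powRN powR_mulrn ?(ltW c0)// exprVn => /(_ isT) h.
by apply: le_trans h _; rewrite -natrX ler_nat.
Qed.

End flat_estimates.

Section bumps.
Variables (R : realType) (d : nat).
Implicit Types (x y c : 'rV[R]_d) (s : R) (D : set 'rV[R]_d).

Definition bump c s y : R := flat 0 (1 - enorm (y - c) ^+ 2 / s ^+ 2).

Lemma bump_ge0 c s y : 0 <= bump c s y.
Proof. exact: flat_ge0. Qed.

Lemma bump_le1 c s y : bump c s y <= 1.
Proof. exact: flat0_le1. Qed.

Lemma bump_eq0 c s y : 0 < s -> s <= enorm (y - c) -> bump c s y = 0.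
Proof.
move=> s0 sy; apply: flat0_eq0; rewrite subr_le0 ler_pdivlMr ?exprn_gt0// mul1r.
by rewrite ler_pXn2r ?nnegrE ?enorm_ge0 ?(ltW s0).
Qed.

(** At distance at most 2s/3 the argument of [flat 0] is at least 1 - 4/9, hence at least 1/2. *)
Lemma bump_ge c s y : 0 < s -> 3 * enorm (y - c) <= 2 * s -> expR (- 2) <= bump c s y.
Proof.
move=> s0 sy; apply: flat0_ge.
rewrite lerBrDr -lerBrDl ler_pdivrMr ?exprn_gt0//.
have := enorm_ge0 (y - c); set e := enorm _ in sy * => e0; nra.
Qed.

Lemma smooth_bump c s : smooth (bump c s).
Proof.
apply: smooth_flat.
rewrite (_ : (fun x => _) = cst 1 + cst (- (s ^+ 2)^-1) *
    (fun y => \sum_(i < d) (((fun y : 'rV[R]_d => y ord0 i) + cst (- c ord0 i)) *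
                            ((fun y : 'rV[R]_d => y ord0 i) + cst (- c ord0 i))) y)).
  apply: smoothD; first exact: smooth_cst.
  apply: smoothM; first exact: smooth_cst.
  have H i : smooth ((fun y : 'rV[R]_d => y ord0 i) + cst (- c ord0 i)).
    by apply: smoothD; [exact: smooth_coord|exact: smooth_cst].
  by apply: smooth_sum => i; exact: smoothM.
apply/funext => y; rewrite sqr_enorm.
rewrite [RHS](_ : _ = 1 + - (s ^+ 2)^-1 * \sum_(i < d) (y ord0 i - c ord0 i) ^+ 2)//.
by rewrite mulNr mulrC; congr (_ - _ * _); apply: eq_bigr => i _; rewrite !mxE.
Qed.

Lemma bump_lipschitz c s x y : 0 < s -> `|bump c s x - bump c s y| <= 16 / s * enorm (x - y).
Proof.
move=> s0.
wlog xy : x y / enorm (x - c) <= enorm (y - c).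
  move=> H; have [|/ltW] := leP (enorm (x - c)) (enorm (y - c)); first exact: H.
  by move=> /H; rewrite distrC enormB.
have D1 : enorm (y - c) - enorm (x - c) <= enorm (x - y).
  by rewrite lerBlDr (enormB x) (enorm_distD x).
have ex0 := enorm_ge0 (x - c); have exy0 := enorm_ge0 (x - y).
have [sx|xs] := leP s (enorm (x - c)).
  by rewrite !bump_eq0 ?(le_trans sx)// subrr normr0 mulr_ge0// divr_ge0// ltW.
(* The squared norm is Lipschitz only on bounded sets. If [y] is at distance at least 2s from the
   centre, then |x - y| >= s and the trivial bound 1 suffices; otherwise the two distances sum to at
   most 3s, which gives 4 * 3 / s. *)
have [sy|ys] := leP (2 * s) (enorm (y - c)).
  apply: (@le_trans _ _ 1).
    rewrite (bump_eq0 (y := y))// ?subr0 ?ger0_norm ?bump_ge0 ?bump_le1//.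
    by apply: le_trans sy; lra.
  rewrite mulrAC ler_pdivlMr// mul1r; lra.
apply: le_trans (flat0_lipschitz _ _) _.
rewrite (_ : _ - _ = (enorm (y - c) ^+ 2 - enorm (x - c) ^+ 2) * (s ^+ 2)^-1); last by ring.
rewrite normrM (ger0_norm (x := (_ ^+ _)^-1)) ?invr_ge0 ?sqr_ge0//.
rewrite ger0_norm; last by rewrite subr_ge0 ler_pXn2r ?nnegrE ?enorm_ge0.
rewrite mulrA ler_pdivrMr ?exprn_gt0//.
rewrite (_ : 16 / s * enorm (x - y) * s ^+ 2 = 16 * enorm (x - y) * s); last first.
  by field; rewrite gt_eqF.
rewrite subr_sqr.
set a := enorm (y - c) in xy D1 ys *; set b := enorm (x - c) in xy D1 ex0 xs *.
set e := enorm _ in D1 exy0 *.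
have : (a - b) * (a + b) <= e * (3 * s) by apply: ler_pM; lra.
by nra.
Qed.

Lemma bump_diff_le1 c s x y : (bump c s x - bump c s y) ^+ 2 <= 1.
Proof.
have := bump_ge0 c s x; have := bump_le1 c s x.
have := bump_ge0 c s y; have := bump_le1 c s y.
by set a := bump _ _ y; set b := bump _ _ x; nra.
Qed.

Lemma bump_diff_le c s x y : 0 < s ->
  (bump c s x - bump c s y) ^+ 2 <= 256 * (enorm (x - y) / s) ^+ 2.
Proof.
move=> s0; have h := bump_lipschitz c x y s0.
rewrite -real_normK ?num_real//.
have -> : 256 * (enorm (x - y) / s) ^+ 2 = (16 / s * enorm (x - y)) ^+ 2.
  by rewrite !exprMn; ring.
by rewrite ler_pXn2r// nnegrE// mulr_ge0 ?enorm_ge0// divr_ge0// ltW.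
Qed.

Lemma closed_eball_closed c s : closed [set y : 'rV[R]_d | enorm (y - c) <= s].
Proof.
rewrite (_ : [set y | _] = (fun y => enorm (y - c)) @^-1` [set t | t <= s])//.
apply: closed_comp; last exact: closed_le.
move=> y _; apply: continuous_comp; last exact: continuous_enorm.
by apply: continuousB; [exact: cvg_id|exact: cst_continuous].
Qed.

Lemma closed_eball_compact c s : compact [set y : 'rV[R]_d | enorm (y - c) <= s].
Proof.
apply: bounded_closed_compact; last exact: closed_eball_closed.
exists (enorm c + s); split; first exact: num_real.
move=> M cM y /= ys; apply: le_trans (ltW cM).
apply: le_trans (norm_le_enorm y) _.
by rewrite -[y](subrK c) (le_trans (enormD _ _))// addrC lerD2l.
Qed.

Lemma test_function_bump D c s : 0 < s ->
  (forall y, enorm (y - c) <= s -> D y) -> test_function D (bump c s).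
Proof.
move=> s0 sD.
have H : closure [set y | bump c s y != 0] `<=` [set y | enorm (y - c) <= s].
  rewrite [X in _ `<=` X](closure_id _).1; last exact: closed_eball_closed.
  apply: closureS => y /= y0; rewrite leNgt; apply: contra y0 => ys.
  by rewrite bump_eq0// ltW.
split; first exact: smooth_bump.
  by apply: subclosed_compact H; [exact: closed_closure|exact: closed_eball_compact].
by move=> y /H; exact: sD.
Qed.

(** Smooth modifications that vanish where [u] does keep the support compact in [D]. This is the
    reason why the nonlinear maps applied to test functions below all fix 0. *)
Lemma test_function_zero D u v : test_function D u -> smooth v ->
  (forall x, u x = 0 -> v x = 0) -> test_function D v.
Proof.
move=> [su cu uD] sv uv.
have H : closure [set x | v x != 0] `<=` closure [set x | u x != 0].
  by apply: closureS => x /=; apply: contra => /eqP/uv ->.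
split=> //; last exact: subset_trans uD.
by apply: subclosed_compact H; [exact: closed_closure|exact: cu].
Qed.

Lemma test_function_zero2 D u v w : test_function D u -> test_function D v -> smooth w ->
  (forall x, u x = 0 -> v x = 0 -> w x = 0) -> test_function D w.
Proof.
move=> [su cu uD] [sv cv vD] sw uvw.
have H : closure [set x | w x != 0] `<=` closure [set x | u x != 0] `|` closure [set x | v x != 0].
  rewrite -closureU; apply: closureS => x /=; have [u0|] := eqVneq (u x) 0; last by left.
  by have [v0|] := eqVneq (v x) 0; [rewrite uvw ?eqxx|right].
split=> //; last by move=> x /H[/uD|/vD].
by apply: subclosed_compact H; [exact: closed_closure|exact: compactU].
Qed.

Lemma test_function_smooth D u : test_function D u -> smooth u.
Proof. by case. Qed.

Lemma test_function_sum_sqr D n (u : 'I_n.+1 -> 'rV[R]_d -> R) :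
  (forall i, test_function D (u i)) ->
  test_function D (fun x => \sum_(i < n.+1) u i x ^+ 2).
Proof.
elim: n u => [|n IH] u tu.
  have su := test_function_smooth (tu ord0).
  rewrite (_ : (fun _ => _) = u ord0 * u ord0).
    apply: (test_function_zero (tu ord0)); first exact: smoothM.
    by move=> x u0; rewrite [LHS](_ : _ = u ord0 x * u ord0 x)// u0 mul0r.
  by apply/funext => x; rewrite big_ord1.
have su := test_function_smooth (tu ord0).
have tS := IH (fun i => u (lift ord0 i)) (fun i => tu _).
rewrite (_ : (fun _ => _) = u ord0 * u ord0 + (fun x => \sum_(i < n.+1) u (lift ord0 i) x ^+ 2)).
  apply: (test_function_zero2 (tu ord0) tS).
    by apply: smoothD; [exact: smoothM|exact: test_function_smooth tS].
  by move=> x /= u0 v0; rewrite [LHS](_ : _ = u ord0 x * u ord0 x +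
    \sum_(i < n.+1) u (lift ord0 i) x ^+ 2)// u0 v0 mul0r addr0.
by apply/funext => x; rewrite big_ord_recl.
Qed.

(** The shift by [e] inside the root keeps its argument away from the singularity at 0, and
    subtracting [e] restores the vanishing outside the supports. *)
Lemma test_function_l2norm D n (e : R) (u : 'I_n.+1 -> 'rV[R]_d -> R) : 0 < e ->
  (forall i, test_function D (u i)) ->
  test_function D (fun x => Num.sqrt (e ^+ 2 + \sum_(i < n.+1) u i x ^+ 2) - e).
Proof.
move=> e0 tu; have tS := test_function_sum_sqr tu.
apply: (test_function_zero tS); last first.
  by move=> x ->; rewrite addr0 sqrtr_sqr ger0_norm ?subrr// ltW.
have p x : 0 < e ^+ 2 + \sum_(i < n.+1) u i x ^+ 2.
  by rewrite ltr_pwDl ?exprn_gt0// sum_sqr_ge0.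
rewrite (_ : (fun _ => _) =
    (fun x => (e ^+ 2 + \sum_(i < n.+1) u i x ^+ 2) `^ 2^-1) + cst (- e)).
  apply: smoothD; last exact: smooth_cst.
  apply: smooth_powR => //; apply: (@smoothD _ _ (cst (e ^+ 2))); first exact: smooth_cst.
  exact: (test_function_smooth tS).
by apply/funext => x; rewrite [RHS](_ : _ = (e ^+ 2 + \sum_(i < n.+1) u i x ^+ 2) `^ 2^-1 - e)//
  powR12_sqrt// ltW.
Qed.

End bumps.

(** * The truncated kernel *)

Section dyadic_integral.
Variable R : realType.

Lemma dyadic_shell (q : R) : 1 <= q -> exists k : nat, 2 ^+ k <= q <= 2 ^+ k.+1.
Proof.
move=> q1.
have ex : exists n : nat, q <= 2 ^+ n.
  exists (Num.truncn q).+1; apply/ltW/(lt_trans (truncnS_gt _)).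
  by rewrite -natrX ltr_nat ltn_expl.
have := ex_minnP ex; case=> [[|k] qk kmin].
  by exists 0%N; rewrite expr0 q1/= (le_trans qk)// expr0 expr1 ler1n.
exists k; rewrite qk andbT leNgt; apply/negP => /ltW /kmin.
by rewrite ltnn.
Qed.

Lemma nneseries_geometric_le (c q : R) (a : nat -> \bar R) : 0 <= c -> 0 <= q < 1 ->
  (forall k, (0 <= a k <= (c * q ^+ k)%:E)%E) -> (\sum_(0 <= k <oo) a k <= (c / (1 - q))%:E)%E.
Proof.
move=> c0 /andP[q0 q1] ac.
apply: lime_le; first by apply: is_cvg_nneseries => k _ _; have /andP[] := ac k.
apply: nearW => n.
apply: (@le_trans _ _ (\sum_(0 <= k < n) (c * q ^+ k)%:E)%E).
  by apply: lee_sum => k _; have /andP[] := ac k.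
rewrite sumEFin lee_fin -mulr_sumr ler_wpM2l// -[leRHS]mul1r ler_pdivlMr ?subr_gt0//.
have -> : (\sum_(0 <= i < n) q ^+ i) * (1 - q) = 1 - q ^+ n.
  elim: n => [|n IH]; first by rewrite big_geq// mul0r expr0 subrr.
  by rewrite big_nat_recr//= mulrDl IH exprSr; ring.
by rewrite gerBl exprn_ge0.
Qed.

(** The set where [q] is positive is covered by dyadic shells going outwards and inwards from
    [q = 1]. Each shell is enlarged to a strict sublevel set, whence the extra factor 2 in the
    radii, so that only volumes of balls have to be known. *)
Lemma dyadic_integral_le d (T : measurableType d) (mu : {measure set T -> \bar R})
    (q f : T -> R) (b1 b2 : nat -> R) (K q1 q2 : R) :
  measurable_fun setT q -> measurable_fun setT f ->
  (forall y, 0 <= f y) -> (forall y, q y <= 0 -> f y = 0) ->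
  (forall k, 0 <= b1 k) -> (forall k, 0 <= b2 k) ->
  (forall k y, 2 ^+ k <= q y <= 2 ^+ k.+1 -> f y <= b1 k) ->
  (forall k y, 2 ^- k.+1 <= q y <= 2 ^- k -> f y <= b2 k) ->
  0 <= K -> 0 <= q1 < 1 -> 0 <= q2 < 1 ->
  (forall k, ((b1 k)%:E * mu [set y | q y < 2 ^+ k.+2]%R <= (K * q1 ^+ k)%:E)%E) ->
  (forall k, ((b2 k)%:E * mu [set y | q y < 2 * 2 ^- k]%R <= (K * q2 ^+ k)%:E)%E) ->
  (\int[mu]_y (f y)%:E <= (K / (1 - q1) + K / (1 - q2))%:E)%E.
Proof.
move=> mq mf f0 fq b10 b20 fb1 fb2 K0 q11 q21 mb1 mb2.
pose A1 k := [set y | q y < 2 ^+ k.+2].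
pose A2 k := [set y | q y < 2 * 2 ^- k].
have mlt c : measurable [set y | q y < c].
  rewrite -[X in measurable X]setTI (_ : [set y | q y < c] = q @^-1` `]-oo, c[%classic).
    exact: mq.
  by apply/seteqP; split => y /=; rewrite in_itv.
have mA1 k : measurable (A1 k) by exact: mlt.
have mA2 k : measurable (A2 k) by exact: mlt.
pose g1 k (y : T) : \bar R := (b1 k * \1_(A1 k) y)%:E.
pose g2 k (y : T) : \bar R := (b2 k * \1_(A2 k) y)%:E.
have mg1 k : measurable_fun setT (g1 k).
  by apply/measurable_EFinP; apply: measurable_funM => //; exact: measurable_indic.
have mg2 k : measurable_fun setT (g2 k).
  by apply/measurable_EFinP; apply: measurable_funM => //; exact: measurable_indic.
have g10 k y : (0 <= g1 k y)%E by rewrite lee_fin mulr_ge0.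
have g20 k y : (0 <= g2 k y)%E by rewrite lee_fin mulr_ge0.
have s1 y : (0 <= \sum_(0 <= k <oo) g1 k y)%E by exact: nneseries_ge0.
have s2 y : (0 <= \sum_(0 <= k <oo) g2 k y)%E by exact: nneseries_ge0.
have term (g : nat -> T -> \bar R) k y : (forall k y, 0 <= g k y)%E ->
    (g k y <= \sum_(0 <= k <oo) g k y)%E.
  move=> g0; apply: (@le_trans _ _ (\sum_(0 <= i < k.+1) g i y)%E).
    by rewrite big_nat_recr//= leeDr// sume_ge0.
  exact: nneseries_lim_ge.
have ms1 : measurable_fun setT (fun y => \sum_(0 <= k <oo) g1 k y)%E.
  by apply: ge0_emeasurable_sum => // k y _ _; exact: g10.
have ms2 : measurable_fun setT (fun y => \sum_(0 <= k <oo) g2 k y)%E.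
  by apply: ge0_emeasurable_sum => // k y _ _; exact: g20.
apply: (@le_trans _ _ (\int[mu]_y (\sum_(0 <= k <oo) g1 k y + \sum_(0 <= k <oo) g2 k y))%E).
  apply: ge0_le_integral => //.
  - by move=> y _; rewrite lee_fin.
  - exact/measurable_EFinP.
  - exact: emeasurable_funD.
  move=> y _; have [qy|qy] := leP (q y) 0; first by rewrite fq// adde_ge0.
  have [q1y|yq1] := leP 1 (q y).
    have [k kq] := dyadic_shell q1y.
    apply: le_trans (leeDl _ (s2 y)).
    apply: le_trans (term g1 k y g10); rewrite /g1 indicE mem_set ?mulr1 ?lee_fin ?fb1//.
    have /andP[_ qk] := kq; by rewrite /A1 /= (le_lt_trans qk)// ltr_eXn2l ?ltr1n.
  have : 1 <= (q y)^-1 by rewrite invf_ge1// ltW.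
  move=> /dyadic_shell[k /andP[k1 k2]].
  have {}k1 : q y <= 2 ^- k by rewrite -[q y]invrK lef_pV2// posrE ?exprn_gt0// invr_gt0.
  have {}k2 : 2 ^- k.+1 <= q y by rewrite -[leRHS]invrK lef_pV2// posrE ?exprn_gt0// invr_gt0.
  apply: le_trans (leeDr _ (s1 y)).
  apply: le_trans (term g2 k y g20); rewrite /g2 indicE mem_set ?mulr1 ?lee_fin ?fb2 ?k1 ?k2//.
  by rewrite /A2 /= (le_lt_trans k1)// mulr_natl mulr2n ltrDl invr_gt0 exprn_gt0.
rewrite ge0_integralD// EFinD.
have ig (b : R) (A : set T) : 0 <= b -> measurable A ->
    (\int[mu]_y (b * \1_A y)%:E = b%:E * mu A)%E.
  move=> b0 mA; under eq_integral do rewrite EFinM.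
  rewrite ge0_integralZl//; first by rewrite integral_indic// setIT.
  by apply/measurable_EFinP; exact: measurable_indic.
apply: leeD; rewrite integral_nneseries//; apply: nneseries_geometric_le => // k.
  by rewrite /g1 ig// mule_ge0 ?lee_fin//=; exact: mb1.
by rewrite /g2 ig// mule_ge0 ?lee_fin//=; exact: mb2.
Qed.

End dyadic_integral.

Section kernel_cutoff.
Variables (R : realType) (d : nat) (alpha : R).
Hypothesis alpha02 : 0 < alpha < 2.
Local Notation leb := (@lebesgue_rV R d).
Implicit Types x y : 'rV[R]_d.

(** A majorant, up to a constant, of the kernel times the squared increment of a bump of radius [s]:
    such an increment is at most 1, and it is Lipschitz at scale [s]. *)
Definition cutoff (s : R) (p : 'rV[R]_d * 'rV[R]_d) : R :=
  Num.min 1 ((enorm (p.1 - p.2) / s) ^+ 2) * kern alpha p.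

Lemma cutoff_ge0 s p : 0 <= cutoff s p.
Proof. by rewrite mulr_ge0 ?kern_ge0// le_min ler01 sqr_ge0. Qed.

Lemma measurable_cutoff s : measurable_fun setT (cutoff s).
Proof.
apply: measurable_funM; last exact: measurable_kern.
apply: measurable_minr => //; apply: measurable_funX.
apply: measurable_funM => //; exact: measurable_enormB.
Qed.

Lemma measurable_cutoff2 s x : measurable_fun setT (fun y => cutoff s (x, y)).
Proof. by apply: (measurableT_comp (measurable_cutoff s)); exact: pair1_measurable. Qed.

(** Outer shells contribute a geometric series of ratio 2^(-alpha) and inner shells one of ratio
    2^(alpha - 2), so both ends of the range of [alpha] are used. The power of [s] comes from
    scaling. *)
Lemma kernel_cutoff : exists2 C : R, 0 < C & forall s x, 0 < s ->
  (\int[leb]_y (cutoff s (x, y))%:E <= (C * s `^ (- alpha))%:E)%E.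
Proof.
have /andP[a0 a2] := alpha02.
(* The factor 8^d is the volume of the cube around a ball of radius 4 (at unit scale), and 4 is the
   ratio of the squared radii of an inner shell. *)
pose K0 : R := 4 * 8 ^+ d.
pose q1 : R := 2 `^ (- alpha). pose q2 : R := 2 `^ (alpha - 2).
have lt1 (a : R) : a < 0 -> 0 <= 2 `^ a < 1.
  move=> a00; rewrite powR_ge0 /powR gt_eqF// -[X in _ < X]expR0 ltr_expR.
  by rewrite nmulr_rlt0// ln_gt0// ltr1n.
have q11 : 0 <= q1 < 1 by apply: lt1; lra.
have q21 : 0 <= q2 < 1 by apply: lt1; lra.
have K00 : 0 < K0 by rewrite mulr_gt0// exprn_gt0.
exists (K0 / (1 - q1) + K0 / (1 - q2)).
  have /andP[_ h1] := q11; have /andP[_ h2] := q21.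
  by rewrite addr_gt0// divr_gt0// subr_gt0.
move=> s x s0.
rewrite mulrDl.
rewrite (_ : K0 / (1 - q1) * s `^ (- alpha) = (K0 * s `^ (- alpha)) / (1 - q1)); last by rewrite mulrAC.
rewrite (_ : K0 / (1 - q2) * s `^ (- alpha) = (K0 * s `^ (- alpha)) / (1 - q2)); last by rewrite mulrAC.
have vol t : 0 < t -> (leb [set y | (enorm (x - y) / s) < 4 * t]%R <= ((8 * (t * s)) ^+ d)%:E)%E.
  move=> t0; rewrite (_ : [set y | _] = eball x (4 * t * s)).
    apply: le_trans (lebesgue_eball_le _ _) _; first by rewrite !mulr_ge0// ltW.
    by rewrite lee_fin (_ : 2 * (4 * t * s) = 8 * (t * s))//; ring.
  by apply/seteqP; split => y; rewrite /eball /= enormB ltr_pdivrMr.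
have key t : 0 < t -> ((t * s) `^ (- (d%:R + alpha))) * (8 * (t * s)) ^+ d =
    8 ^+ d * (t `^ (- alpha) * s `^ (- alpha)).
  move=> t0; have ts0 : 0 < t * s by rewrite mulr_gt0.
  rewrite exprMn opprD powRD ?(gt_eqF ts0) ?implybT// (powR_invn _ (ltW ts0)).
  rewrite -powRM ?(ltW s0) ?(ltW t0)//.
  by field; rewrite gt_eqF ?exprn_gt0.
have kb t y : 0 < t -> t <= enorm (x - y) / s -> kern alpha (x, y) <= (t * s) `^ (- (d%:R + alpha)).
  move=> t0; rewrite ler_pdivlMr// => ty.
  have ts0 : 0 < t * s by rewrite mulr_gt0.
  rewrite /kern powRN lef_pV2 ?posrE ?powR_gt0//=; last exact: lt_le_trans ty.
  apply: ge0_ler_powR => //; rewrite ?nnegrE ?enorm_ge0 ?(ltW ts0)//.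
  by rewrite addr_ge0// ltW.
apply: (@dyadic_integral_le _ _ _ leb (fun y => enorm (x - y) / s) _
  (fun k => (2 ^+ k * s) `^ (- (d%:R + alpha)))
  (fun k => 4 * (2 ^- k.+1) ^+ 2 * (2 ^- k.+1 * s) `^ (- (d%:R + alpha)))) => //.
- apply: measurable_funM => //.
  exact: (measurableT_comp (@measurable_enormB R d) (pair1_measurable x)).
- exact: measurable_cutoff2.
- by move=> y; exact: cutoff_ge0.
- move=> y; rewrite ler_pdivrMr// mul0r => e0.
  have {}e0 : enorm (x - y) = 0 by apply/eqP; rewrite eq_le e0 enorm_ge0.
  by rewrite /cutoff /= e0 mul0r expr0n /= min_r ?mul0r.
- by move=> k; rewrite powR_ge0.
- by move=> k; rewrite mulr_ge0 ?powR_ge0// mulr_ge0// sqr_ge0.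
- move=> k y /andP[k1 _]; apply: le_trans (kb (2 ^+ k) y _ k1); last by rewrite exprn_gt0.
  by rewrite /cutoff ler_piMl ?kern_ge0// ge_min lexx.
- move=> k y /andP[k1 k2]; rewrite /cutoff; apply: ler_pM.
  + by rewrite le_min ler01 sqr_ge0.
  + exact: kern_ge0.
  + rewrite ge_min; apply/orP; right => /=.
    rewrite (_ : 4 * _ = (2 ^- k) ^+ 2); last first.
      by rewrite (exprS _ k); field; rewrite expf_neq0.
    by rewrite ler_pXn2r// nnegrE ?divr_ge0 ?enorm_ge0 ?invr_ge0 ?exprn_ge0// ltW.
  + by apply: kb => //; rewrite invr_gt0 exprn_gt0.
- by rewrite mulr_ge0 ?powR_ge0// ltW.
- move=> k; apply: le_trans (_ : ((2 ^+ k * s) `^ (- (d%:R + alpha)) * (8 * (2 ^+ k * s)) ^+ d)%:E <= _)%E.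
    rewrite [leRHS]EFinM lee_wpmul2l ?lee_fin ?powR_ge0//.
    have := vol (2 ^+ k); rewrite exprn_gt0// => /(_ isT); rewrite (_ : 4 * 2 ^+ k = 2 ^+ k.+2)//.
    by rewrite !exprS; ring.
  rewrite lee_fin key ?exprn_gt0//.
  rewrite [leRHS](_ : _ = 4 * (8 ^+ d * (q1 ^+ k * s `^ (- alpha)))); last by rewrite /K0; ring.
  rewrite (_ : (2 ^+ k) `^ (- alpha) = q1 ^+ k).
    rewrite ler_peMl ?ler1n// !mulr_ge0 ?powR_ge0 ?exprn_ge0//.
    by rewrite powR_ge0.
  by rewrite -(powR_mulrn k (ler0n R 2)) powRAC (powR_mulrn k (powR_ge0 _ _)).
- move=> k; set t := 2 ^- k.+1.
  have t0 : 0 < t by rewrite invr_gt0 exprn_gt0.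
  apply: le_trans (_ : (4 * t ^+ 2 * (t * s) `^ (- (d%:R + alpha)) * (8 * (t * s)) ^+ d)%:E <= _)%E.
    rewrite [leRHS]EFinM lee_wpmul2l ?lee_fin//.
      by rewrite mulr_ge0 ?powR_ge0// mulr_ge0// sqr_ge0.
    have := vol t t0; rewrite (_ : 4 * t = 2 * 2 ^- k)//.
    by rewrite /t exprS invfM; field; rewrite expf_neq0.
  rewrite lee_fin -mulrA key//.
  rewrite [leRHS](_ : _ = 4 * q2 ^+ k * (8 ^+ d * s `^ (- alpha))); last by rewrite /K0; ring.
  rewrite [leLHS](_ : _ = 4 * (t ^+ 2 * t `^ (- alpha)) * (8 ^+ d * s `^ (- alpha))); last by ring.
  rewrite ler_wpM2r ?mulr_ge0 ?powR_ge0 ?exprn_ge0// ler_wpM2l//.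
  have -> : t ^+ 2 * t `^ (- alpha) = q2 ^+ k.+1.
    rewrite -(powR_mulrn 2 (ltW t0)) -powRD ?(gt_eqF t0) ?implybT//.
    have -> : t = 2 `^ (- k.+1%:R) by rewrite powR_invn.
    rewrite -powRrM /q2 -[RHS]powR_mulrn ?powR_ge0// -powRrM.
    by congr (_ `^ _); ring.
  have /andP[q20 /ltW q2le] := q21.
  by rewrite exprS ler_piMl// exprn_ge0.
Qed.

End kernel_cutoff.

(** * Positivity of the normalizing constant *)

Section gamma_positivity.
Variable R : realType.
Local Notation leb1 := (@lebesgue_measure R).

Let gam (s t : R) : R := if 0 < t then t `^ (s - 1) * expR (- t) else 0.

Let measurable_gam s : measurable_fun setT (gam s).
Proof.
apply: measurable_fun_ifT => //.
- exact: measurable_fun_ltr.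
- apply: measurable_funM; first exact: measurable_powR.
  exact: (measurableT_comp (@measurable_expR R) (@measurable_funN _ _ _ _ _ (@measurable_id _ _ _))).
Qed.

Let integral_gam s : (\int[leb1]_(t in `]0%R, +oo[) (t `^ (s - 1) * expR (- t))%:E =
  \int[leb1]_t (gam s t)%:E)%E.
Proof.
rewrite integral_mkcond; apply: eq_integral => t _; rewrite patchE /gam.
case: ifPn => [|]; first by rewrite inE /= in_itv /= andbT => ->.
by rewrite notin_setE /= in_itv /= andbT => /negP/negbTE ->.
Qed.

Let gam_ge0 s t : 0 <= gam s t.
Proof. by rewrite /gam; case: ifP => // _; rewrite mulr_ge0 ?powR_ge0 ?expR_ge0. Qed.

(** Dyadic shells again: for large t the exponential beats any power, and near 0 a shell of length
    about 2^(-k) contributes about 2^(-s k). *)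
Let gam_lty s : 0 < s -> (\int[leb1]_t (gam s t)%:E < +oo)%E.
Proof.
move=> s0.
pose m := (Num.truncn (s + 1)).+1.
(* With this [m], the part t^m exp(-t) is bounded by m^m and the remaining power is at most t^(-2)
   for t >= 1, which beats the lengths of the shells. *)
have sm : s - 1 - m%:R <= - 2 by have := truncnS_gt (s + 1); rewrite -/m; lra.
pose M : R := m%:R ^+ m.
have M0 : 0 <= M by rewrite exprn_ge0.
have q21 : 0 <= (2 : R) `^ (- s) < 1.
  rewrite powR_ge0 /powR gt_eqF// -[X in _ < X]expR0 ltr_expR.
  by rewrite nmulr_rlt0 ?oppr_lt0// ln_gt0// ltr1n.
have vol (c : R) : 0 <= c -> (leb1 [set y | `|y| < c]%R = (2 * c)%:E)%E.
  move=> c0; rewrite (_ : [set y | _] = ball 0 c).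
    by rewrite lebesgue_measure_ball// mulr2n mulrDl mul1r.
  by apply/seteqP; split => y; rewrite /ball /= sub0r normrN.
apply: le_lt_trans (@dyadic_integral_le R _ _ leb1 (fun t => `|t|) (gam s)
  (fun k => M * 2 ^- k ^+ 2) (fun k => 2 * 2 ^+ k * (2 `^ (- s)) ^+ k)
  (8 * (M + 1)) 2^-1 (2 `^ (- s)) _ _ _ _ _ _ _ _ _ _ _ _ _) (ltry _) => //.
- by apply: measurableT_comp.
- exact: measurable_gam.
- by move=> y; rewrite normr_le0 => /eqP ->; rewrite /gam ltxx.
- by move=> k; rewrite mulr_ge0// sqr_ge0.

- move=> k t /andP[k1 k2]; rewrite /gam; case: ifPn => t0; last by rewrite mulr_ge0// sqr_ge0.
  move: k1 k2; rewrite gtr0_norm// => k1 k2.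
  rewrite (_ : s - 1 = m%:R + (s - 1 - m%:R)); last by ring.
  rewrite powRD ?(gt_eqF t0) ?implybT// mulrAC powR_mulrn ?(ltW t0)//.
  apply: ler_pM; rewrite ?powR_ge0//.
  + by rewrite mulr_ge0 ?expR_ge0 ?exprn_ge0// ltW.
  + exact: expRN_bound (ltW t0).
  + have k21 : 1 <= 2 ^+ k :> R by rewrite exprn_ege1// ler1n.
    apply: (@le_trans _ _ (t `^ (- 2%:R))).
      by rewrite ler_powR// (le_trans k21).
    rewrite powR_invn ?(ltW t0)// exprVn lef_pV2 ?posrE ?exprn_gt0//.
    by rewrite ler_pXn2r ?nnegrE ?exprn_ge0 ?(ltW t0).
- move=> k t /andP[k1 k2]; rewrite /gam; case: ifPn => t0; last first.
    by rewrite mulr_ge0 ?exprn_ge0 ?powR_ge0// mulr_ge0// exprn_ge0.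
  move: k1 k2; rewrite gtr0_norm// => k1 k2.
  rewrite powRD ?(gt_eqF t0) ?implybT// (powR_inv1 (ltW t0)).
  apply: (@le_trans _ _ (t `^ s / t)).
    by rewrite ler_piMr ?mulr_ge0 ?powR_ge0 ?invr_ge0 ?(ltW t0)// -expR0 ler_expR oppr_le0 ltW.
  rewrite mulrC; apply: ler_pM; rewrite ?powR_ge0 ?invr_ge0 ?(ltW t0)//.
    by rewrite -exprS -[leRHS]invrK lef_pV2 ?posrE ?invr_gt0 ?exprn_gt0.
  apply: le_trans (_ : (2 ^- k) `^ s <= _).
    by rewrite ge0_ler_powR ?nnegrE ?(ltW s0) ?(ltW t0)// invr_ge0 exprn_ge0.
  by rewrite -powR_invn// -powRrM -[leRHS]powR_mulrn ?powR_ge0// -powRrM mulrC mulrN mulNr.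
- by rewrite mulr_ge0// addr_ge0.
- by apply/andP; split; lra.
- move=> k; rewrite [X in (_ * X <= _)%E](vol (2 ^+ k.+2)) ?exprn_ge0// -EFinM lee_fin.
  rewrite (_ : M * (2 ^+ k)^-1 ^+ 2 * (2 * 2 ^+ k.+2) = 8 * M * 2^-1 ^+ k); last first.
    by rewrite (_ : 2^-1 ^+ k = (2 ^+ k)^-1) ?exprVn// 2!(exprS 2); field; rewrite expf_neq0.
  by rewrite ler_wpM2r ?exprn_ge0 ?invr_ge0// ler_wpM2l// lerDl.
- move=> k; rewrite [X in (_ * X <= _)%E](vol (2 / 2 ^+ k)); last by rewrite mulr_ge0// invr_ge0 exprn_ge0.
  rewrite -EFinM lee_fin.
  rewrite (_ : 2 * 2 ^+ k * (2 `^ (- s)) ^+ k * (2 * (2 / 2 ^+ k)) = 8 * (2 `^ (- s)) ^+ k); last by field; rewrite expf_neq0.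
  by rewrite ler_wpM2r ?exprn_ge0 ?powR_ge0// ler_peMr// lerDr.
Qed.

Let gam_gt0 s : (0 < \int[leb1]_t (gam s t)%:E)%E.
Proof.
(* A lower bound of the integrand on [1, 2]: the power is monotone there, so its minimum is at an
   endpoint. *)
pose c : R := Num.min 1 (2 `^ (s - 1)) * expR (- 2).
have c0 : 0 < c by rewrite mulr_gt0 ?expR_gt0// lt_min ltr01 powR_gt0.
apply: (@lt_le_trans _ _ (\int[leb1]_(t in `[1%R, 2%R]) c%:E)%E).
  rewrite integral_cst// [X in (_ * X)%E]lebesgue_measure_itv /= lte_fin ltr1n -EFinD -EFinM lte_fin.
  by rewrite mulr_gt0//; lra.
apply: (@le_trans _ _ (\int[leb1]_(t in `[1%R, 2%R]) (gam s t)%:E)%E).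
  apply: ge0_le_integral => //.
  - by move=> t _; rewrite lee_fin ltW.
  - by apply/measurable_EFinP; apply: measurable_funTS; exact: measurable_gam.
  move=> t /=; rewrite in_itv /= => /andP[t1 t2]; rewrite lee_fin.
  have t0 : 0 < t by lra.
  rewrite /gam t0; apply: ler_pM; rewrite ?expR_ge0 ?le_min ?ler01 ?powR_ge0//.
    rewrite ge_min; have [s1|s1] := leP 0 (s - 1).
      by apply/orP; left; rewrite -[X in X <= _](powRr0 t) ler_powR.
    apply/orP; right.
    have E (a : R) : a `^ (s - 1) = (a `^ (1 - s))^-1 by rewrite -powRN opprB.
    rewrite !E lef_pV2 ?posrE ?powR_gt0// ge0_ler_powR ?nnegrE//; lra.
  by rewrite ler_expR lerN2.
apply: ge0_subset_integral => //.
  by apply/measurable_EFinP; exact: measurable_gam.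
by move=> t _; rewrite lee_fin.
Qed.

(** [Gamma] is a real-valued integral, which would be 0 if it diverged; positivity therefore needs
    convergence as well. *)
Lemma Gamma_gt0 (s : R) : 0 < s -> 0 < Gamma s.
Proof.
move=> s0; rewrite /Gamma /Rintegral integral_gam.
by rewrite fine_gt0// gam_gt0 gam_lty.
Qed.

Lemma stable_const_gt0 d (alpha : R) : 0 < alpha < 2 -> 0 < stable_const d alpha.
Proof.
move=> /andP[a0 a2]; rewrite /stable_const divr_gt0// !mulr_gt0 ?powR_gt0 ?pi_gt0//.
- by apply: Gamma_gt0; rewrite divr_gt0// ltr_wpDl.
- by apply: Gamma_gt0; lra.
Qed.

End gamma_positivity.

(** * Boundary layers and the Friedrichs inequality *)

Section cone.
Variable R : realType.

Lemma is_derive_segment n (u : 'rV[R]_n -> R) (x v : 'rV[R]_n) (t du : R) :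
  is_derive (t *: v + x) v u du -> is_derive t 1 (fun h : R => u (h *: v + x)) du.
Proof.
have E : (fun h : R => h^-1 *: ((u \o shift (t *: v + x)) (h *: v) - u (t *: v + x))) =
   (fun h : R => h^-1 *: (((fun h : R => u (h *: v + x)) \o shift t) (h *: 1) -
     (fun h : R => u (h *: v + x)) t)).
  apply/funext => h /=; congr (_ *: (u _ - _)).
  by rewrite addrA -scalerDl; congr (_ *: _ + _); rewrite [X in _ = X + _]mulr1.
move=> -[h1 h2]; apply: DeriveDef.
- by move: h1; rewrite /derivable E.
- by move: h2; rewrite /derive E.
Qed.

Lemma derive_gradient n (u : 'rV[R]_n -> R) (x v : 'rV[R]_n) : differentiable u x ->
  'D_v u x = \sum_(j < n) v ord0 j * gradient u x ord0 j.
Proof.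
move=> du; rewrite deriveE// [in LHS](row_sum_delta v) linear_sum.
by apply: eq_bigr => j _; rewrite linearZ /= mxE deriveE.
Qed.

Lemma C11_lipschitz n (Lam : R) (phi : 'rV[R]_n -> R) (a b : 'rV[R]_n) :
  C11_function Lam phi -> phi b - phi a <= Lam * enorm (b - a).
Proof.
move=> [dphi gphi _].
pose g (t : R) := phi (t *: (b - a) + a).
pose dg (t : R) : R := 'D_(b - a) phi (t *: (b - a) + a).
have H (t : R) : is_derive t 1 g (dg t).
  apply: is_derive_segment; apply: DeriveDef => //.
  exact/diff_derivable.
have cg : {within `[0, 1], continuous g}.
  by apply: continuous_subspaceT => t; exact: continuous_derivable1 (H t).
have [c _] := @MVT R g dg 0 1 ltr01 (fun x _ => H x) cg.
rewrite /g scale1r scale0r add0r subrK subr0 mulr1 => ->.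
rewrite /dg derive_gradient//; apply: le_trans (ler_norm _) _.
rewrite -sqrtr_sqr; apply: le_trans (_ : Num.sqrt ((Lam * enorm (b - a)) ^+ 2) <= _).
  rewrite ler_wsqrtr//; apply: le_trans (cauchy_schwarz_sum _ _) _.
  rewrite -!sqr_enorm mulrC exprMn ler_wpM2r ?sqr_ge0//.
  by rewrite ler_pXn2r ?nnegrE ?enorm_ge0// (le_trans (enorm_ge0 _) (gphi 0)).
by rewrite sqrtr_sqr ger0_norm// mulr_ge0 ?enorm_ge0// (le_trans (enorm_ge0 _) (gphi 0)).
Qed.

Lemma enorm_orthogonal d (Q : 'M[R]_d) (v : 'rV[R]_d) :
  Q *m Q^T = 1%:M -> enorm (v *m Q) = enorm v.
Proof.
move=> QQ; have E (w : 'rV[R]_d) : \sum_(i < d) w ord0 i ^+ 2 = (w *m w^T) ord0 ord0.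
  by rewrite mxE; apply: eq_bigr => i _; rewrite mxE expr2.
by rewrite /enorm !E trmx_mul mulmxA -(mulmxA v) QQ mulmx1.
Qed.

Lemma enorm_col' d (i : 'I_d) (v : 'rV[R]_d) : enorm (col' i v) <= enorm v.
Proof.
case: d i v => [[]//|d] i v.
rewrite ler_wsqrtr// [leRHS](bigD1_ord i)//=.
rewrite [X in _ <= _ + X](_ : _ = \sum_(j < d) col' i v ord0 j ^+ 2).
  by rewrite lerDr sqr_ge0.
by apply: eq_bigr => j _; rewrite mxE.
Qed.

(** Moving by t in the direction [n] up to an error kap t raises the height by at least (1 - kap) t,
    while the graph rises by at most Lam kap t by the Lipschitz bound on [phi]. *)
Lemma C11_cone d (D : set 'rV[R]_d) (z : 'rV[R]_d) : C11_open D -> boundary D z ->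
  exists (n : 'rV[R]_d) (kap r : R), [/\ enorm n = 1, 0 < kap < 1, 0 < r &
    forall x t v, D x -> enorm (x - z) < r -> 0 < t < r ->
      enorm (v - t *: n) <= kap * t -> D (x + v)].
Proof.
move=> [_ [r0 [Lam [r00 Lam0 HD]]]] zD.
have [Q [i [phi [QQ cphi _ _ DE]]]] := HD z zD.
pose n : 'rV[R]_d := delta_mx ord0 i *m Q^T.
have nQ : n *m Q = delta_mx ord0 i.
  by rewrite /n -mulmxA (mulmx1C QQ) mulmx1.
have enQ (v : 'rV[R]_d) : enorm (v *m Q) = enorm v by exact: enorm_orthogonal.
have n1 : enorm n = 1.
  rewrite -enQ nQ /enorm (bigD1 i)//= mxE !eqxx expr1n big1 ?addr0 ?sqrtr1// => j /negbTE ji.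
  by rewrite mxE ji andbF expr0n.
have L1 : 0 < 1 + Lam by rewrite addr_gt0.
(* Chosen so that kap (1 + Lam) = 1/2: the height gained over the graph is then at least t/2. *)
pose kap := (2 * (1 + Lam))^-1.
have kapE : kap * (1 + Lam) = 2^-1 by rewrite /kap; field; rewrite gt_eqF.
have k0 : 0 < kap by rewrite invr_gt0 mulr_gt0.
have k1 : kap < 1.
  by have : 0 < kap * Lam by [rewrite mulr_gt0]; move: kapE; rewrite mulrDr mulr1; lra.
(* As |v| <= 2t, the point x + v stays within 3 r0 / 4 of z, where the graph describes [D]. *)
exists n, kap, (r0 / 4); split => //; first by rewrite k0.
  by rewrite divr_gt0.
move=> x t v Dx xz /andP[t0 tr] vt.
have xr : enorm (x - z) < r0 by apply: lt_trans xz _; lra.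
have ev : enorm v <= 2 * t.
  rewrite -[v](subrK (t *: n)) (le_trans (enormD _ _))// enormZ n1 mulr1 gtr0_norm//.
  have : kap * t < t by rewrite gtr_pMl.
  by lra.
have xvr : enorm (x + v - z) < r0.
  rewrite addrAC; apply: le_lt_trans (enormD _ _) _; lra.
have := DE; move/seteqP => [DE1 DE2].
have [/= Px _] := DE1 x (conj Dx xr).
suff [] : (D `&` eball z r0) (x + v) by [].
apply: DE2; split => //=.
pose w := v - t *: n.
have vE : (x + v - z) *m Q = (x - z) *m Q + (t *: delta_mx ord0 i + w *m Q).
  by rewrite -nQ scalemxAl -mulmxDl -mulmxDl /w [t *: n + _]addrC subrK addrAC.
have wi : `|(w *m Q) ord0 i| <= kap * t.
  by apply: le_trans vt; rewrite -(enQ w); exact: coord_le_enorm.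
have ci : enorm (col' i ((x + v - z) *m Q) - col' i ((x - z) *m Q)) <= kap * t.
  rewrite vE -linearB /= addrAC subrr add0r linearD /=.
  rewrite (_ : col' i (t *: delta_mx ord0 i) = 0) ?add0r; last first.
    by apply/rowP => j; rewrite !mxE [lift i j == i]eq_sym (negbTE (neq_lift _ _)) andbF mulr0.
  by apply: le_trans (enorm_col' _ _) _; rewrite enQ.
have hL := C11_lipschitz (col' i ((x - z) *m Q)) (col' i ((x + v - z) *m Q)) cphi.
have cL := ler_wpM2l (ltW Lam0) ci.
rewrite [ltRHS](_ : _ = ((x - z) *m Q) ord0 i + (t + (w *m Q) ord0 i)); last first.
  by rewrite vE mxE [X in _ + X]mxE; congr (_ + (_ + _)); rewrite !mxE !eqxx mulr1.
have := lerNnormlW wi.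
have : kap * (1 + Lam) * t = 2^-1 * t by rewrite kapE.
move: Px hL cL; lra.
Qed.

End cone.

Section layers.
Variables (R : realType) (d : nat) (alpha : R).
Local Notation leb := (@lebesgue_rV R d).
Local Notation leb2 := (leb \x leb)%E.
Implicit Types (u : 'rV[R]_d -> R) (A D S : set 'rV[R]_d).

(** Pairs with [y] in a small cube around [x - a]. This is a translation by [-a] blurred over a
    cube, because the energy controls increments only on sets of pairs of positive measure. *)
Definition strip (a : 'rV[R]_d) (s : R) : set ('rV[R]_d * 'rV[R]_d) :=
  [set p : 'rV[R]_d * 'rV[R]_d | forall i, `|p.2 ord0 i - (p.1 ord0 i - a ord0 i)| < s].

Lemma measurable_strip a s : measurable (strip a s).
Proof.
pose f i (p : 'rV[R]_d * 'rV[R]_d) := p.2 ord0 i - (p.1 ord0 i - a ord0 i).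
have mf i : measurable_fun setT (f i).
  apply: measurable_funB; first exact: (measurableT_comp (measurable_coord i) measurable_snd).
  apply: measurable_funB => //.
  exact: (measurableT_comp (measurable_coord i) measurable_fst).
rewrite (_ : strip a s = \bigcap_(i in [set: 'I_d]) f i @^-1` ball 0 s).
  apply: fin_bigcap_measurable => // i _.
  by rewrite -[X in measurable X]setTI; apply: mf => //; exact: measurable_ball.
apply/seteqP; split => p /= h i; first by move=> _; rewrite /ball /= sub0r normrN; exact: h.
by have := h i I; rewrite /ball /= sub0r normrN.
Qed.

Lemma integral_mul_indic (S : set 'rV[R]_d) (g : 'rV[R]_d -> R) :
  (\int[leb]_x (g x * \1_S x)%:E = \int[leb]_(x in S) (g x)%:E)%E.
Proof.
rewrite [RHS]integral_mkcond; apply: eq_integral => x _.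
by rewrite patchE indicE; case: (x \in S); rewrite ?mulr1 ?mulr0.
Qed.

Section strip_integral.
Variables (a : 'rV[R]_d) (s : R) (g : 'rV[R]_d -> R).
Hypotheses (s0 : 0 <= s) (mg : measurable_fun setT g) (g0 : forall x, 0 <= g x).

Lemma integral_strip1 : (\int[leb2]_p (g p.1 * \1_(strip a s) p)%:E =
  ((2 * s) ^+ d)%:E * \int[leb]_x (g x)%:E)%E.
Proof.
rewrite fubini_tonelli1; last 2 first.
- apply/measurable_EFinP; apply: measurable_funM.
    exact: (measurableT_comp mg measurable_fst).
  by apply: measurable_indic; exact: measurable_strip.
- by move=> p; rewrite lee_fin mulr_ge0.
rewrite -ge0_integralZl//; last 3 first.
- exact/measurable_EFinP.
- by move=> x _; rewrite lee_fin.
- by rewrite lee_fin exprn_ge0// mulr_ge0.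
apply: eq_integral => x _; rewrite /fubini_F /=.
rewrite (eq_integral (fun y => (g x)%:E * (\1_(cube (x - a) s) y)%:E)%E).
  rewrite ge0_integralZl//; last 2 first.
  - by apply/measurable_EFinP; apply: measurable_indic; exact: measurable_cube.
  - by rewrite lee_fin.
  rewrite integral_indic//; last exact: measurable_cube.
  by rewrite setIT muleC; congr (_ * _)%E; exact: lebesgue_cube.
move=> y _; rewrite -EFinM; congr (_ * _)%:E; rewrite !indicE; congr (nat_of_bool _)%:R.
by apply/idP/idP; rewrite !inE => /= h i; have := h i; rewrite !mxE.
Qed.

Lemma integral_strip2 : (\int[leb2]_p (g p.2 * \1_(strip a s) p)%:E =
  ((2 * s) ^+ d)%:E * \int[leb]_x (g x)%:E)%E.
Proof.
rewrite fubini_tonelli2; last 2 first.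
- apply/measurable_EFinP; apply: measurable_funM.
    exact: (measurableT_comp mg measurable_snd).
  by apply: measurable_indic; exact: measurable_strip.
- by move=> p; rewrite lee_fin mulr_ge0.
rewrite -ge0_integralZl//; last 3 first.
- exact/measurable_EFinP.
- by move=> x _; rewrite lee_fin.
- by rewrite lee_fin exprn_ge0// mulr_ge0.
apply: eq_integral => y _; rewrite /fubini_G /=.
rewrite (eq_integral (fun x => (g y)%:E * (\1_(cube (y + a) s) x)%:E)%E).
  rewrite ge0_integralZl//; last 2 first.
  - by apply/measurable_EFinP; apply: measurable_indic; exact: measurable_cube.
  - by rewrite lee_fin.
  rewrite integral_indic//; last exact: measurable_cube.
  by rewrite setIT muleC; congr (_ * _)%E; exact: lebesgue_cube.
move=> x _; rewrite -EFinM; congr (_ * _)%:E; rewrite !indicE; congr (nat_of_bool _)%:R.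
have E i : y ord0 i - (x ord0 i - a ord0 i) = - (x ord0 i - (y + a) ord0 i) by rewrite !mxE; ring.
by apply/idP/idP; rewrite !inE => /= h i; have := h i; rewrite /= E normrN.
Qed.

End strip_integral.

Lemma sqr_le_add (x y t : R) : 0 < t -> x ^+ 2 <= (1 + t) * y ^+ 2 + (1 + t^-1) * (x - y) ^+ 2.
Proof.
move=> t0; rewrite -subr_ge0.
have -> : (1 + t) * y ^+ 2 + (1 + t^-1) * (x - y) ^+ 2 - x ^+ 2 = t^-1 * (t * y - (x - y)) ^+ 2.
  by field; rewrite gt_eqF.
by rewrite mulr_ge0 ?sqr_ge0// invr_ge0 ltW.
Qed.

Hypothesis dalpha : 0 < d%:R + alpha.

(** At distance at most h the kernel is at least h^(-(d + alpha)); on the diagonal both sides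
    vanish. *)
Lemma sqr_diff_le_gint u x y (h : R) : enorm (x - y) <= h ->
  (u x - u y) ^+ 2 <= h `^ (d%:R + alpha) * gint alpha u (x, y).
Proof.
move=> xyh; rewrite /gint /kern /= mulrCA.
have [E|E] := eqVneq (enorm (x - y)) 0.
  move/eqP: E; rewrite enorm_eq0 subr_eq0 => /eqP ->.
  by rewrite subrr expr0n /= mul0r.
have e0 : 0 < enorm (x - y) by rewrite lt0r E enorm_ge0.
rewrite ler_peMr ?sqr_ge0// ler_pdivlMr ?powR_gt0// mul1r.
by rewrite ge0_ler_powR ?nnegrE ?(ltW dalpha) ?(ltW e0)// (le_trans (ltW e0)).
Qed.

(** Integrate u(x)^2 <= (1 + t) u(y)^2 + (1 + 1/t) (u(x) - u(y))^2 over the strip. Its sections in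
    [x] and in [y] have the same volume (2s)^d, so dividing by it leaves the factor 1 + t, as close
    to 1 as desired, in front of the mass of [A]. *)
Lemma l2_step u D S A a (s h t : R) : measurable_fun setT u ->
  measurable D -> measurable S -> measurable A -> 0 < s -> 0 < t ->
  (forall x y, S x -> strip a s (x, y) -> [/\ A y, D x, D y & enorm (x - y) <= h]) ->
  (l2 S u <= (1 + t)%:E * l2 A u +
    ((1 + t^-1) * h `^ (d%:R + alpha) / (2 * s) ^+ d)%:E * gag alpha D u)%E.
Proof.
move=> mu mD mS mA s0 t0 HS.
pose c : R := (2 * s) ^+ d.
have c0 : 0 < c by rewrite exprn_gt0// mulr_gt0.
pose f1 (p : 'rV[R]_d * 'rV[R]_d) : \bar R := ((u p.1 ^+ 2 * \1_S p.1) * \1_(strip a s) p)%:E.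
pose f2 (p : 'rV[R]_d * 'rV[R]_d) : \bar R := ((u p.2 ^+ 2 * \1_A p.2) * \1_(strip a s) p)%:E.
pose f3 (p : 'rV[R]_d * 'rV[R]_d) : \bar R := ((fun p => (gint alpha u p)%:E) \_ (D `*` D)) p.
have mgS (B : set 'rV[R]_d) : measurable B -> measurable_fun setT (fun x => u x ^+ 2 * \1_B x).
  by move=> mB; apply: measurable_funM; [exact: measurable_funX|exact: measurable_indic].
have gS0 (B : set 'rV[R]_d) x : 0 <= u x ^+ 2 * \1_B x by rewrite mulr_ge0 ?sqr_ge0.
have i1 : (\int[leb2]_p f1 p = c%:E * l2 S u)%E.
  rewrite /f1 (@integral_strip1 a s (fun x => u x ^+ 2 * \1_S x)) ?(ltW s0)//; last exact: mgS.
  by rewrite integral_mul_indic.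
have i2 : (\int[leb2]_p f2 p = c%:E * l2 A u)%E.
  rewrite /f2 (@integral_strip2 a s (fun x => u x ^+ 2 * \1_A x)) ?(ltW s0)//; last exact: mgS.
  by rewrite integral_mul_indic.
have i3 : (\int[leb2]_p f3 p = gag alpha D u)%E by rewrite -integral_mkcond.
have mf1 : measurable_fun setT f1.
  apply/measurable_EFinP; apply: measurable_funM.
    exact: (measurableT_comp (mgS _ mS) measurable_fst).
  by apply: measurable_indic; exact: measurable_strip.
have mf2 : measurable_fun setT f2.
  apply/measurable_EFinP; apply: measurable_funM.
    exact: (measurableT_comp (mgS _ mA) measurable_snd).
  by apply: measurable_indic; exact: measurable_strip.
have mf3 : measurable_fun setT f3.
  apply/(measurable_restrictT _ _).1; first exact: measurableX.
  exact: measurable_gintT.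
have f10 p : (0 <= f1 p)%E by rewrite lee_fin mulr_ge0.
have f20 p : (0 <= f2 p)%E by rewrite lee_fin mulr_ge0.
have f30 p : (0 <= f3 p)%E by rewrite /f3 patchE; case: ifP => //; rewrite lee_fin gint_ge0.
pose b : R := (1 + t^-1) * h `^ (d%:R + alpha).
have b0 : 0 <= b by rewrite mulr_ge0 ?powR_ge0// addr_ge0// invr_ge0 ltW.
have t10 : 0 <= 1 + t by lra.
have H : (c%:E * l2 S u <= (1 + t)%:E * (c%:E * l2 A u) + b%:E * gag alpha D u)%E.
  rewrite -i1 -i2 -i3 -!ge0_integralZl//.
  rewrite -ge0_integralD//; last 4 first.
  - by move=> p _; rewrite mule_ge0.
  - exact: measurable_funeM.
  - by move=> p _; rewrite mule_ge0.
  - exact: measurable_funeM.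
  apply: ge0_le_integral => //.
  - by apply: emeasurable_funD; exact: measurable_funeM.
  move=> [x y] _; rewrite /f1 /=.
  have [/set_mem xS|xS] := boolP (x \in S); last first.
    by rewrite indicE (negbTE xS) mulr0 mul0r adde_ge0// mule_ge0.
  have [/set_mem sxy|sxy] := boolP ((x, y) \in strip a s); last first.
    by rewrite [X in _ * X]indicE (negbTE sxy) mulr0 adde_ge0// mule_ge0.
  have [Ay Dx Dy xyh] := HS x y xS sxy.
  rewrite /f2 /f3 /= patchE !indicE !mem_set// !mulr1 -!EFinM -EFinD lee_fin.
  apply: le_trans (sqr_le_add (u x) (u y) t0) _; rewrite lerD2l /b -mulrA ler_wpM2l//.
    by rewrite addr_ge0// invr_ge0 ltW.
  exact: sqr_diff_le_gint.
have cV : (l2 S u = (c^-1)%:E * (c%:E * l2 S u))%E.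
  by rewrite muleA -EFinM mulVf ?gt_eqF// mul1e.
rewrite cV; apply: le_trans (lee_wpmul2l _ H) _; first by rewrite lee_fin invr_ge0 ltW.
rewrite ge0_muleDr ?mule_ge0 ?l2_ge0 ?gag_ge0 ?lee_fin ?(ltW c0)//.
rewrite !muleA -!EFinM leeD// lee_wpmul2r ?l2_ge0 ?gag_ge0// lee_fin.
- by rewrite mulrAC mulVf ?mul1r// gt_eqF.
- by rewrite mulrC.
Qed.

End layers.

Lemma continuous_subr (R : realType) d (c : 'rV[R]_d) : continuous (fun x : 'rV[R]_d => x - c).
Proof. by move=> y; apply: continuousB; [exact: cvg_id|exact: cst_continuous]. Qed.

Section friedrichs.
Variables (R : realType) (d : nat) (alpha : R) (D : set 'rV[R]_d).
Local Notation leb := (@lebesgue_rV R d).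
Local Notation leb2 := (leb \x leb)%E.
Implicit Types (u : 'rV[R]_d -> R).
Hypotheses (d0 : (0 < d)%N) (alpha12 : 1 < alpha < 2) (oD : open D).

Let mD : measurable D. Proof. exact: measurable_open_rV. Qed.

Let dalpha : 0 < d%:R + alpha.
Proof. by have /andP[a1 _] := alpha12; rewrite ltr_wpDl// (lt_trans _ a1). Qed.

(** Stops the descent through the layers: [u] vanishes on every layer of depth at most [h]. *)
Lemma test_function_dist u : test_function D u ->
  exists2 h : R, 0 < h & forall x y, u x != 0 -> enorm (y - x) <= h -> D y.
Proof.
move=> [su cu uD]; set K := closure _ in cu uD.
have nc := (compact_near_coveringP K).1 cu.
have [|h /= h0 H] := nc R (0 : R)^'+ (fun e x => forall y, enorm (y - x) <= e -> D y) _.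
  move=> x Kx; have /nbhs_ballP[e /= e0 xeD] := open_nbhs_nbhs (conj oD (uD x Kx)).
  exists (ball x (e / 2), [set t | t < e / 2]) => /=.
    split; first by apply: nbhsx_ballx; rewrite divr_gt0.
    by exists (e / 2) => /=; [rewrite divr_gt0|move=> t /=; rewrite sub0r normrN => /(le_lt_trans (ler_norm _))].
  move=> [x' t] /= [xx' te] y yt; apply: xeD.
  rewrite (splitr e); apply: ball_triangle xx' _.
  rewrite -ball_normE /= distrC.
  exact: le_lt_trans (norm_le_enorm _) (le_lt_trans yt te).
exists (h / 2); first by rewrite divr_gt0.
move=> x y ux yx; apply: (H (h / 2) _ _ x _ y yx) => /=.
- by rewrite sub0r normrN gtr0_norm ?divr_gt0// ltr_pdivrMr// ltr_pMr// ltr1n.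
- by rewrite divr_gt0.
- exact: subset_closure.
Qed.

Section local.
Variables (z n : 'rV[R]_d) (kap r : R).
Hypotheses (n1 : enorm n = 1) (kap01 : 0 < kap < 1) (r0 : 0 < r).
Hypothesis cone : forall x t v, D x -> enorm (x - z) < r -> 0 < t < r ->
  enorm (v - t *: n) <= kap * t -> D (x + v).
Variable lam : R.
Hypotheses (lam12 : 1 < lam < 2) (lama : 2 < lam `^ alpha).

(* The radius shrinks by [h / (lam - 1)], the sum of the widths of the layers met on the way down. *)
Definition layer (h : R) : set 'rV[R]_d :=
  [set x | [/\ D x, enorm (x - z) < r - h / (lam - 1) & ~ D (x - h *: n)]].

Lemma measurable_layer h : measurable (layer h).
Proof.
have cB := @continuous_subr R d (h *: n).
rewrite (_ : layer h = D `&` eball z (r - h / (lam - 1)) `&` ~` ((fun x => x - h *: n) @^-1` D)).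
  apply: measurableI; first by apply: measurableI => //; exact: measurable_eball.
  apply: measurableC; apply: measurable_open_rV.
  by have /continuousP := cB; apply.
by apply/seteqP; split => x; [case=> a b c; split|case=> -[a b] c; split].
Qed.

(** As lam = 2 - 2 eps, a push by (1 - eps) h leaves a margin eps h at both ends for the cone
    condition. The number 2 + t is the midpoint of 2 and lam^alpha. [C1] is the constant of
    [l2_step] for cubes of half-side kap eps h / d, and [K] solves (2 + t) K + C1 = K lam^alpha. *)
Let eps := 1 - lam / 2.
Let t := (lam `^ alpha - 2) / 2.
Let C1 := (1 + t^-1) * (d%:R / (2 * (kap * eps))) ^+ d.
Let K := C1 / (lam `^ alpha - (2 + t)).

Let lams : [/\ 1 < lam, lam < 2, 0 < lam & 0 < eps].
Proof. by have /andP[l1 l2] := lam12; split => //; rewrite /eps; lra. Qed.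

Let t0 : 0 < t. Proof. by rewrite /t divr_gt0// subr_gt0. Qed.

Let C10 : 0 <= C1.
Proof.
have [_ _ _ e0] := lams; have /andP[k0 _] := kap01.
rewrite mulr_ge0 ?addr_ge0 ?invr_ge0 ?(ltW t0)//.
by rewrite exprn_ge0// divr_ge0// !mulr_ge0// ltW.
Qed.

Let Kpos : 0 < lam `^ alpha - (2 + t).
Proof. by have := t0; rewrite /t; set L := lam `^ alpha; lra. Qed.

Let K0 : 0 <= K. Proof. by rewrite divr_ge0// ltW. Qed.

(* [layer (lam * h) `\` layer h] is pushed into [layer h] by a translation along [n], so that the mass
   at most doubles up to an energy term; it is absorbed in [layer_l2_le] because [2 < lam `^ alpha]. *)
Let layer_step u (h : R) : measurable_fun setT u -> 0 < h ->
  (l2 (layer (lam * h)) u <= (2 + t)%:E * l2 (layer h) u + (C1 * h `^ alpha)%:E * gag alpha D u)%E.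
Proof.
move=> mu h0; have [l1 l2' l0 e0] := lams; have /andP[k0 k1] := kap01.
pose S := layer (lam * h) `\` layer h.
have mA := measurable_layer h; have mA' := measurable_layer (lam * h).
have mS : measurable S by exact: measurableD.
have ll : 0 < lam - 1 by rewrite subr_gt0.
have keh : 0 < kap * eps * h by rewrite !mulr_gt0.
have step : (l2 S u <= (1 + t)%:E * l2 (layer h) u + (C1 * h `^ alpha)%:E * gag alpha D u)%E.
  have dR : 0 < d%:R :> R by rewrite ltr0n.
  have := @l2_step R d alpha dalpha u D S (layer h) (((1 - eps) * h) *: n)
    (kap * eps * h / d%:R) h t mu mD mS mA _ t0 _.
  rewrite (_ : _ / _ ^+ d = C1 * h `^ alpha); last first.
    have B0 : d%:R / (2 * (kap * eps)) != 0 by rewrite gt_eqF// divr_gt0// !mulr_gt0.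
    have -> : 2 * (kap * eps * h / d%:R) = h / (d%:R / (2 * (kap * eps))).
      by field; rewrite ?gt_eqF// pnatr_eq0 -lt0n.
    rewrite /C1 powRD ?(gt_eqF h0) ?implybT// powR_mulrn ?(ltW h0)// expr_div_n.
    set B := _ / (2 * _) in B0 *; field.
    by rewrite !expf_neq0 ?(gt_eqF h0) ?(gt_eqF t0).
  apply; first by rewrite divr_gt0.
  move=> x y [[Dx xz nD] nA] sxy.
  have hlt : h / (lam - 1) <= lam * h / (lam - 1).
    by rewrite ler_pM2r ?invr_gt0// ler_peMl// ltW.
  have Dxh : D (x - h *: n).
    apply: contrapT => nDh; apply: nA; split => //.
    by apply: lt_le_trans xz _; lra.
  pose w := y - (x - ((1 - eps) * h) *: n).
  have ew : enorm w < kap * eps * h.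
    apply: enorm_lt_coord => // i; have := sxy i; rewrite /= /w !mxE.
    by rewrite (_ : y ord0 i + _ = y ord0 i - (x ord0 i - (1 - eps) * h * n ord0 i))//; ring.
  (* The radii of the two layers differ by exactly h, which leaves room for the displacement |x - y|
     <= h. *)
  have hE : lam * h / (lam - 1) = h / (lam - 1) + h by field; rewrite gt_eqF.
  have hh : h <= h / (lam - 1).
    by rewrite ler_pdivlMr// ler_piMr// ?(ltW h0)//; lra.
  have xn0 := enorm_ge0 (x - z).
  have hr : h < r by lra.
  have eh : 0 < eps * h < r.
    by rewrite mulr_gt0//=; apply: le_lt_trans hr; rewrite ler_piMl ?(ltW h0)// /eps; lra.
  have keh2 : kap * eps * h <= eps * h by rewrite -mulrA ler_piMl ?(ltW k1)//; have /andP[/ltW] := eh.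
  have yE : y = x - ((1 - eps) * h) *: n + w by rewrite /w addrC subrK.
  (* Outside [layer h] the point x - h n lies in [D], and [y] belongs to the cone at it, at height
     eps h. *)
  have Dy : D y.
    rewrite (_ : y = (x - h *: n) + ((eps * h) *: n + w)); last first.
      by apply/rowP => i; rewrite /w !mxE; ring.
    apply: (@cone _ (eps * h)) => //.
      rewrite addrAC; apply: le_lt_trans (enormD _ _) _.
      by rewrite enormN enormZ n1 mulr1 gtr0_norm//; lra.
    by rewrite addrAC subrr add0r mulrA ltW.
  have e1 : eps < 1 by rewrite /eps; lra.
  have m0 : 0 < (1 - eps) * h by rewrite mulr_gt0// subr_gt0.
  have eyx : enorm (x - y) <= h.
    rewrite (_ : x - y = ((1 - eps) * h) *: n - w); last first.
      by apply/rowP => i; rewrite /w !mxE; ring.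
    apply: le_trans (enormD _ _) _; rewrite enormN enormZ n1 mulr1 gtr0_norm//.
    have : (1 - eps) * h = h - eps * h by ring.
    lra.
  have yz : enorm (y - z) < r - h / (lam - 1).
    have := enorm_distD x y z; rewrite (enormB y x); lra.
  (* If y - h n were in [D], the cone at it would contain x - lam h n at height eps h, because lam =
     2 - 2 eps. *)
  split => //; split => // Dyh; apply: nD.
  rewrite (_ : x - (lam * h) *: n = (y - h *: n) + ((eps * h) *: n - w)); last first.
    by apply/rowP => i; rewrite /w /eps !mxE; field.
  apply: (@cone _ (eps * h)) => //.
    rewrite addrAC; apply: le_lt_trans (enormD _ _) _.
    by rewrite enormN enormZ n1 mulr1 gtr0_norm//; lra.
  by rewrite addrAC subrr add0r enormN mulrA ltW.
have sub : (l2 (layer (lam * h)) u <= l2 (layer h) u + l2 S u)%E.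
  have msq (B : set 'rV[R]_d) : measurable_fun B (fun x => (u x ^+ 2)%:E).
    by apply: measurable_sqr; exact: measurable_funTS.
  rewrite /l2 -ge0_integral_setU//; last 2 first.
  - by move=> x _; rewrite lee_fin sqr_ge0.
  - by apply/disj_setPS => x [A1 [_]].
  apply: ge0_subset_integral => //; first exact: measurableU.
    by move=> x _; rewrite lee_fin sqr_ge0.
  by move=> x xl; have [xA|xA] := pselect (layer h x); [left|right].
apply: le_trans sub _; apply: le_trans (leeD (lexx _) step) _.
(* The mass of [layer h] is counted once for itself and once, with the factor 1 + t, as the target
   of the push. *)
rewrite addeA (_ : (2 + t)%:E = 1%:E + (1 + t)%:E)%E; last first.
  by rewrite -EFinD; congr EFin; ring.
rewrite ge0_muleDl ?mul1e//; rewrite lee_fin; have := t0; lra.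
Qed.

(** Induction on k for depths up to lam^k h1, where h1 is a depth below which [u] vanishes on the
    layer. The constant depends neither on k nor on the support of [u], since [K] is a fixed point
    of the recursion. *)
Lemma layer_l2_le u h : test_function D u -> 0 < h ->
  (l2 (layer h) u <= (K * h `^ alpha)%:E * gag alpha D u)%E.
Proof.
move=> tu h0; have [l1 l2' l0 e0] := lams.
have mu := test_function_measurable tu.
have [h1 h10 Hh1] := test_function_dist tu.
have KP (x : R) : (0 <= (K * x `^ alpha)%:E)%E.
  by rewrite lee_fin; apply: mulr_ge0; [exact: K0|exact: powR_ge0].
have t2 : 0 <= 2 + t by have := t0; lra.
have H k : forall h, 0 < h -> h <= lam ^+ k * h1 ->
    (l2 (layer h) u <= (K * h `^ alpha)%:E * gag alpha D u)%E.
  elim: k => [|k IH] {}h {}h0.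
    rewrite expr0 mul1r => hh1.
    rewrite /l2 integral0_eq; first by apply: mule_ge0; [exact: KP|exact: gag_ge0].
    move=> x [Dx _ nD].
    have [->|ux] := eqVneq (u x) 0; first by rewrite expr0n.
    exfalso; apply: nD; apply: Hh1 ux _.
    by rewrite addrAC subrr add0r enormN enormZ n1 mulr1 gtr0_norm.
  move=> hk; have hl : 0 < h / lam by rewrite divr_gt0.
  have := layer_step mu hl; rewrite (_ : lam * (h / lam) = h); last by rewrite mulrC divfK// gt_eqF.
  move=> /le_trans; apply.
  have {}IH := IH _ hl; rewrite ler_pdivrMr// mulrAC -exprSr in IH.
  apply: le_trans (leeD (lee_wpmul2l _ (IH hk)) (lexx _)) _.
    by rewrite lee_fin.
  have E : h `^ alpha = lam `^ alpha * (h / lam) `^ alpha.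
    by rewrite -powRM ?(ltW l0) ?(ltW hl)// mulrC divfK// gt_eqF.
  rewrite muleA -ge0_muleDl; last 2 first.
  - by apply: mule_ge0; [rewrite lee_fin|exact: KP].
  - by rewrite lee_fin; apply: mulr_ge0; [exact: C10|exact: powR_ge0].
  rewrite lee_wpmul2r ?gag_ge0// -EFinM -EFinD lee_fin E.
  have <- : K * (lam `^ alpha - (2 + t)) = C1 by rewrite /K divfK// gt_eqF.
  by rewrite le_eqVlt; apply/orP; left; apply/eqP; ring.
(* Bernoulli's inequality, to reach any depth after finitely many steps. *)
have bern k : 1 + k%:R * (lam - 1) <= lam ^+ k.
  elim: k => [|k IH]; first by rewrite expr0 mul0r addr0.
  rewrite exprS -natr1; have k0 : 0 <= k%:R :> R by [].
  have : lam * (1 + k%:R * (lam - 1)) <= lam * lam ^+ k by rewrite ler_pM2l.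
  have : 0 <= k%:R * (lam - 1) * (lam - 1) by rewrite !mulr_ge0// subr_ge0 ltW.
  lra.
pose k := (Num.truncn (h / h1 / (lam - 1))).+1.
apply: (H k) => //; rewrite -ler_pdivrMr//.
have : h / h1 / (lam - 1) < k%:R by exact: truncnS_gt.
rewrite ltr_pdivrMr ?subr_gt0// => /ltW hk.
by apply: le_trans hk _; apply: le_trans (bern k); rewrite lerDr.
Qed.

End local.

End friedrichs.

Lemma ltr_powR2 (R : realType) (a b : R) : a < b -> 2 `^ a < 2 `^ b.
Proof.
by move=> ab; rewrite /powR gt_eqF// ltr_expR ltr_pM2r// ln_gt0// ltr1n.
Qed.

Section friedrichs_inequality.
Variables (R : realType) (d : nat) (alpha : R).
Local Notation leb := (@lebesgue_rV R d).
Local Notation leb2 := (leb \x leb)%E.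
Implicit Types (u : 'rV[R]_d -> R) (A D N : set 'rV[R]_d).
Hypotheses (d0 : (0 < d)%N) (alpha12 : 1 < alpha < 2).

Let dalpha : 0 < d%:R + alpha.
Proof. by have /andP[a1 _] := alpha12; rewrite ltr_wpDl// (lt_trans _ a1). Qed.

(** Integrate u(x)^2 <= 2 (u(x) - u(y))^2 + 2 u(y)^2 over [A] times [N]: on a bounded set the kernel
    is bounded below, so the mass of [A] is controlled by that of any part of positive measure. *)
Lemma l2_poincare u A N (M : R) : measurable_fun setT u -> measurable A -> measurable N ->
  N `<=` A -> (forall x y, A x -> A y -> enorm (x - y) <= M) ->
  (leb N * l2 A u <= (2 * M `^ (d%:R + alpha))%:E * gag alpha A u + 2%:E * (leb A * l2 N u))%E.
Proof.
move=> mu mA mN NA AM.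
have mAN : measurable (A `*` N) by exact: measurableX.
have mAA : measurable (A `*` A) by exact: measurableX.
pose f1 (p : 'rV[R]_d * 'rV[R]_d) : \bar R := (u p.1 ^+ 2)%:E.
pose f2 (p : 'rV[R]_d * 'rV[R]_d) : \bar R := (u p.2 ^+ 2)%:E.
pose f3 (p : 'rV[R]_d * 'rV[R]_d) : \bar R := (gint alpha u p)%:E.
have mf1 (B : set ('rV[R]_d * 'rV[R]_d)) : measurable_fun B f1.
  apply: measurable_funTS; apply/measurable_EFinP; apply: measurable_funX.
  exact: (measurableT_comp mu measurable_fst).
have mf2 (B : set ('rV[R]_d * 'rV[R]_d)) : measurable_fun B f2.
  apply: measurable_funTS; apply/measurable_EFinP; apply: measurable_funX.
  exact: (measurableT_comp mu measurable_snd).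
have mf3 (B : set ('rV[R]_d * 'rV[R]_d)) : measurable_fun B f3 by exact: measurable_gintT.
have f10 p : (0 <= f1 p)%E by rewrite lee_fin sqr_ge0.
have f20 p : (0 <= f2 p)%E by rewrite lee_fin sqr_ge0.
have f30 p : (0 <= f3 p)%E by rewrite lee_fin gint_ge0.
have msq (B : set 'rV[R]_d) : measurable_fun B (fun x => (u x ^+ 2)%:E).
  by apply: measurable_sqr; exact: measurable_funTS.
have i1 : (\int[leb2]_(p in A `*` N) f1 p = leb N * l2 A u)%E.
  rewrite tonelli_rect1// /f1 /=.
  rewrite /l2 -ge0_integralZl//; last by move=> x _; rewrite lee_fin sqr_ge0.
  by apply: eq_integral => x _; rewrite integral_cst// muleC.
have i2 : (\int[leb2]_(p in A `*` N) f2 p = leb A * l2 N u)%E.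
  rewrite tonelli_rect2// /f2 /=.
  rewrite /l2 -ge0_integralZl//; last by move=> x _; rewrite lee_fin sqr_ge0.
  by apply: eq_integral => x _; rewrite integral_cst// muleC.
have i3 : (\int[leb2]_(p in A `*` N) f3 p <= gag alpha A u)%E.
  by apply: ge0_subset_integral => // -[x y] [xA /NA yA].
have c0 : 0 <= 2 * M `^ (d%:R + alpha) by rewrite mulr_ge0 ?powR_ge0.
rewrite -i1 -i2.
apply: le_trans (_ : (2 * M `^ (d%:R + alpha))%:E * \int[leb2]_(p in A `*` N) f3 p +
   2%:E * \int[leb2]_(p in A `*` N) f2 p <= _)%E; last first.
  by rewrite leeD// lee_wpmul2l.
rewrite -!ge0_integralZl//.
rewrite -ge0_integralD//; last 4 first.
- by move=> p _; rewrite mule_ge0.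
- exact: measurable_funeM.
- by move=> p _; rewrite mule_ge0.
- exact: measurable_funeM.
apply: ge0_le_integral => //.
- by apply: emeasurable_funD; exact: measurable_funeM.
move=> [x y] [xA yN]; rewrite /f1 /f2 /f3 /= -!EFinM -EFinD lee_fin -mulrA.
have := sqr_diff_le_gint dalpha u (AM x y xA (NA _ yN)).
have := sqr_ge0 (u x - 2 * u y); nra.
Qed.

Lemma friedrichs_test D z : C11_open D -> bounded_set D -> boundary D z ->
  exists2 C : R, 0 < C & forall u, test_function D u -> (l2 D u <= C%:E * gag alpha D u)%E.
Proof.
move=> cD bD zD; have [oD _] := cD; have mD := measurable_open_rV oD.
have /andP[a1 a2] := alpha12.
have [n [kap [r [n1 kap01 r0 cone]]]] := C11_cone cD zD.
have /andP[k0 k1] := kap01.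
have nDz : ~ D z by case: zD => _; rewrite (interior_id D).1.
(* The exponent is the midpoint of 1/alpha and 1, so that lam < 2 and lam^alpha > 2; it exists
   because alpha > 1. *)
pose lam : R := 2 `^ ((1 + alpha^-1) / 2).
have e1 : 1 < alpha * ((1 + alpha^-1) / 2).
  by rewrite mulrA mulrDr mulr1 mulfV ?gt_eqF; lra.
have ai : 0 < alpha^-1 < 1 by rewrite invr_gt0 invf_lt1; lra.
have lam12 : 1 < lam < 2.
  have /andP[ai0 ai1] := ai; rewrite /lam.
  rewrite -[X in X < _ < _](powRr0 2) -[X in _ < _ < X](@powRr1 _ 2)//.
  by rewrite !ltr_powR2//; lra.
have lama : 2 < lam `^ alpha.
  by rewrite /lam -powRrM -[X in X < _](@powRr1 _ 2)// ltr_powR2// mulrC.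
have /andP[l1 l2'] := lam12.
(* At this depth the layer has radius exactly r / 2. *)
pose h1 := r * (lam - 1) / 2.
have h10 : 0 < h1 by rewrite divr_gt0// mulr_gt0// subr_gt0.
have h1r : h1 < r / 2 by rewrite ltr_pM2r ?invr_gt0// gtr_pMr//; lra.
pose del := kap * h1.
have del0 : 0 < del by rewrite mulr_gt0.
have delh : del < h1 by rewrite gtr_pMl.
pose N := D `&` eball z del.
have mN : measurable N by apply: measurableI => //; exact: measurable_eball.
(* A point x of [D] within kap h1 of z lies in the layer: otherwise x - h1 n is in [D], and the cone
   at it contains z, which is not in [D]. *)
have NL : N `<=` layer D z n r lam h1.
  move=> x [Dx xz]; rewrite /eball /= in xz; split => //.
    rewrite (_ : h1 / (lam - 1) = r / 2); last first.
      by rewrite /h1; field; rewrite subr_eq0 gt_eqF.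
    lra.
  move=> Dxh; apply: nDz.
  rewrite (_ : z = (x - h1 *: n) + (z - (x - h1 *: n))); last by rewrite addrC subrK.
  apply: (cone _ h1) => //.
  - rewrite addrAC; apply: le_lt_trans (enormD _ _) _.
    by rewrite enormN enormZ n1 mulr1 gtr0_norm//; lra.
  - by rewrite h10/=; lra.
  - rewrite (_ : _ - h1 *: n = z - x) ?(enormB z) ?(ltW xz)//.
    by apply/rowP => i; rewrite !mxE; ring.
have N0 : (0 < leb N)%E.
  have oN : open N by apply: openI => //; exact: open_eball.
  have [x Nx] : N !=set0.
    have [cz _] := zD; have [|x [Dx xz]] := cz (eball z del).
      apply: open_nbhs_nbhs; split; first exact: open_eball.
      by rewrite /eball /= subrr enorm0.
    by exists x.
  have /nbhs_ballP[e /= e0 xeN] := open_nbhs_nbhs (conj oN Nx).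
  apply: lt_le_trans (_ : leb (eball x e) <= _)%E.
    apply: lt_le_trans (lebesgue_eball_ge x e0).
    by rewrite lte_fin exprn_gt0// mulr_gt0// divr_gt0// ltr0n.
  apply: le_measure; rewrite ?inE//; first exact: measurable_eball.
  move=> y yx; apply: xeN; rewrite -ball_normE /= distrC.
  exact: le_lt_trans (norm_le_enorm _) yx.
have [M M0 DM] := bounded_sub_eball bD.
have DMM x y : D x -> D y -> enorm (x - y) <= 2 * M.
  move=> /DM + /DM; rewrite /eball /= !subr0 => xM yM.
  apply: le_trans (enormD _ _) _; rewrite enormN; lra.
have lD : (leb D < +oo)%E.
  apply: le_lt_trans (lebesgue_eball_lty 0 M); apply: le_measure; rewrite ?inE//.
  exact: measurable_eball.
have ND : N `<=` D by move=> x [].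
have lN : (leb N < +oo)%E.
  by apply: le_lt_trans lD; apply: le_measure; rewrite ?inE.
have fD : leb D = (fine (leb D))%:E by rewrite fineK// ge0_fin_numE.
have fN : leb N = (fine (leb N))%:E by rewrite fineK// ge0_fin_numE.
set V := fine (leb N) in fN; set W := fine (leb D) in fD.
have V0 : 0 < V by rewrite -lte_fin -fN.
have W0 : 0 <= W by rewrite -lee_fin -fD.
(* The constant of [layer_l2_le] at depth [h1], with its local names expanded. *)
set K := (1 + ((lam `^ alpha - 2) / 2)^-1) * (d%:R / (2 * (kap * (1 - lam / 2)))) ^+ d /
   (lam `^ alpha - (2 + (lam `^ alpha - 2) / 2)) * h1 `^ alpha.
pose P := 2 * (2 * M) `^ (d%:R + alpha).
have P0 : 0 <= P by rewrite mulr_ge0 ?powR_ge0.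
have K0 : 0 <= K.
  rewrite mulr_ge0 ?powR_ge0// divr_ge0//.
    rewrite mulr_ge0//; first by rewrite addr_ge0// invr_ge0; lra.
    by rewrite exprn_ge0// divr_ge0// !mulr_ge0//; lra.
  lra.
exists ((P + 2 * (W * K)) / V + 1).
  apply: ltr_wpDl => //; apply: divr_ge0; last exact: ltW.
  by apply: addr_ge0 => //; apply: mulr_ge0 => //; exact: mulr_ge0.
move=> u tu; have mu := test_function_measurable tu.
have hL := layer_l2_le d0 alpha12 oD n1 kap01 cone lam12 lama tu h10.
have hN : (l2 N u <= K%:E * gag alpha D u)%E.
  apply: le_trans hL; apply: l2_subset => //.
  by apply: measurable_layer => //.
have hP := l2_poincare mu mD mN ND DMM.
rewrite fN fD in hP.
have {}hP : (V%:E * l2 D u <= (P + 2 * (W * K))%:E * gag alpha D u)%E.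
  apply: le_trans hP _; rewrite [in leRHS]EFinD ge0_muleDl//; last first.
    by rewrite lee_fin; apply: mulr_ge0 => //; exact: mulr_ge0.
  rewrite leeD// (EFinM 2) (EFinM W) -!muleA lee_wpmul2l// lee_wpmul2l//.
have -> : (l2 D u = (V^-1)%:E * (V%:E * l2 D u))%E.
  by rewrite muleA -EFinM mulVf ?gt_eqF// mul1e.
apply: le_trans (lee_wpmul2l _ hP) _; first by rewrite lee_fin invr_ge0 ltW.
rewrite muleA -EFinM lee_wpmul2r ?gag_ge0// lee_fin mulrC lerDl//.
Qed.

Lemma censored_domain_approx D u (e : R) : measurable D -> measurable_fun setT u ->
  censored_domain alpha D u -> 0 < e ->
  exists phi, [/\ test_function D phi, (gag alpha D (phi \- u)%R <= e%:E)%E &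
    (l2 D (phi \- u)%R <= e%:E)%E].
Proof.
move=> mD mu [_ _ [phi [tphi cphi]]] e0.
have /andP[a1 a2] := alpha12.
have c0 : 0 < 2^-1 * stable_const d alpha.
  by rewrite mulr_gt0 ?invr_gt0// stable_const_gt0//; lra.
set c := 2^-1 * _ in c0.
have E k : censored_form1 alpha D (phi k \- u)%R =
    (c%:E * gag alpha D (phi k \- u)%R + l2 D (phi k \- u)%R)%E.
  rewrite /censored_form1 censored_formE//; apply: measurable_funTS.
  by apply: measurable_funB => //; exact: (test_function_measurable (tphi k)).
pose e' := Num.min e (c * e).
have e'0 : 0 < e' by rewrite lt_min e0 mulr_gt0.
have e'e : (e'%:E <= e%:E)%E by rewrite lee_fin ge_min lexx.
have e'c : (e'%:E <= (c * e)%:E)%E by rewrite lee_fin ge_min lexx orbT.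
have [k _ /(_ k (leqnn k)) /=] : \forall k \near \oo, (censored_form1 alpha D (phi k \- u)%R < e'%:E)%E.
  exact: (cphi _ (@nbhs_open_ereal_lt R 0 (cst e') e'0)).
rewrite E => /ltW H; exists (phi k); split => //.
  rewrite -(@lee_pmul2l _ c%:E)//.
  by rewrite -EFinM; apply: le_trans e'c; apply: le_trans H; rewrite leeDl// l2_ge0.
apply: le_trans e'e; apply: le_trans H; rewrite leeDr// mule_ge0 ?gag_ge0// lee_fin ltW//.
Qed.

(** Density: the passage to a test function and the passage back each cost a factor 2. The total
    error is (2 + 4 C) e', which fixes e'. *)
Lemma friedrichs D z : C11_open D -> bounded_set D -> boundary D z ->
  exists2 C : R, 0 < C & forall u, measurable_fun setT u -> censored_domain alpha D u ->
    (l2 D u <= C%:E * gag alpha D u)%E.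
Proof.
move=> cD bD zD; have [C C0 HC] := friedrichs_test cD bD zD.
have [oD _] := cD; have mD := measurable_open_rV oD.
exists (4 * C); first by rewrite mulr_gt0.
move=> u mu du; apply/lee_addgt0Pr => e e0.
pose e' := e / (2 + 4 * C).
have e'0 : 0 < e' by rewrite divr_gt0// addr_gt0// mulr_gt0.
have [phi [tphi g1 g2]] := censored_domain_approx mD mu du e'0.
have mphi := test_function_measurable tphi.
have mB : measurable_fun setT (phi \- u) by exact: measurable_funB.
have h1 : (l2 D u <= 2%:E * (l2 D (phi \- u)%R + l2 D phi))%E.
  apply: l2_leD => // x _ /=; have := sqr_ge0 (2 * phi x - u x); nra.
have h2 : (gag alpha D phi <= 2%:E * (gag alpha D (phi \- u)%R + gag alpha D u))%E.
  apply: gag_leD => // x y _ _ /=.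
  set a := phi x - phi y; set b := u x - u y.
  have -> : phi x - u x - (phi y - u y) = a - b by rewrite /a /b; ring.
  have := sqr_ge0 (a - 2 * b); nra.
apply: le_trans h1 _.
apply: le_trans (_ : 2%:E * (e'%:E + C%:E * (2%:E * (e'%:E + gag alpha D u))) <= _)%E.
  rewrite lee_wpmul2l// leeD//; apply: le_trans (HC _ tphi) _.
  rewrite lee_wpmul2l ?lee_fin ?(ltW C0)//; apply: le_trans h2 _.
  by rewrite lee_wpmul2l// leeD.
have e'p : (0 <= e'%:E)%E by rewrite lee_fin ltW.
have gp := gag_ge0 alpha D u.
have [->|gfin] := eqVneq (gag alpha D u) +oo%E.
  by rewrite [X in (_ <= X + _)%E]gt0_muley ?lte_fin ?mulr_gt0// addye// leey.
have -> : gag alpha D u = (fine (gag alpha D u))%:E by rewrite fineK// ge0_fin_numE// ltey.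
do 4! rewrite -?EFinM -?EFinD; rewrite lee_fin /e'.
rewrite le_eqVlt; apply/orP; left; apply/eqP; field.
by rewrite gt_eqF// addr_gt0// mulr_gt0.
Qed.

End friedrichs_inequality.

(** * Operations on the domain of the form *)

Section nneseries_ae.
Context d (T : measurableType d) (R : realType) (mu : {measure set T -> \bar R}).

Lemma nneseries_fine_cvg (a : nat -> R) : (forall k, 0 <= a k) ->
  (\sum_(0 <= k <oo) (a k)%:E < +oo)%E ->
  \sum_(0 <= k < n) a k @[n --> \oo] --> fine (\sum_(0 <= k <oo) (a k)%:E)%E.
Proof.
move=> a0 aoo.
have c := is_cvg_nneseries (fun k _ _ => a0 k : (0 <= (a k)%:E)%E) (N := 0%N) (P := xpredT).
apply: (@fine_cvg _ _ _ _ (fun n => (\sum_(0 <= k < n) a k)%:E)).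
rewrite fineK; last by rewrite ge0_fin_numE// nneseries_ge0// => k _ _; rewrite lee_fin.
under eq_fun do rewrite -sumEFin.
exact: c.
Qed.

Lemma nneseries_cvg0 (a : nat -> R) : (forall k, 0 <= a k) ->
  (\sum_(0 <= k <oo) (a k)%:E < +oo)%E -> a @ \oo --> (0 : R).
Proof.
move=> a0 aoo; apply: cvg_series_cvg_0; apply/cvg_ex; eexists.
exact: nneseries_fine_cvg a0 aoo.
Qed.

Lemma nneseries_geometric_lty (a : nat -> \bar R) (c : R) : 0 <= c ->
  (forall k, (0 <= a k <= (c * 2^-1 ^+ k)%:E)%E) -> (\sum_(0 <= k <oo) a k < +oo)%E.
Proof.
move=> c0 ac; apply: le_lt_trans (ltry _); apply: nneseries_geometric_le ac => //.
by apply/andP; split; lra.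
Qed.

Lemma ae_integral_lty (D : set T) (f : T -> \bar R) : measurable D -> measurable_fun D f ->
  (forall x, D x -> (0 <= f x)%E) -> (\int[mu]_(x in D) f x < +oo)%E ->
  {ae mu, forall x, D x -> (f x < +oo)%E}.
Proof.
move=> mD mf f0 foo.
have : mu.-integrable D f.
  apply/integrableP; split => //.
  by under eq_integral => x /set_mem xD do rewrite gee0_abs ?f0//.
move=> /(integrable_ae mD); apply: filterS => x h xD.
by have := h xD; rewrite ge0_fin_numE ?f0.
Qed.
End nneseries_ae.

Section domain_maps.
Variables (R : realType) (d : nat) (alpha : R) (D : set 'rV[R]_d).
Local Notation leb := (@lebesgue_rV R d).
Local Notation leb2 := (leb \x leb)%E.
Implicit Types (u v b : 'rV[R]_d -> R).
Hypotheses (mD : measurable D) (alpha12 : 1 < alpha < 2).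

Let mDD : measurable (D `*` D). Proof. exact: measurableX. Qed.

Lemma eq_censored_form u v : {in D, u =1 v} ->
  censored_form alpha D u u = censored_form alpha D v v.
Proof.
move=> uv; apply: (congr1 (fun t => (2^-1 * stable_const d alpha)%:E * t)%E).
apply: eq_integral => x xD; apply: eq_integral => y yD.
by rewrite !uv.
Qed.

(** Members of the domain are only measurable on [D]; extension by zero gives global measurability
    and changes nothing on [D]. *)
Lemma censored_domain_patch u : censored_domain alpha D u ->
  [/\ measurable_fun setT (u \_ D), censored_domain alpha D (u \_ D) &
      censored_form alpha D (u \_ D) (u \_ D) = censored_form alpha D u u].
Proof.
move=> [mu l2u [phi [tphi cphi]]].
have uD : {in D, (u \_ D) =1 u} by move=> x xD; rewrite patchE xD.
have m1 : measurable_fun setT (u \_ D) by exact: (measurable_restrictT u mD).1 mu.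
split; [exact: m1| |exact: eq_censored_form].
split; first exact: measurable_funTS.
  rewrite (_ : L2_product D (u \_ D) (u \_ D) = L2_product D u u)//.
  by apply: eq_integral => x xD; rewrite uD.
exists phi; split => //.
rewrite (_ : (fun k => _) = (fun k => censored_form1 alpha D (phi k \- u)))//.
apply/funext => k.
have uDk : {in D, phi k \- (u \_ D) =1 phi k \- u} by move=> x xD /=; rewrite uD.
rewrite /censored_form1 (eq_censored_form uDk); congr (_ + _)%E.
by apply: eq_integral => x xD; rewrite uDk.
Qed.

(** With summable errors, the series of the squared differences serves at once to prove almost
    everywhere convergence and to dominate the approximants. *)
Lemma censored_domain_fast u (e : nat -> R) : measurable_fun setT u ->
  censored_domain alpha D u -> (forall k, 0 < e k) ->
  exists phi : nat -> 'rV[R]_d -> R, [/\ forall k, test_function D (phi k),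
    forall k, (gag alpha D (phi k \- u)%R <= (e k)%:E)%E &
    forall k, (l2 D (phi k \- u)%R <= (e k)%:E)%E].
Proof.
move=> mu du e0.
have /choice[phi Hphi] k := censored_domain_approx alpha12 mD mu du (e0 k).
by exists phi; split => k; have [] := Hphi k.
Qed.

Lemma gint_le_sub u v p : gint alpha u p <= 2 * (gint alpha v p + gint alpha (u \- v)%R p).
Proof.
rewrite /gint -mulrDl mulrA ler_wpM2r ?kern_ge0//=.
have := sqr_ge0 ((v p.1 - v p.2) - ((u p.1 - v p.1) - (u p.2 - v p.2))); nra.
Qed.

Lemma integral_nneseries_gint (phi : nat -> 'rV[R]_d -> R) :
  (forall k, measurable_fun setT (phi k)) ->
  (\int[leb2]_(p in D `*` D) (\sum_(0 <= k <oo) (gint alpha (phi k) p)%:E) =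
   \sum_(0 <= k <oo) gag alpha D (phi k))%E.
Proof.
move=> mphi; rewrite integral_nneseries//.
  by move=> k; exact: measurable_gintT.
by move=> k p _; rewrite lee_fin gint_ge0.
Qed.

Lemma integral_nneseries_sqr (phi : nat -> 'rV[R]_d -> R) :
  (forall k, measurable_fun setT (phi k)) ->
  (\int[leb]_(x in D) (\sum_(0 <= k <oo) (phi k x ^+ 2)%:E) =
   \sum_(0 <= k <oo) l2 D (phi k))%E.
Proof.
move=> mphi; rewrite integral_nneseries//.
  by move=> k; apply: measurable_sqr; exact: measurable_funTS.
by move=> k p _; rewrite lee_fin sqr_ge0.
Qed.

Lemma measurable_nneseries_gint (phi : nat -> 'rV[R]_d -> R) A :
  (forall k, measurable_fun setT (phi k)) ->
  measurable_fun A (fun p => \sum_(0 <= k <oo) (gint alpha (phi k) p)%:E)%E.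
Proof.
move=> mphi; apply: ge0_emeasurable_sum => [k p _ _|k _]; first by rewrite lee_fin gint_ge0.
exact: measurable_gintT.
Qed.

Lemma measurable_nneseries_sqr (phi : nat -> 'rV[R]_d -> R) A :
  (forall k, measurable_fun setT (phi k)) ->
  measurable_fun A (fun x => \sum_(0 <= k <oo) (phi k x ^+ 2)%:E)%E.
Proof.
move=> mphi; apply: ge0_emeasurable_sum => [k p _ _|k _]; first by rewrite lee_fin sqr_ge0.
by apply: measurable_sqr; exact: measurable_funTS.
Qed.

Lemma nneseries_term_le (a : nat -> \bar R) k : (forall k, 0 <= a k)%E ->
  (a k <= \sum_(0 <= i <oo) a i)%E.
Proof.
move=> a0; apply: (@le_trans _ _ (\sum_(0 <= i < k.+1) a i)%E).
  by rewrite big_nat_recr//= leeDr// sume_ge0.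
exact: nneseries_lim_ge.
Qed.

(** Stability under u |-> f(u(x), x), where the dependence on x is controlled by a function [b] of
    finite energy, a bump in the application to localization. The map is applied to rapidly
    converging test functions, and the hypotheses on [f] carry the domination over to the images. *)
Lemma censored_domain_map u (f : R -> 'rV[R]_d -> R) b (L : R) : 0 <= L ->
  measurable_fun setT u -> censored_domain alpha D u -> (gag alpha D u < +oo)%E ->
  measurable_fun setT b -> (gag alpha D b < +oo)%E ->
  (forall phi, test_function D phi -> test_function D (fun x => f (phi x) x)) ->
  (forall x, continuous (f^~ x)) -> measurable_fun setT (fun x => f (u x) x) ->
  (forall s t x y, D x -> D y -> (f s x - f t y) ^+ 2 <= L * ((s - t) ^+ 2 + (b x - b y) ^+ 2)) ->
  (forall s x, D x -> f s x ^+ 2 <= L * s ^+ 2) ->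
  censored_domain alpha D (fun x => f (u x) x).
Proof.
move=> L0 mu du gu mb gb tf cf mf fL f0.
have e0 k : 0 < 2^-1 ^+ k :> R by rewrite exprn_gt0// invr_gt0.
have [phi [tphi g1 g2]] := censored_domain_fast mu du e0.
have mphi k := test_function_measurable (tphi k).
have mB k : measurable_fun setT (phi k \- u) by exact: measurable_funB.
(* Increments and values of every [phi k] are dominated by those of [u] plus these series, which are
   integrable since the errors are geometric. *)
pose Sg p := (\sum_(0 <= k <oo) (gint alpha (phi k \- u)%R p)%:E)%E.
pose Sl x := (\sum_(0 <= k <oo) ((phi k \- u)%R x ^+ 2)%:E)%E.
have Sg0 p : (0 <= Sg p)%E by apply: nneseries_ge0 => k _ _; rewrite lee_fin gint_ge0.
have Sl0 x : (0 <= Sl x)%E by apply: nneseries_ge0 => k _ _; rewrite lee_fin sqr_ge0.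
have mSg A : measurable_fun A Sg by exact: measurable_nneseries_gint.
have mSl A : measurable_fun A Sl by exact: measurable_nneseries_sqr.
have iSg : (\int[leb2]_(p in D `*` D) Sg p < +oo)%E.
  rewrite integral_nneseries_gint//; apply: (@nneseries_geometric_lty _ _ 1) => // k.
  by rewrite gag_ge0 mul1r/=.
have iSl : (\int[leb]_(x in D) Sl x < +oo)%E.
  rewrite integral_nneseries_sqr//; apply: (@nneseries_geometric_lty _ _ 1) => // k.
  by rewrite l2_ge0 mul1r; exact: g2.
have l2u : (\int[leb]_(x in D) (u x ^+ 2)%:E < +oo)%E by case: du.
have mu2 : measurable_fun D (fun x => (u x ^+ 2)%:E).
  by apply: measurable_sqr; exact: measurable_funTS.
pose G p := (L%:E * (2%:E * ((gint alpha u p)%:E + Sg p) + (gint alpha b p)%:E))%E.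
pose H x := (L%:E * (2%:E * ((u x ^+ 2)%:E + Sl x)))%E.
have mG1 : measurable_fun (D `*` D) (fun p => (gint alpha u p)%:E + Sg p)%E.
  by apply: emeasurable_funD => //; exact: measurable_gintT.
have mG2 : measurable_fun (D `*` D)
    (fun p => 2%:E * ((gint alpha u p)%:E + Sg p) + (gint alpha b p)%:E)%E.
  by apply: emeasurable_funD; [exact: measurable_funeM|exact: measurable_gintT].
have mH1 : measurable_fun D (fun x => (u x ^+ 2)%:E + Sl x)%E.
  exact: emeasurable_funD.
have G10 p : (0 <= (gint alpha u p)%:E + Sg p)%E by rewrite adde_ge0// lee_fin gint_ge0.
have H10 x : (0 <= (u x ^+ 2)%:E + Sl x)%E by rewrite adde_ge0// lee_fin sqr_ge0.
apply: (@censored_domain_dominated _ _ _ _ mD (fun k x => f (phi k x) x) _ G H) => //.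
- by move=> k; exact: tf.
- have := ae_integral_lty mD (mSl D) (fun x _ => Sl0 x) iSl.
  apply: filterS => x hx xD.
  have h := nneseries_cvg0 (fun k => sqr_ge0 _) (hx xD).
  have c : phi ^~ x @ \oo --> u x.
    have : (phi k x - u x) @[k --> \oo] --> (0 : R).
      apply/cvgr0Pnorm_lt => e ep.
      have /cvgr0Pnorm_lt/(_ (e ^+ 2)) := h; rewrite exprn_gt0// => /(_ isT).
      apply: filterS => k; rewrite normrX ltr_pXn2r// ?nnegrE ?(ltW ep)//.
    move=> /cvgD /(_ (cvg_cst (u x))); rewrite add0r.
    by apply: cvg_trans; apply: near_eq_cvg; apply: nearW => k /=; rewrite subrK.
  exact: (continuous_cvg _ (cf x (u x)) c).
- exact: measurable_funeM.
- rewrite ge0_integralZl//; last 1 first.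
    by move=> p _; rewrite adde_ge0 ?mule_ge0// lee_fin gint_ge0.
  rewrite lte_mul_pinfty// ge0_integralD//; last 4 first.
  + by move=> p _; rewrite mule_ge0.
  + exact: measurable_funeM.
  + by move=> p _; rewrite lee_fin gint_ge0.
  + exact: measurable_gintT.
  rewrite lte_add_pinfty// ge0_integralZl// lte_mul_pinfty//.
  rewrite ge0_integralD//; last 2 first.
  + by move=> p _; rewrite lee_fin gint_ge0.
  + exact: measurable_gintT.
  exact: lte_add_pinfty.
- move=> k [x y] [xD yD].
  apply: (@le_trans _ _ (L * (gint alpha (phi k) (x, y) + gint alpha b (x, y)))%:E).
    rewrite lee_fin /gint -mulrDl mulrA ler_wpM2r ?kern_ge0//=.
    exact: fL.
  rewrite EFinM EFinD lee_wpmul2l// leeD//.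
  apply: (@le_trans _ _ (2 * (gint alpha u (x, y) + gint alpha (phi k \- u)%R (x, y)))%:E).
    by rewrite lee_fin gint_le_sub.
  rewrite EFinM (EFinD (gint _ _ _)) lee_wpmul2l// leeD//.
  by apply: (@nneseries_term_le (fun k => (gint alpha (phi k \- u)%R (x, y))%:E)) => i;
    rewrite lee_fin gint_ge0.
- by apply: measurable_funeM; exact: measurable_funeM.
- rewrite ge0_integralZl//; last 2 first.
  + exact: measurable_funeM.
  + by move=> x _; rewrite mule_ge0.
  rewrite lte_mul_pinfty// ge0_integralZl// lte_mul_pinfty//.
  rewrite ge0_integralD//; last by move=> x _; rewrite lee_fin sqr_ge0.
  exact: lte_add_pinfty.
- move=> k x xD.
  apply: (@le_trans _ _ (L * phi k x ^+ 2)%:E); first by rewrite lee_fin f0.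
  rewrite EFinM lee_wpmul2l//.
  apply: (@le_trans _ _ (2 * (u x ^+ 2 + (phi k x - u x) ^+ 2))%:E).
    by rewrite lee_fin; have := sqr_ge0 (2 * u x - phi k x); nra.
  rewrite EFinM (EFinD (u x ^+ 2)) lee_wpmul2l// leeD//.
  by apply: (@nneseries_term_le (fun k => ((phi k \- u)%R x ^+ 2)%:E)) => i; rewrite lee_fin sqr_ge0.
Qed.

End domain_maps.


Lemma sqr_le_cvg0 (R : realType) (a b : nat -> R) : (forall k, a k ^+ 2 <= b k) ->
  b @ \oo --> (0 : R) -> a @ \oo --> (0 : R).
Proof.
move=> ab /cvgr0Pnorm_lt h; apply/cvgr0Pnorm_lt => e e0.
have := h (e ^+ 2); rewrite exprn_gt0// => /(_ isT).
apply: filterS => k bk; rewrite -(@ltr_pXn2r _ 2)// ?nnegrE ?(ltW e0)//.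
by rewrite real_normK ?num_real// (le_lt_trans (ab k))// (le_lt_trans (ler_norm _)).
Qed.

Section subadditivity.
Variables (R : realType) (d : nat) (alpha : R) (D : set 'rV[R]_d).
Local Notation leb := (@lebesgue_rV R d).
Local Notation leb2 := (leb \x leb)%E.
Implicit Types (v w b : 'rV[R]_d -> R).
Hypotheses (mD : measurable D) (alpha12 : 1 < alpha < 2).

Let mDD : measurable (D `*` D). Proof. exact: measurableX. Qed.

Lemma sumr_le_nneseries (a : nat -> R) n : (forall k, 0 <= a k) ->
  ((\sum_(i < n) a i)%:E <= \sum_(0 <= i <oo) (a i)%:E)%E.
Proof.
move=> a0; rewrite -sumEFin -(big_mkord xpredT (fun i => (a i)%:E)).
by apply: nneseries_lim_ge => k _ _; rewrite lee_fin.
Qed.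

Section l2norm.
Variables (u : nat -> 'rV[R]_d -> R) (e : R).
Hypotheses (e0 : 0 < e) (mu : forall j, measurable_fun setT (u j))
  (du : forall j, censored_domain alpha D (u j))
  (gu : (\sum_(0 <= j <oo) gag alpha D (u j) < +oo)%E)
  (lu : (\sum_(0 <= j <oo) l2 D (u j) < +oo)%E).

(* Its increments are at most those of [(u j x)_j] in l2, whence [gag_l2norm_shift]; it is nearly
   at least [1] wherever one of the [u j] is. *)
Definition l2norm_shift (x : 'rV[R]_d) : R :=
  Num.sqrt (e ^+ 2 + fine (\sum_(0 <= j <oo) (u j x ^+ 2)%:E)%E) - e.

Let Su p := (\sum_(0 <= j <oo) (gint alpha (u j) p)%:E)%E.
Let Sq x := (\sum_(0 <= j <oo) (u j x ^+ 2)%:E)%E.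
Let v k (x : 'rV[R]_d) : R := Num.sqrt (e ^+ 2 + \sum_(i < k.+1) u i x ^+ 2) - e.

Let iSu : (\int[leb2]_(p in D `*` D) Su p < +oo)%E.
Proof. by rewrite integral_nneseries_gint. Qed.

Let iSq : (\int[leb]_(x in D) Sq x < +oo)%E.
Proof. by rewrite integral_nneseries_sqr. Qed.

Let mSu A : measurable_fun A Su. Proof. exact: measurable_nneseries_gint. Qed.
Let mSq A : measurable_fun A Sq. Proof. exact: measurable_nneseries_sqr. Qed.
Let Su0 p : (0 <= Su p)%E.
Proof. by apply: nneseries_ge0 => k _ _; rewrite lee_fin gint_ge0. Qed.
Let Sq0 x : (0 <= Sq x)%E.
Proof. by apply: nneseries_ge0 => k _ _; rewrite lee_fin sqr_ge0. Qed.

Lemma nneseries_sqr_fin_ae : {ae leb, forall x, D x -> (Sq x < +oo)%E}.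
Proof. exact: (ae_integral_lty mD (@mSq D) (fun x _ => Sq0 x) iSq). Qed.

Lemma measurable_l2norm_shift : measurable_fun setT l2norm_shift.
Proof.
apply: measurable_funB => //.
have h : measurable_fun setT (fun x => e ^+ 2 + fine (Sq x)).
  apply: measurable_funD => //.
  exact: (measurableT_comp (@fine_measurable R setT measurableT) (@mSq setT)).
exact: (measurableT_comp (continuous_measurable_fun (@sqrt_continuous R)) h).
Qed.

Let v_cvg x : (Sq x < +oo)%E -> v ^~ x @ \oo --> l2norm_shift x.
Proof.
move=> Sx; apply: cvgB; last exact: cvg_cst.
apply: (@continuous_cvg _ _ _ _ _ (fun k => e ^+ 2 + \sum_(i < k.+1) u i x ^+ 2) Num.sqrt).
  exact: sqrt_continuous.
apply: cvgD; first exact: cvg_cst.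
have h := nneseries_fine_cvg (fun k => sqr_ge0 (u k x)) Sx.
rewrite -(cvg_shiftS (fun n => \sum_(0 <= k < n) u k x ^+ 2)) in h.
by move: h; under eq_fun do rewrite big_mkord.
Qed.

Let gint_v k p : ((gint alpha (v k) p)%:E <= Su p)%E.
Proof.
apply: le_trans (sumr_le_nneseries k.+1 (fun j => gint_ge0 alpha (u j) p)).
rewrite lee_fin /gint -mulr_suml ler_wpM2r ?kern_ge0//.
apply: le_trans (sqr_sqrtB_le e (fun i : 'I_k.+1 => u i p.1) (fun i : 'I_k.+1 => u i p.2)).
by rewrite /v opprB addrA subrK.
Qed.

Lemma gag_l2norm_shift : (gag alpha D l2norm_shift <= \sum_(0 <= j <oo) gag alpha D (u j))%E.
Proof.
rewrite -integral_nneseries_gint//; apply: ae_ge0_le_integral => //.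
- by move=> p _; rewrite lee_fin gint_ge0.
- by apply: measurable_gintT; exact: measurable_l2norm_shift.
- by move=> p _; exact: Su0.
- exact: mSu.
have := ae_pair nneseries_sqr_fin_ae; apply: filterS => p [w1 w2] [p1 p2].
have c : (gint alpha (v k) p)%:E @[k --> \oo] --> (gint alpha l2norm_shift p)%:E.
  apply: cvg_EFin; first by apply: nearW.
  by apply: cvg_gint; apply: v_cvg; [exact: w1|exact: w2].
rewrite -(cvg_lim _ c)//; apply: lime_le; first by apply/cvg_ex; eexists; exact: c.
by apply: nearW => k; exact: gint_v.
Qed.

(** A diagonal approximation: stage k takes the l2-norm of the first k + 1 functions, each replaced
    by its own k-th approximant. *)
Lemma censored_domain_l2norm_shift : censored_domain alpha D l2norm_shift.
Proof.
(* The division by k + 1 makes the total error of the k + 1 approximants at stage k at most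
   2^(-k). *)
pose ek k : R := 2^-1 ^+ k / k.+1%:R.
have ek0 k : 0 < ek k by rewrite divr_gt0// exprn_gt0// invr_gt0.
have /choice[phi Hphi] j := censored_domain_fast mD alpha12 (mu j) (du j) ek0.
have tphi j k : test_function D (phi j k) by have [] := Hphi j.
have mphi j k := test_function_measurable (tphi j k).
have mB j k : measurable_fun setT (phi j k \- u j) by exact: measurable_funB.
pose wk k (x : 'rV[R]_d) := Num.sqrt (e ^+ 2 + \sum_(i < k.+1) phi i k x ^+ 2) - e.
pose Tg k p := \sum_(i < k.+1) gint alpha (phi i k \- u i) p.
pose Tl k x := \sum_(i < k.+1) (phi i k \- u i) x ^+ 2.
have Tg0 k p : 0 <= Tg k p by apply: sumr_ge0 => i _; exact: gint_ge0.
have Tl0 k x : 0 <= Tl k x by apply: sumr_ge0 => i _; exact: sqr_ge0.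
have mTg k A : measurable_fun A (fun p => (Tg k p)%:E).
  rewrite /Tg; under eq_fun do rewrite -sumEFin.
  by apply: emeasurable_sum => i; exact: measurable_gintT.
have mTl k A : measurable_fun A (fun p => (Tl k p)%:E).
  rewrite /Tl; under eq_fun do rewrite -sumEFin.
  by apply: emeasurable_sum => i; apply: measurable_sqr; apply: measurable_funTS.
have ekE k (a : 'I_k.+1 -> \bar R) : (forall i, a i <= (ek k)%:E)%E ->
    (\sum_(i < k.+1) a i <= (1 * 2^-1 ^+ k)%:E)%E.
  move=> ae; apply: (@le_trans _ _ (\sum_(i < k.+1) (ek k)%:E)%E); first exact: lee_sum.
  by rewrite sumEFin lee_fin sumr_const card_ord mul1r /ek -[leLHS]mulr_natr divfK// pnatr_eq0.
pose Sg p := (\sum_(0 <= k <oo) (Tg k p)%:E)%E.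
pose Sl x := (\sum_(0 <= k <oo) (Tl k x)%:E)%E.
have Sg0 p : (0 <= Sg p)%E by apply: nneseries_ge0 => k _ _; rewrite lee_fin.
have Sl0 x : (0 <= Sl x)%E by apply: nneseries_ge0 => k _ _; rewrite lee_fin.
have mSg A : measurable_fun A Sg.
  by apply: ge0_emeasurable_sum => [k p _ _|k _]; rewrite ?lee_fin.
have mSl A : measurable_fun A Sl.
  by apply: ge0_emeasurable_sum => [k p _ _|k _]; rewrite ?lee_fin.
have iSg : (\int[leb2]_(p in D `*` D) Sg p < +oo)%E.
  rewrite integral_nneseries; [|exact: mDD|by move=> k; exact: mTg|]; last first.
    by move=> k p _; rewrite lee_fin; exact: Tg0.
  apply: (@nneseries_geometric_lty R _ 1) => // k; rewrite integral_ge0/=; last first.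
    by move=> p _; rewrite lee_fin.
  rewrite /Tg; under eq_integral do rewrite -sumEFin.
  rewrite ge0_integral_sum//; last 2 first.
  - by move=> i; exact: measurable_gintT.
  - by move=> i p _; rewrite lee_fin gint_ge0.
  by apply: ekE => i; have [_ + _] := Hphi i; apply.
have iSl : (\int[leb]_(p in D) Sl p < +oo)%E.
  rewrite integral_nneseries; [|exact: mD|by move=> k; exact: mTl|]; last first.
    by move=> k p _; rewrite lee_fin; exact: Tl0.
  apply: (@nneseries_geometric_lty R _ 1) => // k; rewrite integral_ge0/=; last first.
    by move=> p _; rewrite lee_fin.
  rewrite /Tl; under eq_integral do rewrite -sumEFin.
  rewrite ge0_integral_sum//; last 2 first.
  - by move=> i; apply: measurable_sqr; exact: measurable_funTS.
  - by move=> i p _; rewrite lee_fin sqr_ge0.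
  by apply: ekE => i; have [_ _] := Hphi i; apply.
pose G p := (2%:E * (Su p + Sg p))%E.
pose H x := (2%:E * (Sq x + Sl x))%E.
apply: (@censored_domain_dominated _ _ _ _ mD wk _ G H) => //.
- by move=> k; exact: test_function_l2norm.
- exact: measurable_l2norm_shift.
- have h1 := nneseries_sqr_fin_ae.
  have h2 := ae_integral_lty mD (mSl D) (fun x _ => Sl0 x) iSl.
  apply: filterS2 h1 h2 => x /[swap] hx2 /[swap] xD => /(_ xD)/v_cvg hv.
  have hT := nneseries_cvg0 (Tl0 ^~ x) (hx2 xD).
  (* The l2-norm is 1-Lipschitz, so this squared difference is at most [Tl k x], the general term of
     a convergent series. *)
  have hd : (wk k x - v k x) @[k --> \oo] --> (0 : R).
    apply: sqr_le_cvg0 hT => k.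
    apply: le_trans (sqr_sqrtB_le e (fun i : 'I_k.+1 => phi i k x) (fun i : 'I_k.+1 => u i x)).
    by rewrite /wk /v opprB addrA subrK.
  have hh := cvgD hd hv; rewrite add0r in hh.
  rewrite (_ : (fun k => wk k x) = (fun k => wk k x - v k x) + (fun k => v k x)); first exact: hh.
  by apply/funext => k; rewrite [RHS](_ : _ = wk k x - v k x + v k x)// subrK.
- by apply: measurable_funeM; exact: emeasurable_funD.
- rewrite ge0_integralZl//; last 2 first.
  + exact: emeasurable_funD.
  + by move=> p _; rewrite adde_ge0.
  by rewrite lte_mul_pinfty// ge0_integralD// lte_add_pinfty.
- move=> k p _.
  apply: (@le_trans _ _ (2 * (\sum_(i < k.+1) gint alpha (u i) p + Tg k p))%:E).
    rewrite lee_fin.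
    apply: (@le_trans _ _ (\sum_(i < k.+1) gint alpha (phi i k) p)).
      rewrite /gint -mulr_suml ler_wpM2r ?kern_ge0//.
      apply: le_trans (sqr_sqrtB_le e (fun i : 'I_k.+1 => phi i k p.1) (fun i : 'I_k.+1 => phi i k p.2)).
      by rewrite /wk opprB addrA subrK.
    rewrite /Tg -big_split/= mulr_sumr; apply: ler_sum => i _; exact: gint_le_sub.
  rewrite EFinM (EFinD (\sum_(i < k.+1) _)) lee_wpmul2l// leeD//.
    exact: (@sumr_le_nneseries (fun i => gint alpha (u i) p) k.+1 (fun i => gint_ge0 _ _ _)).
  by apply: (@nneseries_term_le _ (fun k => (Tg k p)%:E)) => i; rewrite lee_fin.
- by apply: measurable_funeM; exact: emeasurable_funD.
- rewrite ge0_integralZl//; last 2 first.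
  + exact: emeasurable_funD.
  + by move=> p _; rewrite adde_ge0.
  by rewrite lte_mul_pinfty// ge0_integralD// lte_add_pinfty.
- move=> k x _.
  apply: (@le_trans _ _ (2 * (\sum_(i < k.+1) u i x ^+ 2 + Tl k x))%:E).
    rewrite lee_fin.
    apply: (@le_trans _ _ (\sum_(i < k.+1) phi i k x ^+ 2)).
      have h := sqr_sqrtB_le e (fun i : 'I_k.+1 => phi i k x) (fun i : 'I_k.+1 => 0).
      have E0 : \sum_(i < k.+1) (0 : R) ^+ 2 = 0 by rewrite big1// => i _; rewrite expr0n.
      rewrite E0 addr0 sqrtr_sqr (gtr0_norm e0) in h.
      by apply: le_trans h _; apply: ler_sum => i _; rewrite subr0.
    rewrite /Tl -big_split/= mulr_sumr; apply: ler_sum => i _.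
    have := sqr_ge0 (2 * u i x - phi i k x); nra.
  rewrite EFinM (EFinD (\sum_(i < k.+1) _)) lee_wpmul2l// leeD//.
    exact: (@sumr_le_nneseries (fun i => u i x ^+ 2) k.+1 (fun i => sqr_ge0 _)).
  by apply: (@nneseries_term_le _ (fun k => (Tl k x)%:E)) => i; rewrite lee_fin.
Qed.

End l2norm.

End subadditivity.

(** * Capacity *)

Section capacity_theory.
Variables (R : realType) (d : nat) (alpha : R) (D : set 'rV[R]_d).
Local Notation leb := (@lebesgue_rV R d).
Implicit Types (u v w : 'rV[R]_d -> R) (U E : set 'rV[R]_d).
Hypotheses (oD : open D) (alpha12 : 1 < alpha < 2).

Let mD : measurable D. Proof. exact: measurable_open_rV. Qed.

Definition form_const : R := 2^-1 * stable_const d alpha.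

Lemma form_const_gt0 : 0 < form_const.
Proof.
have /andP[a1 a2] := alpha12.
by rewrite mulr_gt0 ?invr_gt0// stable_const_gt0//; lra.
Qed.

Lemma censored_form_gag u : measurable_fun setT u ->
  censored_form alpha D u u = (form_const%:E * gag alpha D u)%E.
Proof. by move=> mu; rewrite censored_formE//; exact: measurable_funTS. Qed.

Lemma censored_form_ge0 u : censored_domain alpha D u -> (0 <= censored_form alpha D u u)%E.
Proof.
move=> [mu _ _]; rewrite censored_formE// mule_ge0 ?gag_ge0// lee_fin ltW//.
exact: form_const_gt0.
Qed.

Lemma capacity_ge0 E : (0 <= capacity alpha D E)%E.
Proof.
apply: le_ereal_inf_tmp => _ [U _ <-]; apply: le_ereal_inf_tmp => _ [u [du _] <-].
exact: censored_form_ge0.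
Qed.

Lemma capacity_le E U u : open U -> U `<=` D -> E `<=` U -> censored_domain alpha D u ->
  {ae leb, forall x, U x -> 1 <= u x} -> (capacity alpha D E <= censored_form alpha D u u)%E.
Proof.
move=> oU UD EU du u1; apply: (@le_trans _ _ (capacity_open alpha D U)).
  by apply: ereal_inf_lbound; exists U.
by apply: ereal_inf_lbound; exists u.
Qed.

(** The capacity is an infimum of infima; each level uses half of the tolerance, and the competitor
    is extended by zero. *)
Lemma capacity_approx E (e : R) : (capacity alpha D E < +oo)%E -> 0 < e ->
  exists U u, [/\ open U, U `<=` D, E `<=` U, measurable_fun setT u &
    [/\ censored_domain alpha D u, {ae leb, forall x, U x -> 1 <= u x} &
    (censored_form alpha D u u <= capacity alpha D E + e%:E)%E]].
Proof.
move=> Eoo e0; have e20 : 0 < e / 2 by rewrite divr_gt0.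
have fE : capacity alpha D E \is a fin_num by rewrite ge0_fin_numE// capacity_ge0.
have [_ [U [oU UD EU] <-] UE] := lb_ereal_inf_adherent e20 fE.
have U0 : (0 <= capacity_open alpha D U)%E.
  by apply: le_ereal_inf_tmp => _ [u [du _] <-]; exact: censored_form_ge0.
have fU : capacity_open alpha D U \is a fin_num.
  by rewrite ge0_fin_numE//; apply: lt_trans UE _; rewrite lte_add_pinfty// ltry.
have [_ [u [du u1] <-] uU] := lb_ereal_inf_adherent e20 fU.
have [mu' du' fu'] := censored_domain_patch mD du.
exists U, (u \_ D); split; [exact: oU|exact: UD|exact: EU|exact: mu'|].
split; first exact: du'.
  by apply: filterS u1 => x h Ux; rewrite patchE mem_set; [exact: h|exact: UD].
rewrite fu'; apply: le_trans (ltW uU) _.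
apply: le_trans (leeD (ltW UE) (lexx _)) _.
by rewrite -addeA -EFinD -splitr.
Qed.

Lemma gag_cst (c : R) : gag alpha D (cst c) = 0%E.
Proof. by apply: integral0_eq => p _; rewrite /gint subrr expr0n mul0r. Qed.

Lemma censored_domain_scale (k : R) u : measurable_fun setT u -> censored_domain alpha D u ->
  (gag alpha D u < +oo)%E -> censored_domain alpha D (fun x => k * u x).
Proof.
move=> mu du gu.
apply: (@censored_domain_map _ _ _ _ mD alpha12 u (fun t _ => k * t) (cst 0) (k ^+ 2)) => //.
- exact: sqr_ge0.
- by rewrite gag_cst.
- move=> phi tphi; apply: (test_function_zero tphi).
    exact: (smoothM (smooth_cst k) (test_function_smooth tphi)).
  by move=> x ->; rewrite mulr0.
- by move=> x; exact: mulrl_continuous.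
- exact: measurable_funM.
- by move=> s t x y _ _; rewrite subrr expr0n addr0 -mulrBr exprMn.
- by move=> s x _; rewrite exprMn.
Qed.

Variable C : R.
Hypotheses (C0 : 0 < C) (friedrichsD : forall u, measurable_fun setT u ->
  censored_domain alpha D u -> (l2 D u <= C%:E * gag alpha D u)%E).

Lemma capacity_sigma_subadditive (E : nat -> set 'rV[R]_d) :
  (capacity alpha D (\bigcup_j E j) <= \sum_(0 <= j <oo) capacity alpha D (E j))%E.
Proof.
have [->|Soo] := eqVneq (\sum_(0 <= j <oo) capacity alpha D (E j))%E +oo%E; first exact: leey.
have S0 : (0 <= \sum_(0 <= j <oo) capacity alpha D (E j))%E.
  by apply: nneseries_ge0 => j _ _; exact: capacity_ge0.
have SE : (\sum_(0 <= j <oo) capacity alpha D (E j) =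
    (fine (\sum_(0 <= j <oo) capacity alpha D (E j)))%:E)%E.
  by rewrite fineK// ge0_fin_numE// ltey.
set S := fine _ in SE; rewrite SE in S0 *; rewrite lee_fin in S0.
have Ej j : (capacity alpha D (E j) < +oo)%E.
  apply: le_lt_trans (ltry S); rewrite -SE.
  by apply: (@nneseries_term_le _ (fun j => capacity alpha D (E j))) => i; exact: capacity_ge0.
have main (ep : R) : 0 < ep <= 1 ->
    (capacity alpha D (\bigcup_j E j) <= ((1 + ep) * (S + ep))%:E)%E.
  move=> /andP[ep0 ep1].
  pose dl j : R := (ep / 2) * 2^-1 ^+ j.
  have dl0 j : 0 < dl j by rewrite mulr_gt0 ?divr_gt0// exprn_gt0// invr_gt0.
  have /choice[U HU] j := capacity_approx (Ej j) (dl0 j).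
  have /choice[u Hu] := HU.
  have mu j : measurable_fun setT (u j) by have [_ _ _ ? _] := Hu j.
  have du j : censored_domain alpha D (u j) by have [_ _ _ _ [? _ _]] := Hu j.
  have sdl : (\sum_(0 <= j <oo) (dl j)%:E <= ep%:E)%E.
    apply: le_trans (@nneseries_geometric_le R (ep / 2) 2^-1 _ _ _ _) _.
    - by rewrite divr_ge0// ltW.
    - by apply/andP; split; lra.
    - by move=> k; rewrite lexx andbT lee_fin ltW.
    by rewrite lee_fin (_ : ep / 2 / (1 - 2^-1) = ep)//; field.
  have scg : (\sum_(0 <= j <oo) (form_const%:E * gag alpha D (u j)) <= (S + ep)%:E)%E.
    apply: (@le_trans _ _ (\sum_(0 <= j <oo) (capacity alpha D (E j) + (dl j)%:E))%E).
      apply: lee_nneseries => [j _ _|j _].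
        by rewrite mule_ge0 ?gag_ge0// lee_fin ltW// form_const_gt0.
      by rewrite -censored_form_gag//; have [_ _ _ _ [_ _ ?]] := Hu j.
    rewrite nneseriesD; last 2 first.
    - by move=> j _ _; exact: capacity_ge0.
    - by move=> j _ _; rewrite lee_fin ltW.
    by rewrite SE EFinD leeD.
  have cc0 := form_const_gt0.
  rewrite nneseriesZl in scg; last by move=> j _; exact: gag_ge0.
  have gu : (\sum_(0 <= j <oo) gag alpha D (u j) < +oo)%E.
    rewrite ltey; apply/eqP => goo; move: scg; rewrite goo.
    by rewrite gt0_muley ?lte_fin.
  (* The Friedrichs inequality turns summable energies into summable L^2 norms, so that the l2-norm
     of the [u j] is finite almost everywhere on [D] and square integrable. *)
  have lu : (\sum_(0 <= j <oo) l2 D (u j) < +oo)%E.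
    apply: (@le_lt_trans _ _ (\sum_(0 <= j <oo) (C%:E * gag alpha D (u j)))%E).
      apply: lee_nneseries => [j _ _|j _]; first exact: l2_ge0.
      exact: friedrichsD.
    rewrite nneseriesZl; last by move=> j _; exact: gag_ge0.
    by rewrite lte_mul_pinfty// lee_fin ltW.
  (* For e <= 1/6 one has (1 - e)^(-2) <= 1 + 6 e, so the final rescaling costs a factor 1 + ep. *)
  pose e := ep / 6; have e0 : 0 < e by rewrite divr_gt0.
  have e1 : e <= 6^-1 by rewrite /e ler_piMl.
  pose w := l2norm_shift u e.
  have mw : measurable_fun setT w by exact: measurable_l2norm_shift.
  have dw : censored_domain alpha D w by exact: censored_domain_l2norm_shift.
  have gw : (gag alpha D w <= \sum_(0 <= j <oo) gag alpha D (u j))%E.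
    exact: gag_l2norm_shift.
  (* Where some [u j] is at least 1 the shifted norm is at least 1 - e, so dividing by 1 - e makes
     it admissible. *)
  pose k := (1 - e)^-1.
  have ke : 0 < 1 - e by lra.
  pose w' (x : 'rV[R]_d) := k * w x.
  have mw' : measurable_fun setT w' by exact: measurable_funM.
  have dw' : censored_domain alpha D w'.
    by apply: censored_domain_scale => //; exact: le_lt_trans gu.
  have gw' : (gag alpha D w' <= (k ^+ 2)%:E * gag alpha D w)%E.
    apply: gag_le => //; first exact: sqr_ge0.
    by move=> x y _ _; rewrite /w' -mulrBr exprMn.
  have k2 : k ^+ 2 <= 1 + ep.
    rewrite /k exprVn -[leLHS]mul1r ler_pdivrMr ?exprn_gt0//.
    have -> : ep = 6 * e by rewrite /e; field.
    nra.
  apply: le_trans (@capacity_le _ (\bigcup_j U j) w' _ _ _ dw' _) _.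
  - by apply: bigcup_open => j _; have [] := Hu j.
  - by move=> x [j _ Ujx]; have [_ UD _ _ _] := Hu j; exact: UD.
  - by move=> x [j _ Ejx]; exists j => //; have [_ _ EU _ _] := Hu j; exact: EU.
  - have h1 := nneseries_sqr_fin_ae mD mu lu.
    have h2 : {ae leb, forall x, forall j, U j x -> 1 <= u j x}.
      by apply/ae_foralln => j; have [_ _ _ _ [_ ? _]] := Hu j.
    apply: filterS2 h1 h2 => x Sx ux [j _ Ujx].
    have xD : D x by have [_ UD _ _ _] := Hu j; exact: UD.
    have uj1 := ux j Ujx.
    have s1 : 1 <= fine (\sum_(0 <= j <oo) (u j x ^+ 2)%:E)%E.
      have Sfin : (\sum_(0 <= j <oo) (u j x ^+ 2)%:E)%E \is a fin_num.
        rewrite ge0_fin_numE; first exact: Sx.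
        by apply: nneseries_ge0 => i _ _; rewrite lee_fin sqr_ge0.
      rewrite -lee_fin fineK//.
      apply: le_trans (@nneseries_term_le _ (fun j => (u j x ^+ 2)%:E) j _).
        by rewrite lee_fin expr_ge1// (le_trans _ uj1).
      by move=> i; rewrite lee_fin sqr_ge0.
    rewrite /w' /k mulrC ler_pdivlMr// mul1r /w /l2norm_shift lerD2r.
    rewrite -[leLHS]sqrtr1 ler_wsqrtr//; apply: le_trans s1 _.
    by rewrite lerDr sqr_ge0.
  rewrite censored_form_gag//.
  apply: (@le_trans _ _ ((k ^+ 2)%:E * (form_const%:E * \sum_(0 <= j <oo) gag alpha D (u j)))%E).
    rewrite muleCA lee_wpmul2l//; first by rewrite lee_fin ltW.
    apply: le_trans gw' _; rewrite lee_wpmul2l// lee_fin sqr_ge0//.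
  apply: (@le_trans _ _ ((k ^+ 2)%:E * (S + ep)%:E)%E).
    by rewrite lee_wpmul2l// lee_fin sqr_ge0.
  by rewrite -EFinM lee_fin ler_wpM2r// addr_ge0// ltW.
apply/lee_addgt0Pr => eta eta0.
(* For ep <= 1 the product (1 + ep) (S + ep) is at most S + ep (S + 2). *)
pose ep := Num.min 1 (eta / (S + 2)).
have ep0 : 0 < ep by rewrite lt_min ltr01 divr_gt0// ltr_wpDl.
have ep1 : ep <= 1 by rewrite ge_min lexx.
have ep2 : ep * (S + 2) <= eta.
  by rewrite -ler_pdivlMr ?ltr_wpDl// ge_min lexx orbT.
apply: le_trans (main ep _) _; first by rewrite ep0.
rewrite -EFinD lee_fin; nra.
Qed.

End capacity_theory.

Lemma eball_radius_gt0 (R : realType) d (x : 'rV[R]_d) (V : R) : (0 < d)%N -> 0 < V ->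
  exists2 s, 0 < s & lebesgue_rV (eball x s) = V%:E.
Proof. by case: d x => // n x _; exact: eball_radius. Qed.

(** * Capacity and volume of balls *)

Section ball_capacity.
Variables (R : realType) (d : nat) (alpha : R) (D : set 'rV[R]_d).
Local Notation leb := (@lebesgue_rV R d).
Local Notation leb2 := (leb \x leb)%E.
Implicit Types (x y : 'rV[R]_d) (u v w : 'rV[R]_d -> R) (U E : set 'rV[R]_d).
Hypotheses (d0 : (0 < d)%N) (oD : open D) (bD : bounded_set D) (alpha12 : 1 < alpha < 2).

Let mD : measurable D. Proof. exact: measurable_open_rV. Qed.

Let alpha02 : 0 < alpha < 2.
Proof. by have /andP[a1 a2] := alpha12; rewrite a2 (lt_trans _ a1). Qed.

Lemma lebesgue_domain_lty : (leb D < +oo)%E.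
Proof.
have [M M0 DM] := bounded_sub_eball bD.
apply: le_lt_trans (lebesgue_eball_lty 0 M); apply: le_measure; rewrite ?inE//.
exact: measurable_eball.
Qed.

Lemma bump_diff_cutoff c s x y : 0 < s ->
  (bump c s x - bump c s y) ^+ 2 * kern alpha (x, y) <= 256 * cutoff alpha s (x, y).
Proof.
move=> s0; rewrite /cutoff mulrA ler_wpM2r ?kern_ge0//=.
rewrite minr_pMr; last exact: ler0n.
rewrite le_min mulr1 (bump_diff_le c x y s0) andbT.
by apply: le_trans (bump_diff_le1 c s x y) _; rewrite ler1n.
Qed.

Lemma cutoffC s x y : cutoff alpha s (x, y) = cutoff alpha s (y, x).
Proof. by rewrite /cutoff /kern /= enormB. Qed.

Lemma integral_mul_cutoff (C s : R) (g : 'rV[R]_d -> R) : 0 < s -> 0 <= C ->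
  (forall x, (\int[leb]_y (cutoff alpha s (x, y))%:E <= (C * s `^ (- alpha))%:E)%E) ->
  measurable_fun setT g -> (forall x, 0 <= g x) ->
  (\int[leb2]_p (g p.1 * cutoff alpha s p)%:E <=
     (C * s `^ (- alpha))%:E * \int[leb]_x (g x)%:E)%E /\
  (\int[leb2]_p (g p.2 * cutoff alpha s p)%:E <=
     (C * s `^ (- alpha))%:E * \int[leb]_x (g x)%:E)%E.
Proof.
move=> s0 C0 HC mg g0.
have c0 : 0 <= C * s `^ (- alpha) by rewrite mulr_ge0 ?powR_ge0.
have mge : measurable_fun setT (fun x => (g x)%:E) by exact/measurable_EFinP.
have inner x : (\int[leb]_y (g x * cutoff alpha s (x, y))%:E <=
    (C * s `^ (- alpha))%:E * (g x)%:E)%E.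
  under eq_integral do rewrite EFinM.
  rewrite ge0_integralZl//; last 3 first.
  - by apply/measurable_EFinP; exact: measurable_cutoff2.
  - by move=> y _; rewrite lee_fin cutoff_ge0.
  - by rewrite lee_fin.
  by rewrite muleC lee_wpmul2r// lee_fin.
have m1 : measurable_fun setT (fun p : 'rV[R]_d * 'rV[R]_d => (g p.1 * cutoff alpha s p)%:E).
  apply/measurable_EFinP; apply: measurable_funM; last exact: measurable_cutoff.
  exact: (measurableT_comp mg measurable_fst).
have m2 : measurable_fun setT (fun p : 'rV[R]_d * 'rV[R]_d => (g p.2 * cutoff alpha s p)%:E).
  apply/measurable_EFinP; apply: measurable_funM; last exact: measurable_cutoff.
  exact: (measurableT_comp mg measurable_snd).
have p1 (p : 'rV[R]_d * 'rV[R]_d) : (0 <= (g p.1 * cutoff alpha s p)%:E)%E.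
  by rewrite lee_fin mulr_ge0 ?cutoff_ge0.
have p2 (p : 'rV[R]_d * 'rV[R]_d) : (0 <= (g p.2 * cutoff alpha s p)%:E)%E.
  by rewrite lee_fin mulr_ge0 ?cutoff_ge0.
rewrite -ge0_integralZl//; last by move=> x _; rewrite lee_fin.
split.
  rewrite fubini_tonelli1//; apply: ge0_le_integral => //.
  - by move=> x _; apply: integral_ge0 => y _; exact: p1.
  - exact: measurable_fun_fubini_tonelli_F.
  - exact: measurable_funeM.
  - by move=> x _; exact: inner.
rewrite fubini_tonelli2//; apply: ge0_le_integral => //.
- by move=> x _; apply: integral_ge0 => y _; exact: p2.
- exact: measurable_fun_fubini_tonelli_G.
- exact: measurable_funeM.
move=> y _; rewrite /fubini_G.
rewrite (_ : (fun x => _) = (fun x => (g y * cutoff alpha s (y, x))%:E)); first exact: inner.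
by apply/funext => x /=; rewrite cutoffC.
Qed.

(** The ball carrying the bump may leave [D]; finiteness comes from the truncated kernel and the
    finite volume of [D]. *)
Lemma gag_bump_lty c s : 0 < s -> (gag alpha D (bump c s) < +oo)%E.
Proof.
move=> s0; have [C C0 HC] := kernel_cutoff d alpha02.
have mI : measurable_fun setT (\1_D : 'rV[R]_d -> R) by exact: measurable_indic.
have I0 x : 0 <= (\1_D x : R) by [].
have [h _] := integral_mul_cutoff s0 (ltW C0) (fun x => HC s x s0) mI I0.
have mb : measurable_fun setT (bump c s).
  by apply: continuous_measurable_rV; have [] := smooth_bump c s [::].
have mDD : measurable (D `*` D) by exact: measurableX.
have m1 : measurable_fun setT (fun p : 'rV[R]_d * 'rV[R]_d => (\1_D p.1 * cutoff alpha s p)%:E).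
  apply/measurable_EFinP; apply: measurable_funM; last exact: measurable_cutoff.
  exact: (measurableT_comp mI measurable_fst).
have p1 (p : 'rV[R]_d * 'rV[R]_d) : (0 <= (\1_D p.1 * cutoff alpha s p)%:E)%E.
  by rewrite lee_fin mulr_ge0 ?cutoff_ge0.
have k0 : (0 <= 256%:E :> \bar R)%E by rewrite lee_fin ler0n.
apply: (@le_lt_trans _ _ (256%:E * \int[leb2]_p (\1_D p.1 * cutoff alpha s p)%:E)%E).
  rewrite -ge0_integralZl; [|exact: measurableT|exact: m1|by move=> p _; exact: p1|exact: k0].
  apply: (@le_trans _ _ (\int[leb2]_(p in D `*` D) (256%:E * (\1_D p.1 * cutoff alpha s p)%:E))%E).
    apply: ge0_le_integral => //.
    - by move=> p _; rewrite lee_fin gint_ge0.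
    - exact: measurable_gintT.
    - by apply: measurable_funTS; exact: measurable_funeM.
    move=> [x y] [xD yD]; rewrite -EFinM lee_fin /= indicE mem_set// mul1r.
    exact: bump_diff_cutoff.
  apply: ge0_subset_integral; [exact: mDD|exact: measurableT|exact: measurable_funeM| |by []].
  by move=> p _; apply: mule_ge0; [exact: k0|exact: p1].
apply: lte_mul_pinfty; [exact: k0|by []|apply: le_lt_trans h _].
rewrite lte_mul_pinfty ?lee_fin ?mulr_ge0 ?powR_ge0 ?(ltW C0)//.
by rewrite integral_indic// setIT lebesgue_domain_lty.
Qed.

Lemma test_function_domain u : test_function D u -> (l2 D u < +oo)%E -> censored_domain alpha D u.
Proof.
move=> tu lu; have mu := test_function_measurable tu.
split => //; first exact: measurable_funTS.
exists (fun=> u); split => //.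
rewrite (_ : (fun _ => _) = cst 0%E); first exact: cvg_cst.
apply/funext => k; rewrite /censored_form1 censored_formE//; last first.
  by apply: measurable_funTS; exact: measurable_funB.
rewrite (_ : gag _ _ _ = 0%E); last first.
  by apply: integral0_eq => p _; rewrite /gint /= !subrr expr0n mul0r.
rewrite mule0 add0e; apply: integral0_eq => y _ /=.
by rewrite subrr mulr0.
Qed.

Lemma capacity_eball_lty x (r : R) : 0 < r -> eball x (2 * r) `<=` D ->
  (capacity alpha D (eball x r) < +oo)%E.
Proof.
(* With this radius the bump is supported inside the ball of radius 2 r and is at least exp(-2) on
   the ball of radius r, which is exactly two thirds of [s]. *)
move=> r0 xD; pose s := 3 / 2 * r; have s0 : 0 < s by rewrite mulr_gt0 ?divr_gt0.
have tb : test_function D (bump x s).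
  apply: test_function_bump => // y ys; apply: xD; rewrite /eball /=.
  by apply: le_lt_trans ys _; rewrite /s; lra.
have mb := test_function_measurable tb.
have db : censored_domain alpha D (bump x s).
  apply: test_function_domain => //.
  apply: le_lt_trans lebesgue_domain_lty.
  rewrite -[leRHS]mul1e -integral_cst//; apply: ge0_le_integral => //.
  - by move=> y _; rewrite lee_fin sqr_ge0.
  - by apply: measurable_sqr; exact: measurable_funTS.
  by move=> y _; rewrite lee_fin expr_le1// ?bump_ge0 ?bump_le1.
have gb := gag_bump_lty x s0.
pose k : R := expR 2.
have dk := censored_domain_scale oD alpha12 k mb db gb.
have mk : measurable_fun setT (fun y => k * bump x s y) by exact: measurable_funM.
apply: le_lt_trans (@capacity_le _ _ _ _ (eball x r) (eball x r) _ _ _ _ dk _) _ => //.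
- exact: open_eball.
- by move=> y yr; apply: xD; rewrite /eball /=; apply: lt_trans yr _; lra.
- apply: aeW => y yr; rewrite /k -ler_pdivrMl ?expR_gt0// mulr1 -expRN.
  apply: bump_ge => //; rewrite /eball /= in yr; rewrite /s; lra.
rewrite censored_form_gag// lte_mul_pinfty//.
  by rewrite lee_fin ltW// form_const_gt0.
have h : (gag alpha D (fun y => k * bump x s y)%R <= (k ^+ 2)%:E * gag alpha D (bump x s))%E.
  apply: gag_le => //; first exact: sqr_ge0.
  by move=> y z _ _; rewrite -mulrBr exprMn.
by apply: le_lt_trans h _; rewrite lte_mul_pinfty// lee_fin sqr_ge0.
Qed.

Lemma capacity_mono E U : E `<=` U -> (capacity alpha D E <= capacity alpha D U)%E.
Proof.
move=> EU; apply: ereal_inf_le_tmp => _ [V [oV VD UV] <-]; exists V => //; split => //.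
exact: subset_trans UV.
Qed.

(* If the capacity vanishes then [cap_radius] is the junk value 0. *)
Lemma capacity_le_lebesgue x (r : R) : 0 < r -> eball x (2 * r) `<=` D ->
  (capacity alpha D (eball x r) <= leb (eball x (cap_radius_star alpha D r x)))%E.
Proof.
move=> r0 xD; have coo := capacity_eball_lty r0 xD.
have c0 := capacity_ge0 oD alpha12 (eball x r).
have cE : capacity alpha D (eball x r) = (fine (capacity alpha D (eball x r)))%:E.
  by rewrite fineK// ge0_fin_numE.
have [->|cn0] := eqVneq (capacity alpha D (eball x r)) 0%E; first exact: measure_ge0.
have V0 : 0 < fine (capacity alpha D (eball x r)).
  by rewrite -lte_fin -cE lt_neqAle eq_sym cn0.
have [s s0 sE] := eball_radius_gt0 x d0 V0.
have [cr0 crE] : 0 < cap_radius alpha D r x /\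
    leb (eball x (cap_radius alpha D r x)) = capacity alpha D (eball x r).
  by apply: (@xgetPex _ 0 [set s | 0 < s /\ leb (eball x s) = capacity alpha D (eball x r)]);
    exists s; rewrite cE.
rewrite -crE; apply: le_measure; rewrite ?inE; try exact: measurable_eball.
by move=> y; rewrite /eball /= => /lt_le_trans; apply; rewrite /cap_radius_star le_max lexx.
Qed.

Lemma cap_radius_star_ge x (r : R) : 16 * r <= cap_radius_star alpha D r x.
Proof. by rewrite le_max lexx orbT. Qed.

(** The ball of radius s/2 centred at distance s/2 from x in the inner normal direction lies in B(x,
    s). It also lies in the interior ball touching at z, since the distance of x to the boundary and
    s are both below rho/2. *)
Lemma interior_ball_volume (rho s : R) x : interior_ball_radius D rho -> D x ->
  dist_boundary D x < rho / 2 -> 0 < s < rho / 2 ->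
  (((s / d%:R) ^+ d)%:E <= leb (D `&` eball x s))%E.
Proof.
move=> [rho0 Hrho] Dx dx /andP[s0 srho].
have dxrho : dist_boundary D x < rho by apply: lt_trans dx _; lra.
have [z [zD xz ball_sub]] := Hrho x Dx dxrho.
have nDz : ~ D z by case: zD => _; rewrite (interior_id D).1.
have e0 : 0 < enorm (x - z).
  rewrite enorm_gt0 subr_eq0; apply/negP => /eqP xzE; apply: nDz.
  by rewrite -xzE.
set e := enorm (x - z) in e0 xz ball_sub.
have ee : e < rho / 2 by rewrite xz.
pose n := e^-1 *: (x - z).
have n1 : enorm n = 1 by rewrite /n enormZ gtr0_norm ?invr_gt0// mulVf// gt_eqF.
pose p := x + (s / 2) *: n.
have xE : x = z + e *: n by rewrite /n scalerA mulfV ?gt_eqF// scale1r addrC subrK.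
have yE : z + (rho / e) *: (x - z) = z + rho *: n by rewrite /n scalerA.
have sub : eball p (s / 2) `<=` D `&` eball x s.
  move=> y yp; split; last first.
    rewrite /eball /=; apply: le_lt_trans (enorm_distD p y x) _.
    rewrite (_ : p - x = (s / 2) *: n); last by rewrite /p addrC addKr.
    rewrite enormZ n1 mulr1 gtr0_norm ?divr_gt0//.
    by rewrite /eball /= in yp; lra.
  apply: ball_sub; rewrite yE /eball /=.
  apply: le_lt_trans (enorm_distD p y _) _.
  have -> : p - (z + rho *: n) = (e + s / 2 - rho) *: n.
    by rewrite /p [in LHS]xE; apply/rowP => i; rewrite !mxE; ring.
  rewrite enormZ n1 mulr1 ler0_norm; last by lra.
  by rewrite /eball /= in yp; lra.
have mB : measurable (D `&` eball x s) by apply: measurableI => //; exact: measurable_eball.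
apply: le_trans (le_measure _ _ _ sub); rewrite ?inE//; last exact: measurable_eball.
have s20 : 0 < s / 2 by rewrite divr_gt0.
apply: le_trans (lebesgue_eball_ge p s20).
by rewrite lee_fin (_ : 2 * (s / 2 / d%:R) = s / d%:R)//; field; rewrite pnatr_eq0 -lt0n.
Qed.

End ball_capacity.

(** * Quasi-additivity *)

Section truncation.
Variable R : realType.
Implicit Types s t : R.

(* A smooth substitute for [Num.min 1 `|t|], so that it preserves test functions. *)
Definition trunc t : R := t ^+ 2 / (1 + t ^+ 2).

Let den_gt0 t : 0 < 1 + t ^+ 2.
Proof. by rewrite ltr_wpDr// sqr_ge0. Qed.

Lemma trunc_ge0 t : 0 <= trunc t.
Proof. by rewrite divr_ge0 ?sqr_ge0// ltW. Qed.

Lemma trunc_le1 t : trunc t <= 1.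
Proof. by rewrite ler_pdivrMr// mul1r lerDr. Qed.

Lemma trunc_ge_half t : 1 <= t -> 2^-1 <= trunc t.
Proof.
move=> t1; have : 1 <= t ^+ 2 by rewrite expr_ge1// (le_trans _ t1).
by rewrite ler_pdivlMr//; lra.
Qed.

Lemma trunc_lipschitz s t : (trunc s - trunc t) ^+ 2 <= (s - t) ^+ 2.
Proof.
have ds := den_gt0 s; have dt := den_gt0 t.
have -> : (trunc s - trunc t) ^+ 2 =
    (s - t) ^+ 2 * ((s + t) / ((1 + s ^+ 2) * (1 + t ^+ 2))) ^+ 2.
  by rewrite /trunc; field; rewrite !gt_eqF.
rewrite ler_piMr ?sqr_ge0// -real_normK ?num_real// expr_le1// normrM normfV.
rewrite ler_pdivrMr ?normr_gt0 ?gt_eqF ?mulr_gt0// mul1r (gtr0_norm (mulr_gt0 ds dt)).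
have := sqr_ge0 (s * t); have := sqr_ge0 (s - 1); have := sqr_ge0 (t - 1).
have := sqr_ge0 (s + 1); have := sqr_ge0 (t + 1).
by rewrite ler_norml => *; apply/andP; split; nra.
Qed.

Lemma trunc0 : trunc 0 = 0.
Proof. by rewrite /trunc expr0n mul0r. Qed.

Lemma trunc_sqr_le t : trunc t ^+ 2 <= t ^+ 2.
Proof. by have := trunc_lipschitz t 0; rewrite trunc0 !subr0. Qed.

Lemma continuous_trunc : continuous trunc.
Proof.
move=> t; rewrite /trunc /continuous_at.
apply: cvgM; first exact: exprn_continuous.
apply: cvgV; first by rewrite gt_eqF.
by apply: cvgD; [exact: cvg_cst|exact: exprn_continuous].
Qed.

Lemma smooth_trunc d (u : 'rV[R]_d -> R) : smooth u -> smooth (fun x => trunc (u x)).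
Proof.
move=> su; have s2 : smooth (cst 1 + u * u).
  by apply: smoothD; [exact: smooth_cst|exact: smoothM].
rewrite (_ : (fun _ => _) = (u * u) * (fun x => (cst 1 + u * u) x `^ (- 1))).
  apply: smoothM; first exact: smoothM.
  by apply: smooth_powR => // x; have := den_gt0 (u x); rewrite expr2.
apply/funext => x; rewrite [RHS](_ : _ = u x * u x * (1 + u x * u x) `^ (- 1))//.
by rewrite powR_inv1 ?/trunc ?expr2// -expr2 ltW.
Qed.

End truncation.

(** * A Poincare inequality with a point value *)

Section mean_value.
Variables (R : realType) (d : nat) (alpha : R).
Local Notation leb := (@lebesgue_rV R d).
Local Notation leb2 := (leb \x leb)%E.
Hypothesis dalpha : 0 < d%:R + alpha.

(** Averaged over [y] in [A], the L^2 deviation from [w y] is a double integral of squared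
    increments, bounded by the energy because the kernel is bounded below. Some [y] is then at most
    twice the average. *)
Lemma exists_mean_point (A : set 'rV[R]_d) (w : 'rV[R]_d -> R) (M : R) : measurable A ->
  measurable_fun setT w -> (0 < leb A < +oo)%E ->
  (forall x y, A x -> A y -> enorm (x - y) <= M) -> (gag alpha A w < +oo)%E ->
  exists2 y, A y & (leb A * l2 A (fun x => w x - w y)%R <=
    (2 * M `^ (d%:R + alpha))%:E * gag alpha A w)%E.
Proof.
move=> mA mw /andP[A0 Aoo] AM goo.
pose F y : \bar R := l2 A (fun x => w x - w y).
pose f (p : 'rV[R]_d * 'rV[R]_d) : \bar R := ((w p.1 - w p.2) ^+ 2 * \1_A p.1)%:E.
have mf : measurable_fun setT f.
  apply/measurable_EFinP; apply: measurable_funM.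
    apply: measurable_funX; apply: measurable_funB.
      exact: (measurableT_comp mw measurable_fst).
    exact: (measurableT_comp mw measurable_snd).
  exact: (measurableT_comp (measurable_indic mA) measurable_fst).
have f0 p : (0 <= f p)%E by rewrite lee_fin mulr_ge0 ?sqr_ge0.
have FE y : F y = fubini_G leb f y.
  by rewrite /F /fubini_G /f /= integral_mul_indic.
have mF : measurable_fun setT F.
  by rewrite (funext FE); exact: measurable_fun_fubini_tonelli_G.
have F0 y : (0 <= F y)%E by exact: l2_ge0.
pose I : \bar R := ((M `^ (d%:R + alpha))%:E * gag alpha A w)%E.
have I0 : (0 <= I)%E by rewrite mule_ge0 ?gag_ge0// lee_fin powR_ge0.
have Ioo : (I < +oo)%E by rewrite lte_mul_pinfty// lee_fin powR_ge0.
have mFA : measurable_fun A F by exact: measurable_funTS.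
have iF : (\int[leb]_(y in A) F y <= I)%E.
  have -> : (\int[leb]_(y in A) F y = \int[leb2]_(p in A `*` A) ((w p.1 - w p.2) ^+ 2)%:E)%E.
    rewrite tonelli_rect2//.
      apply: measurable_funTS; apply/measurable_EFinP; apply: measurable_funX.
      apply: measurable_funB; first exact: (measurableT_comp mw measurable_fst).
      exact: (measurableT_comp mw measurable_snd).
    by move=> p _; rewrite lee_fin sqr_ge0.
  rewrite /I -ge0_integralZl//; last 4 first.
  - exact: measurableX.
  - exact: measurable_gintT.
  - by move=> p _; rewrite lee_fin gint_ge0.
  - by rewrite lee_fin powR_ge0.
  apply: ge0_le_integral; first exact: measurableX.
  - by move=> p _; rewrite lee_fin sqr_ge0.
  - apply: measurable_funTS; apply/measurable_EFinP; apply: measurable_funX.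
    apply: measurable_funB; first exact: (measurableT_comp mw measurable_fst).
    exact: (measurableT_comp mw measurable_snd).
  - by apply: measurable_funeM; exact: measurable_gintT.
  move=> [x y] [xA yA]; rewrite -EFinM lee_fin /=.
  exact: (sqr_diff_le_gint dalpha w (AM x y xA yA)).
apply: contrapT => H.
have {}H y : A y -> (2%:E * I < leb A * F y)%E.
  move=> yA; rewrite ltNge; apply/negP => h; apply: H; exists y => //.
  by rewrite EFinM -muleA.
have h1 : (2%:E * I * leb A <= leb A * I)%E.
  rewrite -integral_cst//; apply: (@le_trans _ _ (\int[leb]_(y in A) (leb A * F y))%E).
    apply: ge0_le_integral => //.
    - by move=> y _; rewrite mule_ge0.
    - exact: measurable_funeM.
    - by move=> y yA; exact: ltW (H y yA).
  by rewrite ge0_integralZl// lee_wpmul2l.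
(* If every [y] exceeded twice the average, integration would force the bound to be 0. In that
   degenerate case the deviation vanishes almost everywhere on [A], against the strict inequality at
   every point. *)
have Iz : I = 0%E.
  have EI : I = (fine I)%:E by rewrite fineK// ge0_fin_numE.
  have EA : leb A = (fine (leb A))%:E by rewrite fineK// ge0_fin_numE// ltW.
  rewrite EI EA -!EFinM lee_fin in h1.
  rewrite EI lee_fin in I0; rewrite EA lte_fin in A0.
  rewrite EI; congr EFin; move: (fine I) (fine (leb A)) h1 I0 A0 => i a h1 i0 a0.
  apply/eqP; rewrite eq_le i0 andbT -(pmulr_lle0 i a0); lra.
have iF0 : (\int[leb]_(y in A) `|F y| = 0)%E.
  under eq_integral do rewrite gee0_abs//.
  by apply/eqP; rewrite eq_le integral_ge0// andbT -Iz.
have /(ae_eq_integral_abs leb mA mFA) [N [mN N0 AN]] := iF0.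
have : (leb A <= leb N)%E.
  apply: le_measure; rewrite ?inE// => y yA; apply: AN => /= h.
  have := H y yA; rewrite Iz mule0 h//.
  by rewrite mule0 ltxx.
by rewrite N0 leNgt A0.
Qed.

End mean_value.

(** * Energy of a function multiplied by a bump *)

Section localization.
Variables (R : realType) (d : nat) (alpha : R) (D : set 'rV[R]_d).
Local Notation leb := (@lebesgue_rV R d).
Local Notation leb2 := (leb \x leb)%E.
Hypotheses (oD : open D) (alpha12 : 1 < alpha < 2).

Let mD : measurable D. Proof. exact: measurable_open_rV. Qed.

(** The product rule (f psi)(x) - (f psi)(y) = (f(x) - f(y)) psi(y) + f(x) (psi(x) - psi(y)). The
    energy on the left is over all of [D], but a pair contributes only if one of its points lies in
    the ball, and integrating the truncated kernel over the other point costs eta^(-alpha). The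
    factor 8 is 2 * 4, and 1024 is 2 * 256 for each of the two variables. *)
Lemma gag_localize (C eta m : R) (x0 : 'rV[R]_d) (f w : 'rV[R]_d -> R) :
  0 < eta -> 0 <= C ->
  (forall x, (\int[leb]_y (cutoff alpha eta (x, y))%:E <= (C * eta `^ (- alpha))%:E)%E) ->
  measurable_fun setT f -> measurable_fun setT w ->
  (forall x y, (f x - f y) ^+ 2 <= 4 * (w x - w y) ^+ 2) ->
  (forall x, f x ^+ 2 <= (w x - m) ^+ 2) ->
  (gag alpha D (fun x => f x * bump x0 eta x)%R <=
    8%:E * gag alpha (D `&` eball x0 eta) w +
    (1024 * (C * eta `^ (- alpha)))%:E * l2 (D `&` eball x0 eta) (fun x => w x - m)%R)%E.
Proof.
move=> eta0 C0 HC mf mw fw fm.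
pose A := D `&` eball x0 eta.
have mA : measurable A by apply: measurableI => //; exact: measurable_eball.
have mAA : measurable (A `*` A) by exact: measurableX.
have mDD : measurable (D `*` D) by exact: measurableX.
pose psi := bump x0 eta.
have mpsi : measurable_fun setT psi.
  by apply: continuous_measurable_rV; have [] := smooth_bump x0 eta [::].
pose g x : R := (w x - m) ^+ 2 * \1_A x.
have mg : measurable_fun setT g.
  by apply: measurable_funM; [apply: measurable_funX; exact: measurable_funB|exact: measurable_indic].
have g0 x : 0 <= g x by rewrite mulr_ge0 ?sqr_ge0.
have [i2 i3] := integral_mul_cutoff eta0 C0 HC mg g0.
have ig : (\int[leb]_x (g x)%:E = l2 A (fun x => w x - m)%R)%E.
  by rewrite integral_mul_indic.
rewrite ig in i2 i3.
pose F1 (p : 'rV[R]_d * 'rV[R]_d) : \bar R := ((fun p => (gint alpha w p)%:E) \_ (A `*` A)) p.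
pose F2 (p : 'rV[R]_d * 'rV[R]_d) : \bar R := (g p.1 * cutoff alpha eta p)%:E.
pose F3 (p : 'rV[R]_d * 'rV[R]_d) : \bar R := (g p.2 * cutoff alpha eta p)%:E.
have mF1 : measurable_fun setT F1.
  by apply/(measurable_restrictT _ _).1 => //; exact: measurable_gintT.
have mF2 : measurable_fun setT F2.
  apply/measurable_EFinP; apply: measurable_funM; last exact: measurable_cutoff.
  exact: (measurableT_comp mg measurable_fst).
have mF3 : measurable_fun setT F3.
  apply/measurable_EFinP; apply: measurable_funM; last exact: measurable_cutoff.
  exact: (measurableT_comp mg measurable_snd).
have F10 p : (0 <= F1 p)%E by rewrite /F1 patchE; case: ifP => // _; rewrite lee_fin gint_ge0.
have F20 p : (0 <= F2 p)%E by rewrite lee_fin mulr_ge0 ?cutoff_ge0.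
have F30 p : (0 <= F3 p)%E by rewrite lee_fin mulr_ge0 ?cutoff_ge0.
have mv : measurable_fun setT (fun x => f x * psi x) by exact: measurable_funM.
have [k8 [k8E k80]] : exists k : R, k = 8 /\ (0 <= k%:E)%E by (exists 8; split; rewrite ?lee_fin ?ler0n).
have [k512 [k512E k5120]] : exists k : R, (forall t, k * t = 512 * t) /\ (0 <= k%:E)%E.
  by exists 512; split; [move=> t|rewrite lee_fin ler0n].
rewrite -[in leRHS]k8E.
apply: (@le_trans _ _ (\int[leb2]_p (k8%:E * F1 p + (k512%:E * F2 p + k512%:E * F3 p)))%E); last first.
  rewrite ge0_integralD//; last 4 first.
  - by move=> p _; rewrite mule_ge0.
  - exact: measurable_funeM.
  - by move=> p _; rewrite adde_ge0// mule_ge0.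
  - by apply: emeasurable_funD; exact: measurable_funeM.
  rewrite ge0_integralD//; last 4 first.
  - by move=> p _; rewrite mule_ge0.
  - exact: measurable_funeM.
  - by move=> p _; rewrite mule_ge0.
  - exact: measurable_funeM.
  rewrite !ge0_integralZl//; apply: leeD; first by rewrite -integral_mkcond.
  have -> : 1024 * (C * eta `^ (- alpha)) = k512 * (C * eta `^ (- alpha)) + k512 * (C * eta `^ (- alpha)).
    by rewrite !k512E; ring.
  have c0 : 0 <= k512 * (C * eta `^ (- alpha)).
    by apply: mulr_ge0; [rewrite -lee_fin|rewrite mulr_ge0 ?powR_ge0].
  rewrite (EFinD (k512 * _)) ge0_muleDl//.
  apply: leeD; rewrite (EFinM k512) -muleA.
    exact: (lee_wpmul2l k5120 i2).
  exact: (lee_wpmul2l k5120 i3).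
apply: (@le_trans _ _ (\int[leb2]_(p in D `*` D) (k8%:E * F1 p + (k512%:E * F2 p + k512%:E * F3 p)))%E); last first.
  apply: ge0_subset_integral => //.
    by apply: emeasurable_funD; [|apply: emeasurable_funD]; exact: measurable_funeM.
  by move=> p _; rewrite !adde_ge0// mule_ge0.
apply: ge0_le_integral => //.
- by move=> p _; rewrite lee_fin gint_ge0.
- exact: measurable_gintT.
- apply: measurable_funTS.
  by apply: emeasurable_funD; [|apply: emeasurable_funD]; exact: measurable_funeM.
move=> [x y] [/= xD yD].
have out z : D z -> z \notin A -> psi z = 0.
  move=> zD; rewrite notin_setE => zA; apply: bump_eq0 => //.
  by rewrite leNgt; apply/negP => h; apply: zA.
have bc := bump_diff_cutoff alpha x0 x y eta0.
have K0 := kern_ge0 alpha (x, y); have c0 := cutoff_ge0 alpha eta (x, y).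
have p0 z : 0 <= psi z <= 1 by rewrite bump_ge0 bump_le1.
rewrite k8E /F1 /F2 /F3 /g patchE in_setX /= !indicE.
move: bc K0 c0; rewrite /gint /= -/psi.
set k := kern _ _; set cu := cutoff _ _ _; set a := psi x; set b := psi y => bc K0 c0.
have key (s t : R) : s ^+ 2 <= t -> s ^+ 2 * (a - b) ^+ 2 * k <= 256 * (t * cu).
  move=> st; rewrite -mulrA; apply: (@le_trans _ _ (s ^+ 2 * (256 * cu))).
    by rewrite ler_wpM2l ?sqr_ge0.
  by rewrite mulrCA ler_wpM2l ?ler0n// ler_wpM2r.
(* With both points in the ball the product rule is used; with exactly one, only the value of [f]
   there times the increment of the bump survives; with none, the increment is zero. *)
case xA : (x \in A); case yA : (y \in A) => /=.
- rewrite !mulr1 -!EFinM -!EFinD lee_fin !k512E.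
  have hx := key _ _ (fm x).
  have gy0 : 0 <= 512 * ((w y - m) ^+ 2 * cu).
    by apply: mulr_ge0; [exact: ler0n|apply: mulr_ge0; [exact: sqr_ge0|exact: c0]].
  apply: (@le_trans _ _ (2 * ((f x - f y) ^+ 2 * k) + 2 * (f x ^+ 2 * (a - b) ^+ 2 * k))).
    have -> : 2 * ((f x - f y) ^+ 2 * k) + 2 * (f x ^+ 2 * (a - b) ^+ 2 * k) =
        (2 * (f x - f y) ^+ 2 + 2 * (f x ^+ 2 * (a - b) ^+ 2)) * k by ring.
    rewrite ler_wpM2r//.
    have -> : f x * a - f y * b = (f x - f y) * b + f x * (a - b) by ring.
    have /andP[b0 b1] := p0 y.
    have b2 : ((f x - f y) * b) ^+ 2 <= (f x - f y) ^+ 2.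
      by rewrite exprMn ler_piMr ?sqr_ge0// expr_le1.
    have -> : f x ^+ 2 * (a - b) ^+ 2 = (f x * (a - b)) ^+ 2 by rewrite exprMn.
    set P := (f x - f y) * b in b2 *; set Q := f x * (a - b).
    have := sqr_ge0 (P - Q); nra.
  have : (f x - f y) ^+ 2 * k <= 4 * (w x - w y) ^+ 2 * k by rewrite ler_wpM2r.
  lra.
- have b0 : b = 0 by apply: out => //; rewrite yA.
  rewrite [X in (_ <= X + _)%E](_ : _ = 0%E); last exact: mule0.
  rewrite mulr0 mul0r mule0 adde0 add0e mulr1 -EFinM lee_fin k512E b0 mulr0 subr0.
  have := key _ _ (fm x); rewrite b0 subr0 exprMn => h; apply: le_trans h _.
  by apply: ler_wpM2r; [apply: mulr_ge0; [exact: sqr_ge0|exact: c0]|rewrite ler_nat].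
- have a0 : a = 0 by apply: out => //; rewrite xA.
  rewrite [X in (_ <= X + _)%E](_ : _ = 0%E); last exact: mule0.
  rewrite mulr0 mul0r mule0 !add0e mulr1 -EFinM lee_fin k512E a0 mulr0 sub0r sqrrN.
  have := key _ _ (fm y); rewrite a0 sub0r sqrrN exprMn => h; apply: le_trans h _.
  by apply: ler_wpM2r; [apply: mulr_ge0; [exact: sqr_ge0|exact: c0]|rewrite ler_nat].
- have b0 : b = 0 by apply: out => //; rewrite yA.
  have a0 : a = 0 by apply: out => //; rewrite xA.
  rewrite [X in (_ <= X + _)%E](_ : _ = 0%E); last exact: mule0.
  by rewrite a0 b0 !mulr0 subrr expr0n !mul0r !mule0 !adde0.
Qed.

End localization.

Section local_estimate.
Variables (R : realType) (d : nat) (alpha : R) (D : set 'rV[R]_d).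
Local Notation leb := (@lebesgue_rV R d).
Hypotheses (d0 : (0 < d)%N) (oD : open D) (bD : bounded_set D) (alpha12 : 1 < alpha < 2).

Let mD : measurable D. Proof. exact: measurable_open_rV. Qed.

Let alpha0 : 0 < alpha.
Proof. by have /andP[a1 _] := alpha12; rewrite (lt_trans _ a1). Qed.

Let dalpha : 0 < d%:R + alpha.
Proof. by rewrite ltr_wpDl. Qed.

Lemma measurable_trunc (u : 'rV[R]_d -> R) : measurable_fun setT u ->
  measurable_fun setT (fun x : 'rV[R]_d => trunc (u x)).
Proof.
exact: (measurableT_comp (continuous_measurable_fun (@continuous_trunc R))).
Qed.

Lemma trunc_product_bound (s t m a b : R) : 0 <= m <= 1 -> 0 <= a <= 1 -> 0 <= b <= 1 ->
  (trunc s * (trunc s - m) * a - trunc t * (trunc t - m) * b) ^+ 2 <=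
  8 * ((s - t) ^+ 2 + (a - b) ^+ 2).
Proof.
move=> /andP[m0 m1] /andP[a0 a1] /andP[b0 b1].
have := trunc_lipschitz s t.
have := trunc_ge0 s; have := trunc_le1 s; have := trunc_ge0 t; have := trunc_le1 t.
set p := trunc s; set q := trunc t => q1 q0 p1 p0 pq.
have -> : p * (p - m) * a - q * (q - m) * b =
   (p - q) * ((p + q - m) * a) + q * (q - m) * (a - b) by ring.
have h1 : ((p + q - m) * a) ^+ 2 <= 4.
  rewrite exprMn; apply: (@le_trans _ _ (4 * 1)); last by rewrite mulr1.
  apply: ler_pM; rewrite ?sqr_ge0 ?expr_le1//; nra.
have h2 : (q * (q - m)) ^+ 2 <= 1.
  by rewrite -real_normK ?num_real// expr_le1// normrM mulr_ile1// ler_norml; lra.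
have h3 : ((p - q) * ((p + q - m) * a)) ^+ 2 <= (s - t) ^+ 2 * 4.
  by rewrite exprMn; apply: ler_pM; rewrite ?sqr_ge0.
have h4 : (q * (q - m) * (a - b)) ^+ 2 <= (a - b) ^+ 2.
  by rewrite exprMn ler_piMl ?sqr_ge0.
set X := (p - q) * _ in h3 *; set Y := q * (q - m) * _ in h4 *.
have := sqr_ge0 (X - Y); have := sqr_ge0 (a - b); nra.
Qed.

Lemma trunc_product_sqr_le (s m : R) :
  (trunc s * (trunc s - m)) ^+ 2 <= (trunc s - m) ^+ 2.
Proof.
rewrite exprMn ler_piMl ?sqr_ge0// expr_le1//.
  exact: trunc_le1.
exact: trunc_ge0.
Qed.

Lemma trunc_product_diff (s t m : R) : 0 <= m <= 1 ->
  (trunc s * (trunc s - m) - trunc t * (trunc t - m)) ^+ 2 <= 4 * (trunc s - trunc t) ^+ 2.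
Proof.
move=> /andP[m0 m1].
have := trunc_ge0 s; have := trunc_le1 s; have := trunc_ge0 t; have := trunc_le1 t.
set p := trunc s; set q := trunc t => q1 q0 p1 p0.
have -> : p * (p - m) - q * (q - m) = (p + q - m) * (p - q) by ring.
rewrite exprMn ler_wpM2r ?sqr_ge0//; nra.
Qed.

(** The competitor is a multiple of w (w - m) times a bump, restricted to the part of [U] in the
    smaller ball. It comes from test functions because w vanishes with [u], and its square is at
    most (w - m)^2 up to the constant, as the localization requires. *)
Lemma capacity_small_mean (C eta r m : R) (x : 'rV[R]_d) (E U : set 'rV[R]_d)
    (u : 'rV[R]_d -> R) : 0 < r -> 16 * r <= eta -> 0 <= C ->
  (forall z, (\int[leb]_y (cutoff alpha eta (z, y))%:E <= (C * eta `^ (- alpha))%:E)%E) ->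
  0 <= m <= 4^-1 ->
  eball x (2 * r) `<=` D -> open U -> U `<=` D -> E `<=` U -> measurable_fun setT u ->
  censored_domain alpha D u -> (gag alpha D u < +oo)%E -> {ae leb, forall z, U z -> 1 <= u z} ->
  (capacity alpha D (eball x r `&` E) <=
    (form_const d alpha * (8 * expR 2) ^+ 2)%:E *
    (8%:E * gag alpha (D `&` eball x eta) (fun z => trunc (u z)) +
     (1024 * (C * eta `^ (- alpha)))%:E *
       l2 (D `&` eball x eta) (fun z => trunc (u z) - m)%R))%E.
Proof.
move=> r0 reta C0 HC /andP[m0 m4] xD oU UD EU mu du gu u1.
have eta0 : 0 < eta by apply: lt_le_trans reta; rewrite mulr_gt0.
have m01 : 0 <= m <= 1 by rewrite m0/=; lra.
have mw := measurable_trunc mu.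
pose fn (t : R) (z : 'rV[R]_d) : R := trunc t * (trunc t - m) * bump x eta z.
pose f (z : 'rV[R]_d) : R := trunc (u z) * (trunc (u z) - m).
have mf : measurable_fun setT f by apply: measurable_funM => //; exact: measurable_funB.
have sb := smooth_bump x eta.
have mb : measurable_fun setT (bump x eta).
  by apply: continuous_measurable_rV; have [] := sb [::].
have mv : measurable_fun setT (fun z => fn (u z) z) by exact: measurable_funM.
have b01 z : 0 <= bump x eta z <= 1 by rewrite bump_ge0 bump_le1.
have dv : censored_domain alpha D (fun z => fn (u z) z).
  apply: (@censored_domain_map _ _ _ _ mD alpha12 u fn (bump x eta) 8 (ler0n R 8) mu du gu mb).
  - exact: gag_bump_lty.
  - move=> phi tphi; apply: (test_function_zero tphi); last first.
      by move=> z; rewrite /fn => ->; rewrite trunc0 !mul0r.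
    have st := smooth_trunc (test_function_smooth tphi).
    have sA := smoothD st (smooth_cst (- m)).
    have sB := smoothM (smoothM st sA) sb.
    by rewrite (_ : (fun _ => _) = (fun z => trunc (phi z)) *
      ((fun z => trunc (phi z)) + cst (- m)) * bump x eta); [exact: sB|apply/funext].
  - move=> z t; apply: cvgM; last exact: cvg_cst.
    apply: cvgM; first exact: continuous_trunc.
    by apply: cvgB; [exact: continuous_trunc|exact: cvg_cst].
  - exact: mv.
  - by move=> s t y z _ _; exact: trunc_product_bound.
  - move=> s z _; rewrite /fn exprMn.
    have h1 : (trunc s * (trunc s - m)) ^+ 2 <= s ^+ 2.
      apply: le_trans (trunc_sqr_le s); rewrite exprMn ler_piMr ?sqr_ge0//.
      have := trunc_ge0 s; have := trunc_le1 s => p1 p0.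
      by rewrite -real_normK ?num_real// expr_le1// ler_norml; lra.
    have h2 : bump x eta z ^+ 2 <= 1 by rewrite expr_le1// ?bump_ge0 ?bump_le1.
    apply: (@le_trans _ _ (s ^+ 2 * 1)); first by apply: ler_pM; rewrite ?sqr_ge0.
    by rewrite mulr1 ler_peMl ?sqr_ge0// ler1n.
have gv := gag_localize oD x eta0 C0 HC mf mw
  (fun y z => trunc_product_diff (u y) (u z) m01) (fun z => trunc_product_sqr_le (u z) m).
have foo : (gag alpha D (fun z => fn (u z) z) < +oo)%E.
  have h : (gag alpha D (fun z => fn (u z) z) <=
      8%:E * (gag alpha D u + gag alpha D (bump x eta)))%E.
    apply: gag_leD => // y z _ _; exact: trunc_product_bound.
  apply: le_lt_trans h _; rewrite lte_mul_pinfty//.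
  by rewrite lte_add_pinfty// gag_bump_lty.
(* On the set considered w >= 1/2, w - m >= 1/4 and the bump is at least exp(-2), the radius r being
   at most eta/16. *)
pose k : R := 8 * expR 2.
have k0 : 0 < k by rewrite mulr_gt0 ?expR_gt0.
have dk := censored_domain_scale oD alpha12 k mv dv foo.
have mk : measurable_fun setT (fun z => k * fn (u z) z) by exact: measurable_funM.
have c0 := form_const_gt0 d alpha12.
apply: le_trans (@capacity_le _ _ _ _ _ (U `&` eball x r) _ _ _ _ dk _) _.
- by apply: openI => //; exact: open_eball.
- by move=> z [/UD].
- by move=> z [zr /EU].
- apply: filterS u1 => z uz [Uz zr]; have {}uz := uz Uz.
  have h1 := trunc_ge_half uz.
  have h2 : expR (- 2) <= bump x eta z.
    by apply: bump_ge => //; rewrite /eball /= in zr; have := enorm_ge0 (z - x); lra.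
  have h3 : 8^-1 <= trunc (u z) * (trunc (u z) - m).
    apply: (@le_trans _ _ (2^-1 * 4^-1)); first by lra.
    by apply: ler_pM; [rewrite invr_ge0|rewrite invr_ge0|exact: h1|lra].
  apply: (@le_trans _ _ (k * (8^-1 * expR (- 2)))).
    by rewrite /k mulrACA -expRD subrr expR0 mulr1 mulfV.
  rewrite ler_pM2l// /fn; apply: ler_pM => //; rewrite ?invr_ge0 ?expR_ge0//.
rewrite censored_form_gag// (EFinM (form_const _ _)) -muleA.
apply: lee_wpmul2l; first by rewrite lee_fin ltW.
apply: (@le_trans _ _ ((k ^+ 2)%:E * gag alpha D (fun z => fn (u z) z))%E).
  apply: gag_le => //; first exact: sqr_ge0.
  by move=> y z _ _; rewrite -mulrBr exprMn.
by apply: lee_wpmul2l; [rewrite lee_fin sqr_ge0|exact: gv].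
Qed.

End local_estimate.

Section quasi_additivity.
Variables (R : realType) (d : nat) (alpha : R) (D : set 'rV[R]_d).
Local Notation leb := (@lebesgue_rV R d).
Hypotheses (d0 : (0 < d)%N) (oD : open D) (bD : bounded_set D) (alpha12 : 1 < alpha < 2).

Let mD : measurable D. Proof. exact: measurable_open_rV. Qed.

Let alpha0 : 0 < alpha.
Proof. by have /andP[a1 _] := alpha12; rewrite (lt_trans _ a1). Qed.

Let dalpha : 0 < d%:R + alpha.
Proof. by rewrite ltr_wpDl. Qed.

Lemma local_capacity_estimate : exists2 K : R, 0 < K &
  forall (rho r : R) (x : 'rV[R]_d), interior_ball_radius D rho -> 0 < r ->
    eball x (2 * r) `<=` D -> dist_boundary D x < rho / 2 ->
    cap_radius_star alpha D r x < rho / 2 ->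
  forall (E U : set 'rV[R]_d) (u : 'rV[R]_d -> R), open U -> U `<=` D -> E `<=` U ->
    measurable_fun setT u -> censored_domain alpha D u -> (gag alpha D u < +oo)%E ->
    {ae leb, forall z, U z -> 1 <= u z} ->
  (capacity alpha D (eball x r `&` E) <=
    K%:E * (gag alpha (D `&` eball x (cap_radius_star alpha D r x)) (fun z => trunc (u z)) +
            l2 (D `&` eball x (cap_radius_star alpha D r x)) (fun z => trunc (u z))))%E.
Proof.
have /andP[a1 a2] := alpha12.
have alpha02 : 0 < alpha < 2 by rewrite alpha0.
have [C C0 HC] := kernel_cutoff d alpha02.
have [M M0 DM] := bounded_sub_eball bD.
have dR : 0 < d%:R :> R by rewrite ltr0n.
(* P eta^alpha bounds the Poincare constant 2 (2 eta)^(d + alpha) / |O|, given |O| >= (eta/d)^d. [N]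
   bounds eta^alpha uniformly, since O has volume at most (2 M)^d. *)
pose P : R := 2 * 2 `^ (d%:R + alpha) * d%:R ^+ d.
pose N : R := (2 * M * d%:R) `^ alpha.
have P0 : 0 <= P by rewrite /P !mulr_ge0 ?powR_ge0 ?exprn_ge0.
have N0 : 0 <= N by rewrite powR_ge0.
have c0 := form_const_gt0 d alpha12.
(* [A1] serves when m <= 1/4, where eta^alpha from the Poincare inequality cancels eta^(-alpha) from
   the localization; [A2] serves when m > 1/4. *)
pose A1 : R := form_const d alpha * (8 * expR 2) ^+ 2 * (8 + 1024 * (C * P)).
pose A2 : R := (2 * d%:R) ^+ d * (32 * (1 + P * N)).
have A10 : 0 <= A1.
  apply: mulr_ge0; first by apply: mulr_ge0; [exact: ltW|exact: sqr_ge0].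
  apply: addr_ge0; first exact: ler0n.
  by apply: mulr_ge0; [exact: ler0n|apply: mulr_ge0; [exact: ltW|exact: P0]].
have A20 : 0 <= A2.
  apply: mulr_ge0; first by rewrite exprn_ge0// mulr_ge0.
  by apply: mulr_ge0; [exact: ler0n|rewrite addr_ge0// mulr_ge0].
exists (A1 + A2 + 1); first by rewrite ltr_wpDl// addr_ge0.
move=> rho r x Hrho r0 xD dx srho E U u oU UD EU mu du gu u1.
set eta := cap_radius_star _ _ _ _ in srho *.
have reta : 16 * r <= eta by exact: cap_radius_star_ge.
have eta0 : 0 < eta by apply: lt_le_trans reta; rewrite mulr_gt0.
have Dx : D x by apply: xD; rewrite /eball /= subrr enorm0 mulr_gt0.
pose Om := D `&` eball x eta.
have mOm : measurable Om by apply: measurableI => //; exact: measurable_eball.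
have OmD : Om `<=` D by move=> z [].
have lOm : (((eta / d%:R) ^+ d)%:E <= leb Om)%E.
  by apply: (interior_ball_volume d0 oD Hrho Dx dx); rewrite eta0.
have ed0 : 0 < eta / d%:R by rewrite divr_gt0.
have Om0 : (0 < leb Om)%E by apply: lt_le_trans lOm; rewrite lte_fin exprn_gt0.
have OmM : (leb Om <= ((2 * M) ^+ d)%:E)%E.
  apply: le_trans (lebesgue_eball_le 0 (ltW M0)); apply: le_measure; rewrite ?inE//.
    exact: measurable_eball.
  exact: subset_trans DM.
have Omoo : (leb Om < +oo)%E by exact: le_lt_trans OmM (ltry _).
have etaM : eta <= 2 * M * d%:R.
  have := le_trans lOm OmM; rewrite lee_fin ler_pXn2r// ?nnegrE ?(ltW ed0) ?mulr_ge0 ?(ltW M0)//.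
  by rewrite ler_pdivrMr.
have EV : leb Om = (fine (leb Om))%:E by rewrite fineK// ge0_fin_numE.
set V := fine (leb Om) in EV.
have V0 : 0 < V by rewrite -lte_fin -EV.
have VE : eta ^+ d <= d%:R ^+ d * V.
  by rewrite EV lee_fin expr_div_n ler_pdivrMr ?exprn_gt0// mulrC in lOm.
pose w z := trunc (u z).
have mw : measurable_fun setT w by exact: measurable_trunc.
have gwu (A : set 'rV[R]_d) : measurable A -> (gag alpha A w <= gag alpha A u)%E.
  move=> mA; rewrite -[leRHS]mul1e; apply: gag_le => // y z _ _.
  by rewrite mul1r; exact: trunc_lipschitz.
have gOm : (gag alpha Om w < +oo)%E.
  by apply: le_lt_trans (gwu _ mOm) _; apply: le_lt_trans gu; exact: gag_subset.
have OmA y z : Om y -> Om z -> enorm (y - z) <= 2 * eta.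
  move=> [_ yx] [_ zx]; apply: le_trans (enorm_distD x _ _) _.
  by rewrite (enormB x z); rewrite /eball /= in yx zx; lra.
have Om01 : (0 < leb Om < +oo)%E by rewrite Om0.
have [y0 y0Om hm] := exists_mean_point dalpha mOm mw Om01 OmA gOm.
set m := w y0 in hm.
have m0 : 0 <= m by exact: trunc_ge0.
have g0 := gag_ge0 alpha Om w; have l0 := l2_ge0 Om w.
have hL : (l2 Om (fun z => w z - m)%R <= (P * eta `^ alpha)%:E * gag alpha Om w)%E.
  have -> : (l2 Om (fun z => w z - m)%R = (V^-1)%:E * (V%:E * l2 Om (fun z => w z - m)%R))%E.
    by rewrite muleA -EFinM mulVf ?mul1e// gt_eqF.
  rewrite EV in hm.
  have Vi : (0 <= (V^-1)%:E)%E by rewrite lee_fin invr_ge0 ltW.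
  apply: le_trans (lee_wpmul2l Vi hm) _.
  rewrite muleA -EFinM; apply: lee_wpmul2r => //; rewrite lee_fin.
  rewrite mulrC ler_pdivrMr// powRM ?(ltW eta0)//.
  rewrite [eta `^ (d%:R + alpha)]powRD ?(gt_eqF eta0) ?implybT// powR_mulrn ?(ltW eta0)//.
  rewrite /P; set X := 2 `^ _; set Y := eta `^ alpha.
  have -> : 2 * (X * (eta ^+ d * Y)) = 2 * X * Y * eta ^+ d by ring.
  have -> : 2 * X * d%:R ^+ d * Y * V = 2 * X * Y * (d%:R ^+ d * V) by ring.
  by apply: ler_wpM2l => //; rewrite !mulr_ge0 ?powR_ge0.
have Y0 : 0 <= eta `^ alpha by exact: powR_ge0.
have [m4|m4] := leP m 4^-1.
  have m4' : 0 <= m <= 4^-1 by rewrite m0.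
  apply: le_trans (capacity_small_mean oD bD alpha12 r0 reta (ltW C0) (fun z => HC _ z eta0)
    m4' xD oU UD EU mu du gu u1) _.
  apply: (@le_trans _ _ (A1%:E * gag alpha Om w)%E); last first.
    apply: lee_pmul; [by rewrite lee_fin|exact: g0| |by rewrite leeDl].
    by rewrite lee_fin -addrA lerDl addr_ge0.
  rewrite /A1 (EFinM (form_const d alpha * _)) -muleA; apply: lee_wpmul2l.
    by rewrite lee_fin; apply: mulr_ge0; [exact: ltW|exact: sqr_ge0].
  have CP0 : 0 <= 1024 * (C * P).
    by apply: mulr_ge0; [exact: ler0n|apply: mulr_ge0; [exact: ltW|exact: P0]].
  rewrite (EFinD 8) ge0_muleDl ?lee_fin ?ler0n//.
  apply: leeD; first exact: lexx.
  have q0 : (0 <= (1024 * (C * eta `^ (- alpha)))%:E)%E.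
    rewrite lee_fin; apply: mulr_ge0; first exact: ler0n.
    by apply: mulr_ge0; [exact: ltW|exact: powR_ge0].
  apply: le_trans (lee_wpmul2l q0 hL) _.
  rewrite muleA -EFinM; apply: lee_wpmul2r => //; rewrite lee_fin.
  rewrite powRN; set Y := eta `^ alpha.
  have Yp : 0 < Y by exact: powR_gt0.
  rewrite le_eqVlt; apply/orP; left; apply/eqP; field.
  by rewrite gt_eqF.
apply: (@le_trans _ _ (capacity alpha D (eball x r))).
  by apply: capacity_mono => z [].
apply: le_trans (capacity_le_lebesgue d0 oD bD alpha12 r0 xD) _.
apply: le_trans (lebesgue_eball_le x (ltW eta0)) _.
(* As m > 1/4, |O| is at most 16 times the squared L^2 norm on O of the constant m, and that
   constant is w minus the deviation w - m. *)
have hV : (V%:E <= (32 * (1 + P * N))%:E * (gag alpha Om w + l2 Om w))%E.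
  have h1 : (l2 Om (cst m) <= 2%:E * (l2 Om w + l2 Om (fun z => w z - m)%R))%E.
    apply: l2_leD => //; first exact: measurable_funB.
    by move=> z _ /=; have := sqr_ge0 (2 * w z - m); nra.
  have h2 : (l2 Om (cst m) = (m ^+ 2 * V)%:E)%E.
    rewrite (EFinM (m ^+ 2) V) -EV /l2.
    by have := integral_cst leb mOm (m ^+ 2)%:E; rewrite /cst; apply.
  rewrite h2 in h1.
  have h3 : (V%:E <= 16%:E * (m ^+ 2 * V)%:E)%E.
    by rewrite -EFinM lee_fin mulrA ler_peMl ?(ltW V0)//; nra.
  apply: le_trans h3 _.
  apply: (@le_trans _ _ (16%:E * (2%:E * (l2 Om w + (P * N)%:E * gag alpha Om w)))%E).
    apply: lee_wpmul2l; first by rewrite lee_fin.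
    apply: le_trans h1 _; apply: lee_wpmul2l; first by rewrite lee_fin.
    apply: leeD; first exact: lexx.
    apply: le_trans hL _; apply: lee_wpmul2r => //; rewrite lee_fin ler_wpM2l//.
    by rewrite ge0_ler_powR ?nnegrE ?(ltW alpha0) ?(ltW eta0)// (le_trans (ltW eta0)).
  have -> (t : \bar R) : (16%:E * (2%:E * t) = 32%:E * t)%E.
    by rewrite muleA -EFinM; congr (_%:E * _)%E; ring.
  rewrite (EFinM 32 (1 + _)) -muleA.
  apply: lee_wpmul2l; first by rewrite lee_fin.
  have PN0 : 0 <= P * N by rewrite mulr_ge0.
  move: (gag alpha Om w) (l2 Om w) g0 l0 => g l g0 l0.
  rewrite addeC ge0_muleDr//; apply: leeD.
    by apply: lee_wpmul2r => //; rewrite lee_fin lerDr.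
  by rewrite -[leLHS]mul1e; apply: lee_wpmul2r => //; rewrite lee_fin lerDl.
apply: (@le_trans _ _ (((2 * d%:R) ^+ d)%:E * V%:E)%E).
  by rewrite -EFinM lee_fin !exprMn -mulrA ler_wpM2l ?exprn_ge0.
have q0 : (0 <= ((2 * d%:R) ^+ d : R)%:E)%E by rewrite lee_fin exprn_ge0// mulr_ge0.
apply: le_trans (lee_wpmul2l q0 hV) _.
rewrite muleA -EFinM -/A2; apply: lee_wpmul2r; first by rewrite adde_ge0.
by rewrite lee_fin -addrA addrCA lerDl addr_ge0.
Qed.

Variable C : R.
Hypotheses (C0 : 0 < C) (friedrichsD : forall u, measurable_fun setT u ->
  censored_domain alpha D u -> (l2 D u <= C%:E * gag alpha D u)%E).

(** The squares [A j] times [A j] are disjoint inside the square of [D]; interactions between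
    different pieces are simply dropped. *)
Lemma nneseries_gag_le (A : nat -> set 'rV[R]_d) (w : 'rV[R]_d -> R) :
  (forall j, measurable (A j)) -> (forall j, A j `<=` D) -> trivIset setT A ->
  measurable_fun setT w ->
  (\sum_(0 <= j <oo) gag alpha (A j) w <= gag alpha D w)%E.
Proof.
move=> mA AD tA mw.
have mAA j : measurable (A j `*` A j) by exact: measurableX.
rewrite -ge0_integral_bigcup//.
- apply: ge0_subset_integral.
  + exact: bigcup_measurable.
  + exact: measurableX.
  + exact: measurable_gintT.
  + by move=> p _; rewrite lee_fin gint_ge0.
  + by move=> p [j _ [/AD ? /AD ?]].
- exact: measurable_gintT.
- by move=> p _; rewrite lee_fin gint_ge0.
- move=> i j _ _ [p [[p1 p2] [q1 q2]]].
  by apply: (tA i j) => //; exists p.1.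
Qed.

Lemma nneseries_l2_le (A : nat -> set 'rV[R]_d) (w : 'rV[R]_d -> R) :
  (forall j, measurable (A j)) -> (forall j, A j `<=` D) -> trivIset setT A ->
  measurable_fun setT w -> (\sum_(0 <= j <oo) l2 (A j) w <= l2 D w)%E.
Proof.
move=> mA AD tA mw.
have msq B : measurable_fun B (fun x => (w x ^+ 2)%:E).
  by apply: measurable_sqr; exact: measurable_funTS.
rewrite -ge0_integral_bigcup//.
- apply: ge0_subset_integral => //.
  + exact: bigcup_measurable.
  + by move=> p _; rewrite lee_fin sqr_ge0.
  + by move=> p [j _ /AD].
- by move=> p _; rewrite lee_fin sqr_ge0.
Qed.

Lemma capacity_quasi_superadditive : exists2 c : R, 1 < c &
  forall rho : R, interior_ball_radius D rho ->
  forall (x : nat -> 'rV[R]_d) (r : nat -> R),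
    (forall j, 0 < r j) ->
    (forall j, eball (x j) (2 * r j) `<=` D) ->
    (forall j, dist_boundary D (x j) < rho / 2) ->
    (forall j, cap_radius_star alpha D (r j) (x j) < rho / 2) ->
    trivIset setT (fun j => eball (x j) (cap_radius_star alpha D (r j) (x j))) ->
  forall E : set 'rV[R]_d,
    (\sum_(0 <= j <oo) capacity alpha D (eball (x j) (r j) `&` E) <=
     c%:E * capacity alpha D E)%E.
Proof.
have [K K0 HK] := local_capacity_estimate.
have c0 := form_const_gt0 d alpha12.
(* [K] comes from the local estimate, 1 + C from bounding energy plus L^2 norm by the energy, and
   the division passes from [gag] to the form. Adding 2 makes the constant exceed 1. *)
pose c : R := K * (1 + C) / form_const d alpha.
have cp : 0 <= c by rewrite divr_ge0 ?(ltW c0)// mulr_ge0 ?(ltW K0)// addr_ge0// ltW.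
exists (c + 2); first by rewrite ltr_wpDl// ltr1n.
move=> rho Hrho x r r0 xD dx srho tB E.
have [->|Eoo] := eqVneq (capacity alpha D E) +oo%E.
  by rewrite gt0_muley ?leey// lte_fin ltr_wpDl.
rewrite -ltey in Eoo.
have cE0 := capacity_ge0 oD alpha12 E.
apply: (@le_trans _ _ (c%:E * capacity alpha D E)%E); last first.
  by apply: lee_wpmul2r => //; rewrite lee_fin lerDl.
apply/lee_addgt0Pr => e e0.
pose e' := e / (c + 1).
have c10 : 0 < c + 1 by rewrite ltr_wpDl.
have e'0 : 0 < e' by rewrite divr_gt0.
have [U [u [oU UD EU mu [du u1 fu]]]] := capacity_approx oD alpha12 Eoo e'0.
rewrite censored_form_gag// in fu.
have foo : ((form_const d alpha)%:E * gag alpha D u < +oo)%E.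
  by apply: le_lt_trans fu _; rewrite lte_add_pinfty// ltry.
have gu : (gag alpha D u < +oo)%E.
  rewrite ltey; apply/eqP => goo; move: foo; rewrite goo.
  by rewrite gt0_muley ?lte_fin.
pose w z := trunc (u z).
have mw : measurable_fun setT w by exact: measurable_trunc.
pose Om j := D `&` eball (x j) (cap_radius_star alpha D (r j) (x j)).
have mOm j : measurable (Om j) by apply: measurableI => //; exact: measurable_eball.
have OmD j : Om j `<=` D by move=> z [].
have tOm : trivIset setT Om.
  by move=> i j _ _ [z [[_ zi] [_ zj]]]; apply: (tB i j) => //; exists z.
have gw : (gag alpha D w <= gag alpha D u)%E.
  rewrite -[leRHS]mul1e; apply: gag_le => // y z _ _.
  by rewrite mul1r; exact: trunc_lipschitz.
have lw : (l2 D w <= C%:E * gag alpha D u)%E.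
  apply: le_trans (friedrichsD mu du); rewrite -[leRHS]mul1e; apply: l2_le => // z _.
  by rewrite mul1r; exact: trunc_sqr_le.
apply: (@le_trans _ _ (\sum_(0 <= j <oo) (K%:E * (gag alpha (Om j) w + l2 (Om j) w)))%E).
  apply: lee_nneseries => [j _ _|j _]; first exact: capacity_ge0.
  exact: (HK rho (r j) (x j) Hrho (r0 j) (xD j) (dx j) (srho j) E U u oU UD EU mu du gu u1).
rewrite nneseriesZl; last by move=> j _; rewrite adde_ge0 ?gag_ge0 ?l2_ge0.
rewrite nneseriesD; last 2 first.
- by move=> j _ _; exact: gag_ge0.
- by move=> j _ _; exact: l2_ge0.
have hsum : (\sum_(0 <= j <oo) gag alpha (Om j) w + \sum_(0 <= j <oo) l2 (Om j) w <=
    (1 + C)%:E * gag alpha D u)%E.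
  rewrite EFinD ge0_muleDl ?lee_fin ?(ltW C0)// mul1e; apply: leeD.
    exact: le_trans (nneseries_gag_le mOm OmD tOm mw) gw.
  exact: le_trans (nneseries_l2_le mOm OmD tOm mw) lw.
have K0' : (0 <= K%:E)%E by rewrite lee_fin ltW.
apply: le_trans (lee_wpmul2l K0' hsum) _.
have -> : (K%:E * ((1 + C)%:E * gag alpha D u) =
    c%:E * ((form_const d alpha)%:E * gag alpha D u))%E.
  by rewrite !muleA -!EFinM /c divfK// gt_eqF.
have cp' : (0 <= c%:E)%E by rewrite lee_fin.
apply: le_trans (lee_wpmul2l cp' fu) _.
rewrite ge0_muleDr ?lee_fin ?(ltW e'0)//; apply: leeD; first exact: lexx.
rewrite -EFinM lee_fin /e' mulrCA ler_piMr ?(ltW e0)// ler_pdivrMr// mul1r lerDl//.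
Qed.

End quasi_additivity.

Theorem proposition5p2 (R : realType) (d : nat) (alpha : R)
    (D : set 'rV[R]_d) :
  (2 <= d)%N -> 1 < alpha < 2 -> bounded_set D -> C11_open D ->
  exists2 c : R, 1 < c &
    forall rho : R, interior_ball_radius D rho ->
    forall (x : nat -> 'rV[R]_d) (r : nat -> R),
      (forall j, 0 < r j) ->
      (forall j, eball (x j) (2 * r j) `<=` D) ->
      (forall j, dist_boundary D (x j) < rho / 2) ->
      (forall j, cap_radius_star alpha D (r j) (x j) < rho / 2) ->
      trivIset setT (fun j => eball (x j) (cap_radius_star alpha D (r j) (x j))) ->
    forall E : set 'rV[R]_d,
      measurable E -> E `<=` \bigcup_j eball (x j) (r j) ->
      (capacity alpha D E <=
         \sum_(0 <= j <oo) capacity alpha D (eball (x j) (r j) `&` E))%E /\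
      (\sum_(0 <= j <oo) capacity alpha D (eball (x j) (r j) `&` E) <=
         c%:E * capacity alpha D E)%E.
Proof.
move=> d2 alpha12 bD cD.
have d0 : (0 < d)%N by exact: leq_trans d2.
have [oD _] := cD.
(* Without boundary points the hypotheses on the balls are contradictory, as the interior ball
   condition at [x 0] yields one, so any constant above 1 will do. *)
have [[z zD]|nb] := pselect (exists z, boundary D z); last first.
  exists 2; first by rewrite ltr1n.
  move=> rho [rho0 Hrho] x r r0 xD dx _ _ E _ _; exfalso; apply: nb.
  have Dx : D (x 0%N).
    by apply: (xD 0%N); rewrite /eball /= subrr enorm0 mulr_gt0.
  have [|z [zD _ _]] := Hrho (x 0%N) Dx; last by exists z.
  by apply: lt_trans (dx 0%N) _; rewrite ltr_pdivrMr// ltr_pMr// ltr1n.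
have [C C0 HC] := friedrichs d0 alpha12 cD bD zD.
have [c c1 Hc] := capacity_quasi_superadditive d0 oD bD alpha12 C0 HC.
exists c => // rho Hrho x r r0 xD dx srho tB E mE EB; split; last exact: (Hc rho).
have EU : \bigcup_j (eball (x j) (r j) `&` E) = E.
  by rewrite -setI_bigcupl setIC; apply/setIidPl.
rewrite -{1}EU; exact: (capacity_sigma_subadditive oD alpha12 C0 HC).
Qed.
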